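(* Let $E$ be a bicollection and let $\partial$ be a degree $-1$ differential on the free PROP $\Gamma_P(E)$. Let $P$ be a graded PROP concentrated in degree $0$ and $\alpha:(\Gamma_P(E),\partial)\to(P,0)$ a homomorphism of dg PROPs. Suppose that $\alpha$ induces an isomorphism $H_0(\Gamma_P(E),\partial)\cong P$ and that $\Gamma_P(E)$ is $\partial_0$-acyclic in positive degrees. Suppose moreover that either (i) $\partial$ is connected and preserves the path grading, or (ii) $\partial(E)\subset\Gamma_D(E)$. Then $\alpha$ is a free resolution of the PROP $P$.
   Context: $k$ is a field of characteristic zero; everything is over $k$. A bicollection is a family $E=\{E(m,n)\}_{m,n\ge1}$ of differential graded $(\Sigma_m,\Sigma_n)$-bimodules (left $\Sigma_m$, right $\Sigma_n$, commuting actions) with $E(1,1)=0$. A PROP is a family $P=\{P(m,n)\}_{m,n\ge 1}$ of (dg) $(\Sigma_m,\Sigma_n)$-bimodules ($m$ outputs, $n$ inputs) with horizontal compositions, vertical compositions $P(m,n)\otimes P(n,l)\to P(m,l)$ and a unit in $P(1,1)$, satisfying the axioms of the endomorphism PROP $\mathrm{Hom}(V^{\otimes n},V^{\otimes m})$. A dg free PROP is a dg PROP whose underlying non-differential PROP is free, and a free resolution of $P$ is a homology isomorphism from a dg free PROP to $P$. Graphs. An $(m,n)$-graph is a finite, not necessarily connected, directed graph with no directed cycles, every vertex having valence at least three and at least one outgoing and one incoming edge, with exactly $m$ outgoing legs (outputs, labeled $1,\dots,m$) and $n$ incoming legs (inputs, labeled $1,\dots,n$); a leg is an edge with a free end. Disjoint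 unions of directed edges without vertices are allowed. Isomorphisms fix the legs. Free PROP. $E(G):=\bigotimes_{v\in v(G)}E(\mathrm{Out}(v),\mathrm{In}(v))$ (unordered tensor product over vertices, $k$ for a vertexless graph) and $\Gamma_P(E)(m,n)=\bigoplus_G E(G)_{\mathrm{Aut}(G)}$ (coinvariants), over isomorphism classes of $(m,n)$-graphs, with disjoint union and grafting as compositions. Elements of $E(G)_{\mathrm{Aut}(G)}$ are called $G$-monomials. A differential on $\Gamma_P(E)$ is a square-zero derivation. Gradings. For a $G$-monomial $f$: $\mathrm{cmp}(f)$ is the number of connected components of $G$ minus one, $\mathrm{gen}(f)$ is the first Betti number of $G$, and $\mathrm{pth}(f)$ (path grading) is the total number of directed paths in $G$ connecting inputs with outputs. $\Gamma_D(E)\subset\Gamma_P(E)$ is the span of $G$-monomials with $G$ contractible ($\mathrm{cmp}=\mathrm{gen}=0$). Call an internal edge bad if its source vertex has at least two outputs and its target vertex has at least two inputs. $\Gamma_{\frac12P}(E)\subset\Gamma_D(E)$ is the span of $G$-monomials with $G$ contractible without bad edges, $\Gamma_{\mathrm{pth}}(E)$ the span of those with $G$ contractible with at least one bad edge, and $\Gamma_{c+g}(E)$ the span of those with $\mathrm{cmp}+\mathrm{gen}>0$, so $\Gamma_P(E)=\Gamma_{\frac12P}(E)\oplus\Gamma_{\mathrm{pth}}(E)\oplus\Gamma_{c+g}(E)$. $\partial_0$ is the derivation of $\Gamma_P(E)$ whose restriction to the generators $E$ is $\partial|_E$ followed by the projection onto $\Gamma_{\frac12P}(E)$. (Under (i)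 or (ii) one has $\partial_0^2=0$.) $\partial$ is connected if $\mathrm{cmp}(\partial(e))=0$ for each $e\in E$, i.e. $\partial(e)$ is a sum of $G$-monomials with connected $G$. ''$\partial_0$-acyclic in positive degrees'' means $H_i(\Gamma_P(E),\partial_0)=0$ for $i>0$.
   Formalization: The bicollection E, the free PROP and P are taken to be graded in non-negative degrees; with negative degrees allowed the claim fails (e.g. E generated in arity (2,1) and degree -1 with zero differential). *)

(* Defs.v *)
From HB Require Import structures.
From mathcomp Require Import all_boot all_order all_fingroup all_algebra.
From mathcomp Require Import boolp.
From mathcomp Require Import zify.

Set Implicit Arguments.
Unset Strict Implicit.
Unset Printing Implicit Defensive.

Import GRing.Theory.
Local Open Scope ring_scope.

(* The [k]-module presented by generators [T] and relations [R]: formal linear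
   combinations modulo the congruence generated by [R] and the module axioms. *)
Section PresentedModule.
Context (k : fieldType) (T : Type).

Inductive term :=
  TZero | TGen of T | TAdd of term & term | TScale of k & term.

Context (R : term -> term -> Prop).

Inductive eqt : term -> term -> Prop :=
| eqt_rel t u : R t u -> eqt t u
| eqt_refl t : eqt t t
| eqt_sym t u : eqt t u -> eqt u t
| eqt_trans t u v : eqt t u -> eqt u v -> eqt t v
| eqt_add t t' u u' : eqt t t' -> eqt u u' -> eqt (TAdd t u) (TAdd t' u')
| eqt_scale a t t' : eqt t t' -> eqt (TScale a t) (TScale a t')
| eqt_addA t u v : eqt (TAdd t (TAdd u v)) (TAdd (TAdd t u) v)
| eqt_addC t u : eqt (TAdd t u) (TAdd u t)
| eqt_add0 t : eqt (TAdd TZero t) t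
| eqt_addN t : eqt (TAdd (TScale (-1) t) t) TZero
| eqt_scaleA a b t : eqt (TScale a (TScale b t)) (TScale (a * b) t)
| eqt_scale1 t : eqt (TScale 1 t) t
| eqt_scaleDr a t u :
    eqt (TScale a (TAdd t u)) (TAdd (TScale a t) (TScale a u))
| eqt_scaleDl a b t :
    eqt (TScale (a + b) t) (TAdd (TScale a t) (TScale b t)).

HB.instance Definition _ := gen_eqMixin term.
HB.instance Definition _ := gen_choiceMixin term.

Definition eqtb (t u : term) : bool := `[< eqt t u >].

Lemma eqtb_refl : reflexive eqtb.
Proof. by move=> t; apply/asboolP; apply: eqt_refl. Qed.

Lemma eqtb_sym : symmetric eqtb.
Proof. by move=> t u; apply/asboolP/asboolP; apply: eqt_sym. Qed.

Lemma eqtb_trans : transitive eqtb.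
Proof.
move=> u t v /asboolP tu /asboolP uv; apply/asboolP; exact: eqt_trans tu uv.
Qed.

Canonical eqtb_equiv := EquivRel eqtb eqtb_refl eqtb_sym eqtb_trans.

Definition presmod := {eq_quot eqtb}%qT.
HB.instance Definition _ := Choice.on presmod.
Definition pclass (t : term) : presmod := \pi_({eq_quot eqtb})%qT t.

Lemma class_eq t u : eqt t u -> pclass t = pclass u.
Proof. by move=> tu; apply/eqmodP/asboolP. Qed.

Lemma class_inj t u : pclass t = pclass u -> eqt t u.
Proof. by move=> /eqmodP/asboolP. Qed.

Definition rep (x : presmod) : term := generic_quotient.repr (x : {eq_quot eqtb}%qT).

Lemma repK x : pclass (rep x) = x.
Proof. exact: reprK. Qed.

Lemma rep_class t : eqt (rep (pclass t)) t.
Proof. by apply: class_inj; rewrite repK. Qed.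

Definition presmod_add x y := pclass (TAdd (rep x) (rep y)).
Definition presmod_scale a x := pclass (TScale a (rep x)).

Lemma class_add t u : pclass (TAdd t u) = presmod_add (pclass t) (pclass u).
Proof.
by apply: class_eq; apply: eqt_add; apply: eqt_sym; apply: rep_class.
Qed.

Lemma class_scale a t : pclass (TScale a t) = presmod_scale a (pclass t).
Proof. by apply: class_eq; apply/eqt_scale/eqt_sym/rep_class. Qed.

Fact presmod_addA : associative presmod_add.
Proof.
move=> x y z; rewrite -(repK x) -(repK y) -(repK z) -!class_add.
exact/class_eq/eqt_addA.
Qed.

Fact presmod_addC : commutative presmod_add.
Proof.
move=> x y; rewrite -(repK x) -(repK y) -!class_add; exact/class_eq/eqt_addC.
Qed.

Fact presmod_add0 : left_id (pclass TZero) presmod_add.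
Proof. by move=> x; rewrite -(repK x) -class_add; apply/class_eq/eqt_add0. Qed.

Fact presmod_addN : left_inverse (pclass TZero) (presmod_scale (-1)) presmod_add.
Proof.
move=> x; rewrite -(repK x) -class_scale -class_add.
exact/class_eq/eqt_addN.
Qed.

HB.instance Definition _ := GRing.isZmodule.Build presmod
  presmod_addA presmod_addC presmod_add0 presmod_addN.

Fact presmod_scaleA a b x :
  presmod_scale a (presmod_scale b x) = presmod_scale (a * b) x.
Proof. by rewrite -(repK x) -!class_scale; apply/class_eq/eqt_scaleA. Qed.

Fact presmod_scale1 : left_id 1 presmod_scale.
Proof. by move=> x; rewrite -(repK x) -class_scale; apply/class_eq/eqt_scale1. Qed.

Lemma class0 : pclass TZero = 0. Proof. by []. Qed.

Lemma classD t u : pclass (TAdd t u) = pclass t + pclass u.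
Proof. exact: class_add. Qed.

Fact presmod_scaleDr : right_distributive presmod_scale +%R.
Proof.
move=> a x y; rewrite -(repK x) -(repK y) -classD -!class_scale -classD.
exact/class_eq/eqt_scaleDr.
Qed.

Fact presmod_scaleDl x : {morph presmod_scale^~ x : a b / a + b}.
Proof.
move=> a b; rewrite /= -(repK x) -!class_scale -classD.
exact/class_eq/eqt_scaleDl.
Qed.

HB.instance Definition _ := GRing.Zmodule_isLmodule.Build k presmod
  presmod_scaleA presmod_scale1 presmod_scaleDr presmod_scaleDl.

Definition pgen (x : T) : presmod := pclass (TGen x).

Lemma classZ a t : pclass (TScale a t) = a *: pclass t.
Proof. exact: class_scale. Qed.

Section Eval.
Context (M : lmodType k).

Fixpoint peval (g : T -> M) (t : term) : M :=
  match t with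
  | TZero => 0
  | TGen x => g x
  | TAdd t u => peval g t + peval g u
  | TScale a t => a *: peval g t
  end.

Definition respects (g : T -> M) :=
  forall t u, R t u -> peval g t = peval g u.

Lemma eval_eqt g : respects g -> forall t u, eqt t u -> peval g t = peval g u.
Proof.
move=> gR t u; elim=> {t u} /=.
- exact: gR.
- by [].
- by move=> t u _ ->.
- by move=> t u v _ -> _ ->.
- by move=> t t' u u' _ -> _ ->.
- by move=> a t t' _ ->.
- by move=> t u v; rewrite addrA.
- by move=> t u; rewrite addrC.
- by move=> t; rewrite add0r.
- by move=> t; rewrite scaleN1r addNr.
- by move=> a b t; rewrite scalerA.
- by move=> t; rewrite scale1r.
- by move=> a t u; rewrite scalerDr.
- by move=> a b t; rewrite scalerDl.
Qed.

(* A map on generators that respects the relations extends linearly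
   ([plift_gen], [plift_linear]). *)
Definition plift (g : T -> M) (x : presmod) : M := peval g (rep x).

Section Lift.
Context (g : T -> M) (gR : respects g).

Lemma plift_class t : plift g (pclass t) = peval g t.
Proof. exact: (eval_eqt gR (rep_class t)). Qed.

Lemma plift_gen x : plift g (pgen x) = g x.
Proof. exact: plift_class. Qed.

Lemma plift_linear : linear (plift g).
Proof.
move=> a x y; rewrite -(repK x) -(repK y) -classZ -classD.
by rewrite !plift_class.
Qed.

End Lift.
End Eval.

Lemma eval_gen t : peval pgen t = pclass t.
Proof.
elim: t => //= [t -> u ->|a t ->]; first by rewrite classD.
by rewrite classZ.
Qed.

End PresentedModule.

Section Bilinear.
Context (k : fieldType) (T1 T2 : Type).
Context (R1 : term k T1 -> term k T1 -> Prop).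
Context (R2 : term k T2 -> term k T2 -> Prop).
Context (M : lmodType k) (g : T1 -> T2 -> M).

Definition plift2 (x : presmod R1) (y : presmod R2) : M :=
  plift (fun t => plift (g t) y) x.

Lemma eval_ext (T : Type) (h h' : T -> M) t : h =1 h' -> peval h t = peval h' t.
Proof.
by move=> hh'; elim: t => //= [t -> u ->|a t ->].
Qed.

Lemma eval_exchange t u :
  peval (fun x => peval (g x) u) t = peval (fun y => peval (g^~ y) t) u.
Proof.
elim: t => /= [|x|t IHt t' IHt'|a t IHt].
- by elim: u => //= [u <- v <-|a u <-]; rewrite ?addr0 ?scaler0.
- by apply: eval_ext.
- rewrite IHt IHt'; elim: u {IHt IHt'} => /= [|//|u IHu v IHv|a u IHu].
  + by rewrite addr0.
  + by rewrite -IHu -IHv addrACA.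
  + by rewrite -IHu scalerDr.
- rewrite IHt; elim: u {IHt} => /= [|//|u IHu v IHv|b u IHu].
  + by rewrite scaler0.
  + by rewrite scalerDr IHu IHv.
  + by rewrite -IHu !scalerA mulrC.
Qed.

Hypothesis gR1 : forall y, respects R1 (g^~ y).
Hypothesis gR2 : forall x, respects R2 (g x).

Lemma plift2_respects (y : presmod R2) : respects R1 (fun x => plift (g x) y).
Proof.
move=> t u tu; rewrite /plift !eval_exchange; apply: eval_ext => z.
exact: gR1.
Qed.

Lemma plift2_gen x y : plift2 (pgen R1 x) (pgen R2 y) = g x y.
Proof.
by rewrite /plift2 (plift_gen (plift2_respects _)) (plift_gen (gR2 _)).
Qed.

Lemma plift2_linear_l (y : presmod R2) : linear (plift2^~ y).
Proof. exact: (plift_linear (plift2_respects y)). Qed.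

Lemma plift2_linear_r (x : presmod R1) : linear (plift2 x).
Proof.
move=> a y z; rewrite /plift2 /plift.
elim: (rep x) => /= [|t|t -> u ->|b t ->].
- by rewrite scaler0 addr0.
- exact: (plift_linear (gR2 _)).
- by rewrite scalerDr addrACA.
- by rewrite scalerDr !scalerA [b * a]mulrC.
Qed.

End Bilinear.

(* With the product of mathcomp permutations, [(s * t) i = t (s i)]. Reading an
   element as an operation, output [j] of [la s x] is output [s j] of [x], and
   input [i] of [x] is input [t i] of [ra t x]; both rules give a left and a
   right action, respectively, and [ra s x] composes with [y] as [x] composes
   with [la s y]. *)
Record is_bimodule (k : fieldType) (M : lmodType k) (m n : nat)
    (la : 'S_m -> M -> M) (ra : 'S_n -> M -> M) : Prop := IsBimodule {
  bimod_l_linear : forall s, linear (la s);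
  bimod_r_linear : forall t, linear (ra t);
  bimod_l1 : forall x, la 1%g x = x;
  bimod_lM : forall s s' x, la (s * s')%g x = la s (la s' x);
  bimod_r1 : forall x, ra 1%g x = x;
  bimod_rM : forall t t' x, ra (t * t')%g x = ra t' (ra t x);
  bimod_lr : forall s t x, la s (ra t x) = ra t (la s x)
}.

(* [bc_mod m n d] is the degree-[d] part; complexes are non-negatively graded, so
   that "acyclic in positive degrees" leaves only degree 0. Families indexed by
   [m, n >= 1] are extended by zero, here and in [is_prop]. The free PROP depends
   only on the underlying graded bimodules, not on [bc_d]: a differential on it
   is any square-zero derivation. *)
Record bicollection (k : fieldType) := Bicollection {
  bc_mod :> nat -> nat -> nat -> lmodType k;
  bc_l : forall m n d, 'S_m -> bc_mod m n d -> bc_mod m n d;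
  bc_r : forall m n d, 'S_n -> bc_mod m n d -> bc_mod m n d;
  bc_d : forall m n d, bc_mod m n d.+1 -> bc_mod m n d;
  bc_bimod : forall m n d, is_bimodule (@bc_l m n d) (@bc_r m n d);
  bc_d_linear : forall m n d, linear (@bc_d m n d);
  bc_d_l : forall m n d s x, bc_d (@bc_l m n d.+1 s x) = bc_l s (bc_d x);
  bc_d_r : forall m n d t x, bc_d (@bc_r m n d.+1 t x) = bc_r t (bc_d x);
  bc_dd : forall m n d (x : bc_mod m n d.+2), bc_d (bc_d x) = 0;
  bc_pos : forall m n d (x : bc_mod m n d), (m == 0%N) || (n == 0%N) -> x = 0;
  bc_11 : forall d (x : bc_mod 1 1 d), x = 0
}.
Arguments bc_l {k b m n d}.
Arguments bc_r {k b m n d}.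
Arguments bc_d {k b m n d}.

Section BlockPerm.

Definition ord_case (A : Type) (a b : nat) (f : 'I_a -> A) (g : 'I_b -> A)
    (i : 'I_(a + b)) : A :=
  match split i with inl u => f u | inr w => g w end.

Lemma ord_caseL A a b (f : 'I_a -> A) (g : 'I_b -> A) u :
  ord_case f g (lshift b u) = f u.
Proof. by rewrite /ord_case (unsplitK (inl u)). Qed.

Lemma ord_caseR A a b (f : 'I_a -> A) (g : 'I_b -> A) w :
  ord_case f g (rshift a w) = g w.
Proof. by rewrite /ord_case (unsplitK (inr w)). Qed.

Variant ord_sum_spec a b : 'I_(a + b) -> Prop :=
| OrdSumL u : ord_sum_spec (lshift b u)
| OrdSumR w : ord_sum_spec (rshift a w).

Lemma ord_sumP a b i : @ord_sum_spec a b i.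
Proof. by rewrite -(splitK i); case: (split i) => u; constructor. Qed.

(* [bsum s t] is the block sum of permutations, [bswap a b] moves the first [a]
   points past the last [b] ones. *)
Definition bsum_fun a b (s : 'S_a) (t : 'S_b) : 'I_(a + b) -> 'I_(a + b) :=
  ord_case (fun u => lshift b (s u)) (fun w => rshift a (t w)).

Lemma bsum_inj a b s t : injective (@bsum_fun a b s t).
Proof.
rewrite /bsum_fun => i j.
case: (ord_sumP i) => u; case: (ord_sumP j) => w; rewrite !(ord_caseL, ord_caseR).
- by move/lshift_inj/perm_inj->.
- by move=> /eqP; rewrite eq_lrshift.
- by move=> /eqP; rewrite eq_rlshift.
- by move/rshift_inj/perm_inj->.
Qed.

Definition bsum a b s t : 'S_(a + b) := perm (@bsum_inj a b s t).

Definition bswap_fun a b : 'I_(a + b) -> 'I_(a + b) :=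
  ord_case (fun u => cast_ord (addnC b a) (rshift b u))
           (fun w => cast_ord (addnC b a) (lshift a w)).

Lemma bswap_inj a b : injective (@bswap_fun a b).
Proof.
rewrite /bswap_fun => i j.
case: (ord_sumP i) => u; case: (ord_sumP j) => w;
  rewrite !(ord_caseL, ord_caseR) => /cast_ord_inj.
- by move/rshift_inj->.
- by move=> /eqP; rewrite eq_rlshift.
- by move=> /eqP; rewrite eq_lrshift.
- by move/lshift_inj->.
Qed.

Definition bswap a b : 'S_(a + b) := perm (@bswap_inj a b).

End BlockPerm.

(* [M] is the direct sum of the subspaces [deg d], [d >= 0]. *)
Record is_grading (k : fieldType) (M : lmodType k)
    (deg : nat -> M -> Prop) : Prop := IsGrading {
  grading0 : forall d, deg d 0;
  grading_lin : forall d a x y, deg d x -> deg d y -> deg d (a *: x + y);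
  grading_sum : forall x, exists (D : nat) (f : nat -> M),
    (forall d, deg d (f d)) /\ x = \sum_(d < D) f d;
  grading_free : forall (D : nat) (f : nat -> M),
    (forall d, deg d (f d)) -> \sum_(d < D) f d = 0 ->
    forall d, (d < D)%N -> f d = 0
}.

(* [pr_deg d x]: [x] is homogeneous of degree [d]; [m] counts outputs and [n]
   inputs; [vcomp x y] feeds the outputs of [y] into the inputs of [x]. *)
Record prop_data (k : fieldType) := PropData {
  pr_mod :> nat -> nat -> lmodType k;
  pr_deg : forall m n, nat -> pr_mod m n -> Prop;
  pr_l : forall m n, 'S_m -> pr_mod m n -> pr_mod m n;
  pr_r : forall m n, 'S_n -> pr_mod m n -> pr_mod m n;
  hcomp : forall m1 n1 m2 n2,
    pr_mod m1 n1 -> pr_mod m2 n2 -> pr_mod (m1 + m2) (n1 + n2);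
  vcomp : forall m n l, pr_mod m n -> pr_mod n l -> pr_mod m l;
  pr_one : pr_mod 1 1
}.
Arguments pr_deg {k p m n}.
Arguments pr_l {k p m n}.
Arguments pr_r {k p m n}.
Arguments hcomp {k p m1 n1 m2 n2}.
Arguments vcomp {k p m n l}.
Arguments pr_one {k p}.

Fixpoint pr_id (k : fieldType) (P : prop_data k) (n : nat) : P n.+1 n.+1 :=
  match n return P n.+1 n.+1 with
  | 0 => pr_one
  | n'.+1 => hcomp pr_one (pr_id P n')
  end.

Definition pr_cast (k : fieldType) (P : prop_data k) (m m' n n' : nat)
    (em : m = m') (en : n = n') (x : P m n) : P m' n' :=
  ecast m (P m n') em (ecast n (P m n) en x).

Record is_prop (k : fieldType) (P : prop_data k) : Prop := IsProp {
  prop_pos : forall m n (x : P m n), (m == 0%N) || (n == 0%N) -> x = 0;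
  prop_bimod : forall m n, is_bimodule (@pr_l k P m n) (@pr_r k P m n);
  prop_grading : forall m n, is_grading (@pr_deg k P m n);
  prop_deg_l : forall m n d s (x : P m n), pr_deg d x -> pr_deg d (pr_l s x);
  prop_deg_r : forall m n d t (x : P m n), pr_deg d x -> pr_deg d (pr_r t x);
  prop_deg_h : forall m1 n1 m2 n2 d e (x : P m1 n1) (y : P m2 n2),
    pr_deg d x -> pr_deg e y -> pr_deg (d + e) (hcomp x y);
  prop_deg_v : forall m n l d e (x : P m n) (y : P n l),
    pr_deg d x -> pr_deg e y -> pr_deg (d + e) (vcomp x y);
  prop_deg_one : pr_deg 0 (pr_one : P 1 1);
  prop_h_linear_l : forall m1 n1 m2 n2 (y : P m2 n2),
    linear (fun x : P m1 n1 => hcomp x y);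
  prop_h_linear_r : forall m1 n1 m2 n2 (x : P m1 n1),
    linear (fun y : P m2 n2 => hcomp x y);
  prop_v_linear_l : forall m n l (y : P n l),
    linear (fun x : P m n => vcomp x y);
  prop_v_linear_r : forall m n l (x : P m n),
    linear (fun y : P n l => vcomp x y);
  prop_vA : forall m n l o (x : P m n) (y : P n l) (z : P l o),
    vcomp x (vcomp y z) = vcomp (vcomp x y) z;
  prop_v1 : forall m n (x : P m n.+1), vcomp x (pr_id P n) = x;
  prop_1v : forall m n (x : P m.+1 n), vcomp (pr_id P m) x = x;
  prop_v_l : forall m n l s (x : P m n) (y : P n l),
    vcomp (pr_l s x) y = pr_l s (vcomp x y);
  prop_v_r : forall m n l t (x : P m n) (y : P n l),
    vcomp x (pr_r t y) = pr_r t (vcomp x y);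
  prop_v_lr : forall m n l s (x : P m n) (y : P n l),
    vcomp (pr_r s x) y = vcomp x (pr_l s y);
  prop_hA : forall m1 n1 m2 n2 m3 n3
      (x : P m1 n1) (y : P m2 n2) (z : P m3 n3),
    hcomp (hcomp x y) z
      = pr_cast (addnA m1 m2 m3) (addnA n1 n2 n3) (hcomp x (hcomp y z));
  prop_h_l : forall m1 n1 m2 n2 s1 s2 (x : P m1 n1) (y : P m2 n2),
    hcomp (pr_l s1 x) (pr_l s2 y) = pr_l (bsum s1 s2) (hcomp x y);
  prop_h_r : forall m1 n1 m2 n2 t1 t2 (x : P m1 n1) (y : P m2 n2),
    hcomp (pr_r t1 x) (pr_r t2 y) = pr_r (bsum t1 t2) (hcomp x y);
  prop_hC : forall m1 n1 m2 n2 d e (x : P m1 n1) (y : P m2 n2),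
    pr_deg d x -> pr_deg e y ->
    pr_cast (addnC m2 m1) (addnC n2 n1) (hcomp y x)
      = (-1) ^+ (d * e) *:
        pr_l (bswap m1 m2)^-1%g (pr_r (bswap n1 n2) (hcomp x y));
  prop_hv : forall m1 n1 l1 m2 n2 l2 d e
      (x1 : P m1 n1) (x2 : P m2 n2) (y1 : P n1 l1) (y2 : P n2 l2),
    pr_deg d x2 -> pr_deg e y1 ->
    vcomp (hcomp x1 x2) (hcomp y1 y2)
      = (-1) ^+ (d * e) *: hcomp (vcomp x1 y1) (vcomp x2 y2)
}.

Definition endo (k : fieldType) (P : prop_data k) :=
  forall m n, P m n -> P m n.

Record is_derivation (k : fieldType) (P : prop_data k) (D : endo P) : Prop :=
    IsDerivation {
  der_linear : forall m n, linear (@D m n);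
  der_deg : forall m n d (x : P m n), pr_deg d.+1 x -> pr_deg d (D m n x);
  der_deg0 : forall m n (x : P m n), pr_deg 0 x -> D m n x = 0;
  der_l : forall m n s (x : P m n), D m n (pr_l s x) = pr_l s (D m n x);
  der_r : forall m n t (x : P m n), D m n (pr_r t x) = pr_r t (D m n x);
  der_h : forall m1 n1 m2 n2 d (x : P m1 n1) (y : P m2 n2), pr_deg d x ->
    D _ _ (hcomp x y) = hcomp (D _ _ x) y + (-1) ^+ d *: hcomp x (D _ _ y);
  der_v : forall m n l d (x : P m n) (y : P n l), pr_deg d x ->
    D _ _ (vcomp x y) = vcomp (D _ _ x) y + (-1) ^+ d *: vcomp x (D _ _ y)
}.

Definition is_differential (k : fieldType) (P : prop_data k) (D : endo P) :=
  is_derivation D /\ forall m n (x : P m n), D m n (D m n x) = 0.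

Definition zero_endo (k : fieldType) (P : prop_data k) : endo P :=
  fun m n _ => 0.

Record is_dg_hom (k : fieldType) (P Q : prop_data k) (dP : endo P) (dQ : endo Q)
    (f : forall m n, P m n -> Q m n) : Prop := IsDgHom {
  hom_linear : forall m n, linear (@f m n);
  hom_deg : forall m n d (x : P m n), pr_deg d x -> pr_deg d (f m n x);
  hom_l : forall m n s (x : P m n), f m n (pr_l s x) = pr_l s (f m n x);
  hom_r : forall m n t (x : P m n), f m n (pr_r t x) = pr_r t (f m n x);
  hom_h : forall m1 n1 m2 n2 (x : P m1 n1) (y : P m2 n2),
    f _ _ (hcomp x y) = hcomp (f _ _ x) (f _ _ y);
  hom_v : forall m n l (x : P m n) (y : P n l),
    f _ _ (vcomp x y) = vcomp (f _ _ x) (f _ _ y);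
  hom_one : f 1 1 pr_one = pr_one;
  hom_d : forall m n (x : P m n), f m n (dP m n x) = dQ m n (f m n x)
}.

Section Homology.
Context (k : fieldType) (P : prop_data k) (dP : endo P).

Definition cycle_at (i m n : nat) (x : P m n) : Prop :=
  pr_deg i x /\ dP x = 0.

(* Equality of the homology classes of two [i]-cycles. *)
Definition homologous (i m n : nat) (x y : P m n) : Prop :=
  exists2 z : P m n, pr_deg i.+1 z & x - y = dP z.

Definition homology_vanishes (i : nat) : Prop :=
  forall m n (x : P m n), cycle_at i x -> homologous i x 0.

End Homology.

(* Bijectivity of the map induced by [f] from [H_i(P, dP)] to [H_i(Q, dQ)]. *)
Definition homology_iso (k : fieldType) (P Q : prop_data k)
    (dP : endo P) (dQ : endo Q) (f : forall m n, P m n -> Q m n) (i : nat) :=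
  forall m n,
    (forall x x' : P m n, cycle_at dP i x -> cycle_at dP i x' ->
       homologous dQ i (f m n x) (f m n x') -> homologous dP i x x') /\
    (forall y : Q m n, cycle_at dQ i y ->
       exists2 x : P m n, cycle_at dP i x & homologous dQ i (f m n x) y).

Section Rank.
Context (T : finType) (e : rel T).

Definition acyclic_rel := forall c : seq T, path.cycle e c -> c = [::].

Lemma acyclic_rankP :
  acyclic_rel <-> exists rk : T -> nat, forall x y, e x y -> (rk x < rk y)%N.
Proof.
split=> [ac|[rk rkP] [//|x p]].
- exists (fun x => #|[pred z | connect e z x]|) => x y exy.
  apply: proper_card; apply/properP; split.
    by apply/subsetP => z; rewrite !inE => /connect_trans; apply; apply: connect1.
  exists y; rewrite !inE ?connect0 //; apply/negP => /connectP [p pP xE].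
  have := ac (y :: p); rewrite /= rcons_path pP -xE exy.
  by move=> /(_ isT).
- rewrite /= => /(sub_path rkP) /(@order_path_min _ [rel u v | rk u < rk v]%N).
  have tr : transitive [rel u v | rk u < rk v]%N.
    by move=> u v w; apply: ltn_trans.
  move=> /(_ tr); rewrite all_rcons => /andP[].
  by rewrite /= ltnn.
Qed.

End Rank.

Section Ports.

Definition port (N : nat) (a : 'I_N -> nat) := {v : 'I_N & 'I_(a v)}.

Lemma port_eq N (a : 'I_N -> nat) (p q : port a) :
  tag p = tag q -> tagged p = tagged q :> nat -> p = q.
Proof.
case: p q => u i [v j] /= uv; subst v => /= ij.
by congr existT; apply: val_inj.
Qed.

Context (N1 N2 : nat) (a1 : 'I_N1 -> nat) (a2 : 'I_N2 -> nat).
Local Notation a := (ord_case a1 a2).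

Definition portl (p : port a1) : port a :=
  Tagged (fun v => 'I_(a v))
    (cast_ord (esym (ord_caseL a1 a2 (tag p))) (tagged p)).

Definition portr (p : port a2) : port a :=
  Tagged (fun v => 'I_(a v))
    (cast_ord (esym (ord_caseR a1 a2 (tag p))) (tagged p)).

Definition port_split (q : port a) : port a1 + port a2 :=
  match split (tag q) as s
    return 'I_(match s with inl u => a1 u | inr w => a2 w end) ->
           port a1 + port a2 with
  | inl u => fun i => inl (Tagged (fun v => 'I_(a1 v)) i)
  | inr w => fun i => inr (Tagged (fun v => 'I_(a2 v)) i)
  end (tagged q).

Lemma port_splitK :
  cancel port_split (fun s => match s with inl p => portl p | inr p => portr p end).
Proof.
case=> v i; apply: port_eq; rewrite /port_split /=.
  by move: i; rewrite /ord_case; have := splitK v; case: (split v).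
by move: i; rewrite /ord_case; case: (split v).
Qed.

Lemma portl_inj : injective portl.
Proof.
move=> p q pq; apply: port_eq.
  by apply: (@lshift_inj N1 N2); apply: (congr1 (@tag _ _) pq).
have /= := congr1 (fun x : port a => nat_of_ord (tagged x)) pq.
by [].
Qed.

Lemma portr_inj : injective portr.
Proof.
move=> p q pq; apply: port_eq.
  by apply: (@rshift_inj N1 N2); apply: (congr1 (@tag _ _) pq).
have /= := congr1 (fun x : port a => nat_of_ord (tagged x)) pq.
by [].
Qed.

Lemma port_splitL p : port_split (portl p) = inl p.
Proof.
have := port_splitK (portl p); case: (port_split _) => q E.
  by rewrite (portl_inj E).
have /eqP := congr1 (@tag _ _) E; by rewrite /= eq_rlshift.
Qed.

Lemma port_splitR p : port_split (portr p) = inr p.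
Proof.
have := port_splitK (portr p); case: (port_split _) => q E.
  have /eqP := congr1 (@tag _ _) E; by rewrite /= eq_lrshift.
by rewrite (portr_inj E).
Qed.

Variant port_sum_spec : port a -> Prop :=
| PortSumL p : port_sum_spec (portl p)
| PortSumR p : port_sum_spec (portr p).

Lemma port_sumP q : port_sum_spec q.
Proof. by rewrite -(port_splitK q); case: (port_split q) => p; constructor. Qed.

End Ports.
Arguments portl {N1 N2 a1 a2}.
Arguments portr {N1 N2 a1 a2}.
Arguments port_split {N1 N2 a1 a2}.

(* A directed graph with [m] outgoing and [n] incoming legs, given by its vertices,
   their numbers of outgoing and incoming half-edges, and the matching [wire] of
   starts of edges (incoming legs and vertex outputs) with ends of edges
   (outgoing legs and vertex inputs). An edge is represented by its start. An
   edge without vertices is an incoming leg wired to an outgoing leg. *)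
Record pregraph (m n : nat) := PreGraph {
  nvert : nat;
  outs : 'I_nvert -> nat;
  ins : 'I_nvert -> nat;
  wire : 'I_n + port outs -> 'I_m + port ins
}.
Arguments outs {m n}.
Arguments ins {m n}.
Arguments wire {m n}.

Section PreGraphTheory.
Context (m n : nat) (G : pregraph m n).

Definition edge := ('I_n + port (outs G))%type.
(* Vertices together with the free ends of the legs. *)
Definition node := ('I_(nvert G) + ('I_m + 'I_n))%type.

Definition src (e : edge) : node :=
  match e with inl i => inr (inr i) | inr p => inl (tag p) end.
Definition tgt (e : edge) : node :=
  match wire G e with inl o => inr (inl o) | inr p => inl (tag p) end.

Definition adj (x y : node) : bool :=
  [exists e : edge, (src e == x) && (tgt e == y)].

Definition ncomp : nat := n_comp (fun x y => adj x y || adj y x) predT.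

Definition cmp : nat := ncomp.-1.
(* First Betti number: edges - nodes + components. *)
Definition gen_grading : nat := (#|{: edge}| + ncomp - #|{: node}|)%N.

Definition is_dipath (k : nat) (p : k.+1.-tuple edge) : bool :=
  [&& is_inl (thead p), sorted (fun e e' => tgt e == src e') p
    & is_inl (wire G (last (thead p) p))].

(* A directed path in an acyclic graph has at most [nvert G + 1] edges. *)
Definition pth : nat :=
  (\sum_(k < (nvert G).+1) #|[set p : k.+1.-tuple edge | is_dipath p]|)%N.

Definition contractible : bool := (cmp == 0%N) && (gen_grading == 0%N).

Definition bad_edge (e : edge) : bool :=
  match e, wire G e with
  | inr p, inr q => (1 < outs G (tag p))%N && (1 < ins G (tag q))%N
  | _, _ => false
  end.

Definition has_bad_edge : bool := [exists e, bad_edge e].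

Definition acyclic : Prop :=
  acyclic_rel (fun u v : 'I_(nvert G) => adj (inl u) (inl v)).

End PreGraphTheory.

Record graph (m n : nat) := Graph {
  pre :> pregraph m n;
  graph_pos : (0 < m)%N && (0 < n)%N;
  graph_val : forall v, [&& 0 < outs pre v, 0 < ins pre v
                          & 2 < outs pre v + ins pre v]%N;
  graph_wire : bijective (wire pre);
  graph_acyclic : acyclic pre
}.
Arguments graph_pos {m n} g.
Arguments graph_val {m n} g v.
Arguments graph_wire {m n} g.
Arguments graph_acyclic {m n} g [c] _.

Lemma acyclicP m n (G : pregraph m n) :
  acyclic G <->
  exists rk : 'I_(nvert G) -> nat, forall (p : port (outs G)) (q : port (ins G)),
    wire G (inr p) = inr q -> (rk (tag p) < rk (tag q))%N.
Proof.
rewrite /acyclic acyclic_rankP; split=> -[rk rkP]; exists rk.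
  move=> p q pq; apply: rkP; apply/existsP; exists (inr p).
  by rewrite /= /tgt pq !eqxx.
move=> u v /existsP[[i|p]] /andP[/eqP //= [<-]].
rewrite /tgt; case E: (wire G (inr p)) => [//|q] /eqP [<-].
exact: rkP E.
Qed.

Section Unit.

Definition unit_pregraph : pregraph 1 1 :=
  @PreGraph 1 1 0 (fun=> 0%N) (fun=> 0%N)
    (fun e => match e with inl i => inl i | inr p => inr p end).

Definition unit_graph : graph 1 1.
Proof.
apply: (@Graph _ _ unit_pregraph) => //.
- by case.
- by exists (fun e => match e with inl i => inl i | inr p => inr p end); case.
- by case=> // -[].
Defined.

End Unit.

Section Corolla.
Context (m n : nat) (hm : (0 < m)%N) (hn : (0 < n)%N) (hmn : (2 < m + n)%N).

Definition corolla_pregraph : pregraph m n :=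
  @PreGraph m n 1 (fun=> m) (fun=> n)
    (fun e => match e with
              | inl i => inr (Tagged (fun=> 'I_n) (i := ord0) i)
              | inr p => inl (tagged p)
              end).

Definition corolla_graph : graph m n.
Proof.
apply: (@Graph _ _ corolla_pregraph) => //=.
- by rewrite hm.
- by move=> v; rewrite hm hn.
- pose back (t : 'I_m + port (fun _ : 'I_1 => n)) : 'I_n + port (fun _ : 'I_1 => m) :=
    match t with
    | inl o => inr (Tagged (fun=> 'I_m) (i := ord0) o)
    | inr p => inl (tagged p)
    end.
  by exists back; case=> //= -[v i] /=; rewrite (ord1 v).
- by apply/acyclicP; exists (fun=> 0%N).
Defined.

End Corolla.

Section Relabel.
Context (m n : nat) (s : 'S_m) (t : 'S_n) (G : graph m n).

Definition relabel_pregraph : pregraph m n :=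
  @PreGraph m n (nvert G) (outs G) (ins G)
    (fun e => match wire G (match e with
                            | inl i => inl (t^-1%g i)
                            | inr p => inr p
                            end) with
              | inl o => inl (s^-1%g o)
              | inr p => inr p
              end).

Definition relabel_graph : graph m n.
Proof.
apply: (@Graph _ _ relabel_pregraph).
- exact: graph_pos G.
- exact: graph_val.
- have [w wK Kw] := graph_wire G.
  exists (fun x => match w (match x with
                            | inl o => inl (s o)
                            | inr p => inr p
                            end) with
              | inl i => inl (t i)
              | inr p => inr p
              end).
  + case=> [i|p] /=.
      case E: (wire G _) => [o|q] /=; rewrite ?permKV -E wK ?permKV //.
    by case E: (wire G _) => [o|q] /=; rewrite ?permKV -E wK.
  + case=> [o|q] /=.
      by case E: (w _) => [i|p] /=; rewrite ?permK -E Kw ?permK.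
    by case E: (w _) => [i|p] /=; rewrite ?permK -E Kw.
- have /acyclicP[rk rkP] := graph_acyclic G.
  apply/acyclicP; exists rk => p q /=.
  by case E: (wire G _) => [//|q'] [<-]; apply: rkP.
Defined.

End Relabel.

Section Vertical.
Context (m n l : nat) (G : graph m n) (H : graph n l).

Definition vcomp_tgtl (x : 'I_m + port (ins G)) : 'I_m + port (ord_case (ins G) (ins H)) :=
  match x with inl o => inl o | inr p => inr (portl p) end.

Definition vcomp_tgtr (x : 'I_n + port (ins H)) : 'I_m + port (ord_case (ins G) (ins H)) :=
  match x with inl j => vcomp_tgtl (wire G (inl j)) | inr p => inr (portr p) end.

Definition vcomp_wire (e : 'I_l + port (ord_case (outs G) (outs H))) :
    'I_m + port (ord_case (ins G) (ins H)) :=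
  match e with
  | inl i => vcomp_tgtr (wire H (inl i))
  | inr q => match port_split q with
             | inl p => vcomp_tgtl (wire G (inr p))
             | inr p => vcomp_tgtr (wire H (inr p))
             end
  end.

Definition vcomp_pregraph : pregraph m l :=
  @PreGraph m l (nvert G + nvert H) _ _ vcomp_wire.

Lemma vcomp_wire_bij : bijective vcomp_wire.
Proof.
have [w wK Kw] := graph_wire G; have [w' w'K Kw'] := graph_wire H.
pose srcH (x : 'I_l + port (outs H)) : 'I_l + port (ord_case (outs G) (outs H)) :=
  match x with inl i => inl i | inr p => inr (portr p) end.
pose srcG (x : 'I_n + port (outs G)) : 'I_l + port (ord_case (outs G) (outs H)) :=
  match x with inl j => srcH (w' (inl j)) | inr p => inr (portl p) end.
pose back (x : 'I_m + port (ord_case (ins G) (ins H))) :=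
  match x with
  | inl o => srcG (w (inl o))
  | inr q => match port_split q with
             | inl p => srcG (w (inr p))
             | inr p => srcH (w' (inr p))
             end
  end.
have backG x : back (vcomp_tgtl x) = srcG (w x).
  by case: x => [o|p] //=; rewrite port_splitL.
have backH x : back (vcomp_tgtr x) = srcH (w' x).
  by case: x => [j|p] /=; rewrite ?backG ?wK ?port_splitR.
have wireH x : vcomp_wire (srcH x) = vcomp_tgtr (wire H x).
  by case: x => [i|p] //=; rewrite port_splitR.
have wireG x : vcomp_wire (srcG x) = vcomp_tgtl (wire G x).
  by case: x => [j|p] /=; rewrite ?wireH ?Kw' ?port_splitL.
exists back.
- case=> [i|q] /=; first by rewrite backH w'K.
  by case: (port_sumP q) => p; rewrite ?port_splitL ?port_splitR ?backG ?backH ?wK ?w'K.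
- case=> [o|q] /=; first by rewrite wireG Kw.
  by case: (port_sumP q) => p; rewrite ?port_splitL ?port_splitR ?wireG ?wireH ?Kw ?Kw'.
Qed.

Lemma vcomp_acyclic : acyclic vcomp_pregraph.
Proof.
have /acyclicP[rk rkP] := graph_acyclic G.
have /acyclicP[rk' rkP'] := graph_acyclic H.
apply/acyclicP; pose K := (\max_v rk' v).+1.
exists (ord_case (fun v => K + rk v)%N rk') => p q.
have tgtlP x : vcomp_tgtl x = inr q -> exists2 q', x = inr q' & q = portl q'.
  by case: x => //= q' [<-]; exists q'.
rewrite /=; case: (port_sumP p) => {}p; rewrite ?port_splitL ?port_splitR.
  case/tgtlP=> q' E ->; rewrite /= !ord_caseL ltn_add2l; exact: rkP.
case E: (wire H _) => [j|q'] /=.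
  case/tgtlP=> q' _ ->; rewrite /= ord_caseL ord_caseR.
  by rewrite /K ltn_addr // ltnS (@leq_bigmax _ rk').
by move=> [<-]; rewrite /= !ord_caseR; apply: rkP'.
Qed.

Definition vcomp_graph : graph m l.
Proof.
apply: (@Graph _ _ vcomp_pregraph).
- by case/andP: (graph_pos G) => ->; case/andP: (graph_pos H).
- move=> v; case: (ord_sumP v) => u /=; rewrite !(ord_caseL, ord_caseR);
  exact: graph_val.
- exact: vcomp_wire_bij.
- exact: vcomp_acyclic.
Defined.

End Vertical.

Section Horizontal.
Context (m1 n1 m2 n2 : nat) (G : graph m1 n1) (H : graph m2 n2).

Definition hcomp_tgtl (x : 'I_m1 + port (ins G)) :
    'I_(m1 + m2) + port (ord_case (ins G) (ins H)) :=
  match x with inl o => inl (lshift m2 o) | inr p => inr (portl p) end.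

Definition hcomp_tgtr (x : 'I_m2 + port (ins H)) :
    'I_(m1 + m2) + port (ord_case (ins G) (ins H)) :=
  match x with inl o => inl (rshift m1 o) | inr p => inr (portr p) end.

Definition hcomp_wire (e : 'I_(n1 + n2) + port (ord_case (outs G) (outs H))) :
    'I_(m1 + m2) + port (ord_case (ins G) (ins H)) :=
  match e with
  | inl i => ord_case (fun j => hcomp_tgtl (wire G (inl j)))
                      (fun j => hcomp_tgtr (wire H (inl j))) i
  | inr q => match port_split q with
             | inl p => hcomp_tgtl (wire G (inr p))
             | inr p => hcomp_tgtr (wire H (inr p))
             end
  end.

Definition hcomp_pregraph : pregraph (m1 + m2) (n1 + n2) :=
  @PreGraph (m1 + m2) (n1 + n2) (nvert G + nvert H) _ _ hcomp_wire.

Lemma hcomp_wire_bij : bijective hcomp_wire.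
Proof.
have [w wK Kw] := graph_wire G; have [w' w'K Kw'] := graph_wire H.
pose srcH (x : 'I_n2 + port (outs H)) :
    'I_(n1 + n2) + port (ord_case (outs G) (outs H)) :=
  match x with inl i => inl (rshift n1 i) | inr p => inr (portr p) end.
pose srcG (x : 'I_n1 + port (outs G)) :
    'I_(n1 + n2) + port (ord_case (outs G) (outs H)) :=
  match x with inl j => inl (lshift n2 j) | inr p => inr (portl p) end.
pose back (x : 'I_(m1 + m2) + port (ord_case (ins G) (ins H))) :=
  match x with
  | inl o => ord_case (fun o => srcG (w (inl o))) (fun o => srcH (w' (inl o))) o
  | inr q => match port_split q with
             | inl p => srcG (w (inr p))
             | inr p => srcH (w' (inr p))
             end
  end.
have backG x : back (hcomp_tgtl x) = srcG (w x).
  by case: x => [o|p] /=; rewrite ?ord_caseL ?port_splitL.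
have backH x : back (hcomp_tgtr x) = srcH (w' x).
  by case: x => [o|p] /=; rewrite ?ord_caseR ?port_splitR.
have wireH x : hcomp_wire (srcH x) = hcomp_tgtr (wire H x).
  by case: x => [i|p] /=; rewrite ?ord_caseR ?port_splitR.
have wireG x : hcomp_wire (srcG x) = hcomp_tgtl (wire G x).
  by case: x => [i|p] /=; rewrite ?ord_caseL ?port_splitL.
exists back.
- case=> [i|q] /=.
    by case: (ord_sumP i) => j; rewrite ?ord_caseL ?ord_caseR ?backG ?backH ?wK ?w'K.
  by case: (port_sumP q) => p; rewrite ?port_splitL ?port_splitR ?backG ?backH ?wK ?w'K.
- case=> [o|q] /=.
    by case: (ord_sumP o) => j; rewrite ?ord_caseL ?ord_caseR ?wireG ?wireH ?Kw ?Kw'.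
  by case: (port_sumP q) => p; rewrite ?port_splitL ?port_splitR ?wireG ?wireH ?Kw ?Kw'.
Qed.

Lemma hcomp_acyclic : acyclic hcomp_pregraph.
Proof.
have /acyclicP[rk rkP] := graph_acyclic G.
have /acyclicP[rk' rkP'] := graph_acyclic H.
apply/acyclicP; exists (ord_case rk rk') => p q.
rewrite /=; case: (port_sumP p) => {}p; rewrite ?port_splitL ?port_splitR.
  by case E: (wire G _) => [//|q'] [<-]; rewrite /= !ord_caseL; apply: rkP.
by case E: (wire H _) => [//|q'] [<-]; rewrite /= !ord_caseR; apply: rkP'.
Qed.

Definition hcomp_graph : graph (m1 + m2) (n1 + n2).
Proof.
apply: (@Graph _ _ hcomp_pregraph).
- by case/andP: (graph_pos G) => *; case/andP: (graph_pos H) => *; rewrite !addn_gt0; apply/andP; split; apply/orP; left.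
- move=> v; case: (ord_sumP v) => u /=; rewrite !(ord_caseL, ord_caseR);
  exact: graph_val.
- exact: hcomp_wire_bij.
- exact: hcomp_acyclic.
Defined.

End Horizontal.

Definition lspan (k : fieldType) (M : lmodType k) (S : M -> Prop) (x : M) : Prop :=
  exists (r : nat) (c : 'I_r -> k) (y : 'I_r -> M),
    (forall i, S (y i)) /\ x = \sum_(i < r) c i *: y i.

Section Decorated.
Context (k : fieldType) (E : bicollection k).

(* A graph with an element of [E(Out(v), In(v))_d] at every vertex [v], i.e. a
   pure tensor of [E(G)] written in the order of the vertex numbering. *)
Record dgraph (m n : nat) := DGraph {
  und :> graph m n;
  ddeg : 'I_(nvert und) -> nat;
  dec : forall v, E (outs und v) (ins und v) (ddeg v)
}.

Record corolla := Corolla {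
  c_out : nat; c_in : nat; c_deg : nat; c_elt : E c_out c_in c_deg
}.

Definition star m n (D : dgraph m n) (v : 'I_(nvert D)) : corolla :=
  Corolla (dec v).

(* [relabeled r l c c']: [c'] is [c] with output [j] renamed [r j] and input [i]
   renamed [l i]. *)
Inductive relabeled (r l : nat -> nat) : corolla -> corolla -> Prop :=
| Relabeled a b d (e : E a b d) (s : 'S_a) (t : 'S_b) :
    (forall j : 'I_a, r (s j) = j) -> (forall i : 'I_b, l i = t i) ->
    relabeled r l (Corolla e) (Corolla (bc_l s (bc_r t e))).

Definition port_corr N N' (a : 'I_N -> nat) (a' : 'I_N' -> nat)
    (f : 'I_N -> 'I_N') (r : 'I_N -> nat -> nat) (p : port a) (p' : port a') :=
  tag p' = f (tag p) /\ tagged p' = r (tag p) (tagged p) :> nat.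

Definition corr n N N' (a : 'I_N -> nat) (a' : 'I_N' -> nat)
    (f : 'I_N -> 'I_N') (r : 'I_N -> nat -> nat)
    (x : 'I_n + port a) (x' : 'I_n + port a') : Prop :=
  match x, x' with
  | inl i, inl i' => i = i'
  | inr p, inr p' => port_corr f r p p'
  | _, _ => False
  end.

(* An isomorphism fixing the legs and carrying decorations to decorations. *)
Record dgraph_iso m n (D D' : dgraph m n) (f : 'I_(nvert D) -> 'I_(nvert D'))
    (r l : 'I_(nvert D) -> nat -> nat) : Prop := DgraphIso {
  iso_bij : bijective f;
  iso_star : forall v, relabeled (r v) (l v) (star v) (star (f v));
  iso_wire : forall e e', corr f r e e' -> corr f l (wire D e) (wire D' e')
}.

(* The Koszul sign of reordering the vertices along [f] is [(-1) ^+ koszul d f]. *)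
Definition koszul N N' (d : 'I_N -> nat) (f : 'I_N -> 'I_N') : nat :=
  (\sum_(u < N) \sum_(v < N | (u < v) && (f v < f u)) d u * d v)%N.

(* Multilinearity in each vertex presents the tensor product [E(G)]; the relations
   along isomorphisms then identify isomorphic graphs and pass to coinvariants
   under [Aut(G)], with Koszul signs making the tensor product unordered. *)
Inductive grel m n : term k (dgraph m n) -> term k (dgraph m n) -> Prop :=
| grel_lin (G : graph m n) (d : 'I_(nvert G) -> nat) v a
    (e e1 e2 : forall u, E (outs G u) (ins G u) (d u)) :
    (forall u, u != v -> e1 u = e u /\ e2 u = e u) ->
    e v = a *: e1 v + e2 v ->
    grel (TGen k (DGraph e))
         (TAdd (TScale a (TGen k (DGraph e1))) (TGen k (DGraph e2)))
| grel_iso (D D' : dgraph m n) f r l :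
    dgraph_iso (D:=D) (D':=D') f r l ->
    grel (TGen k D) (TScale ((-1) ^+ koszul (@ddeg _ _ D) f) (TGen k D')).

(* The direct sum over isomorphism classes of [(m,n)]-graphs [G] of the coinvariants
   of [E(G)] under [Aut(G)]. *)
Definition freemod m n := presmod (@grel m n).
HB.instance Definition _ m n := GRing.Lmodule.on (freemod m n).

Definition mono m n (D : dgraph m n) : freemod m n := pgen (@grel m n) D.

Lemma mono_lin m n (G : graph m n) (d : 'I_(nvert G) -> nat) v a
    (e e1 e2 : forall u, E (outs G u) (ins G u) (d u)) :
  (forall u, u != v -> e1 u = e u /\ e2 u = e u) -> e v = a *: e1 v + e2 v ->
  mono (DGraph e) = a *: mono (DGraph e1) + mono (DGraph e2).
Proof.
move=> eu ev; rewrite /mono /pgen -classZ -classD; apply: class_eq.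
by apply: eqt_rel; apply: grel_lin eu ev.
Qed.

Lemma mono_iso m n (D D' : dgraph m n) f r l :
  dgraph_iso (D:=D) (D':=D') f r l ->
  mono D = (-1) ^+ koszul (@ddeg _ _ D) f *: mono D'.
Proof.
move=> i; rewrite /mono /pgen -classZ; apply: class_eq.
by apply: eqt_rel; apply: grel_iso i.
Qed.

Lemma koszul_id N (d : 'I_N -> nat) : koszul d id = 0%N.
Proof.
rewrite /koszul big1 // => u _; rewrite big1 // => v /andP[uv vu].
by have := ltn_trans uv vu; rewrite ltnn.
Qed.

Lemma relabeled_id c : relabeled id id c c.
Proof.
case: c => a b d e.
have {2}-> : e = bc_l 1%g (bc_r 1%g e).
  have B := bc_bimod E a b d.
  by rewrite (bimod_l1 B) (bimod_r1 B).
by constructor=> i; rewrite perm1.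
Qed.

Lemma corr_id n N (a : 'I_N -> nat) (x x' : 'I_n + port a) :
  corr id (fun=> id) x x' -> x = x'.
Proof.
case: x x' => [i|p] [i'|p'] //=; first by move->.
by case=> tp vp; congr inr; apply: port_eq.
Qed.

Lemma iso_id m n (D : dgraph m n) :
  dgraph_iso (D:=D) (D':=D) id (fun=> id) (fun=> id).
Proof.
split; first by exists id.
- by move=> v; apply: relabeled_id.
- move=> e e' /corr_id <-; by case: (wire D e) => /=.
Qed.

Section Cat.
Context (N1 N2 : nat) (o1 i1 d1 : 'I_N1 -> nat) (o2 i2 d2 : 'I_N2 -> nat).

Definition dec_case (e1 : forall v, E (o1 v) (i1 v) (d1 v))
    (e2 : forall v, E (o2 v) (i2 v) (d2 v)) (v : 'I_(N1 + N2)) :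
    E (ord_case o1 o2 v) (ord_case i1 i2 v) (ord_case d1 d2 v) :=
  match split v as s
    return E (match s with inl u => o1 u | inr w => o2 w end)
             (match s with inl u => i1 u | inr w => i2 w end)
             (match s with inl u => d1 u | inr w => d2 w end) with
  | inl u => e1 u
  | inr w => e2 w
  end.

Lemma dec_caseL e1 e2 u : Corolla (dec_case e1 e2 (lshift N2 u)) = Corolla (e1 u).
Proof.
rewrite /dec_case /ord_case; have := unsplitK (inl u : 'I_N1 + 'I_N2) => /=.
by move: (split _) => s ->.
Qed.

Lemma dec_caseR e1 e2 w : Corolla (dec_case e1 e2 (rshift N1 w)) = Corolla (e2 w).
Proof.
rewrite /dec_case /ord_case; have := unsplitK (inr w : 'I_N1 + 'I_N2) => /=.
by move: (split _) => s ->.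
Qed.

Lemma dec_case_lin_l e e1 e2 f v a :
  (forall u, u != v -> e1 u = e u /\ e2 u = e u) -> e v = a *: e1 v + e2 v ->
  (forall u, u != lshift N2 v ->
     dec_case e1 f u = dec_case e f u /\ dec_case e2 f u = dec_case e f u) /\
  dec_case e f (lshift N2 v)
    = a *: dec_case e1 f (lshift N2 v) + dec_case e2 f (lshift N2 v).
Proof.
move=> eu ev; split=> [u|].
  rewrite /dec_case /ord_case; have := splitK u; case: (split u) => w //= <- wv.
  by apply: (eu w); apply: contra_neq wv => ->.
rewrite /dec_case /ord_case; have := unsplitK (inl v : 'I_N1 + 'I_N2) => /=.
by move: (split _) => s ->.
Qed.

Lemma dec_case_lin_r e e1 e2 f v a :
  (forall u, u != v -> e1 u = e u /\ e2 u = e u) -> e v = a *: e1 v + e2 v ->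
  (forall u, u != rshift N1 v ->
     dec_case f e1 u = dec_case f e u /\ dec_case f e2 u = dec_case f e u) /\
  dec_case f e (rshift N1 v)
    = a *: dec_case f e1 (rshift N1 v) + dec_case f e2 (rshift N1 v).
Proof.
move=> eu ev; split=> [u|].
  rewrite /dec_case /ord_case; have := splitK u; case: (split u) => w //= <- wv.
  by apply: (eu w); apply: contra_neq wv => ->.
rewrite /dec_case /ord_case; have := unsplitK (inr v : 'I_N1 + 'I_N2) => /=.
by move: (split _) => s ->.
Qed.

End Cat.

Definition unit_dgraph : dgraph 1 1 :=
  @DGraph 1 1 unit_graph (fun=> 0%N) (fun v : 'I_0 => match notF (ltn_ord v) with end).

Definition corolla_dgraph m n d (hm : (0 < m)%N) (hn : (0 < n)%N)
    (hmn : (2 < m + n)%N) (e : E m n d) : dgraph m n :=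
  @DGraph m n (corolla_graph hm hn hmn) (fun=> d) (fun=> e).

Definition relabel_dgraph m n (s : 'S_m) (t : 'S_n) (D : dgraph m n) :=
  @DGraph m n (relabel_graph s t D) (@ddeg _ _ D) (@dec _ _ D).

Definition vcomp_dgraph m n l (D : dgraph m n) (D' : dgraph n l) : dgraph m l :=
  @DGraph m l (vcomp_graph D D') _ (dec_case (@dec _ _ D) (@dec _ _ D')).

Definition hcomp_dgraph m1 n1 m2 n2 (D : dgraph m1 n1) (D' : dgraph m2 n2) :
    dgraph (m1 + m2) (n1 + n2) :=
  @DGraph _ _ (hcomp_graph D D') _ (dec_case (@dec _ _ D) (@dec _ _ D')).

Lemma koszul_case N1 N2 N1' N2' (d1 : 'I_N1 -> nat) (d2 : 'I_N2 -> nat)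
    (f1 : 'I_N1 -> 'I_N1') (f2 : 'I_N2 -> 'I_N2') :
  koszul (ord_case d1 d2)
    (ord_case (fun u => lshift N2' (f1 u)) (fun u => rshift N1' (f2 u)))
  = (koszul d1 f1 + koszul d2 f2)%N.
Proof.
rewrite /koszul big_split_ord /=; congr (_ + _)%N; apply: eq_bigr => u _.
- rewrite big_split_ord /= [X in (_ + X)%N]big1 ?addn0.
    by apply: eq_big => v; rewrite !ord_caseL.
  move=> v /andP[_]; rewrite ord_caseL ord_caseR /= => lt.
  by have := ltn_trans (leq_ltn_trans (leq_addr _ _) lt) (ltn_ord (f1 u)); rewrite ltnn.
- rewrite big_split_ord /= big1 ?add0n.
    by apply: eq_big => v; rewrite !ord_caseR /= !ltn_add2l.
  move=> v /andP[] /= lt.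
  by have := ltn_trans (leq_ltn_trans (leq_addr _ _) lt) (ltn_ord v); rewrite ltnn.
Qed.

Lemma bij_case N1 N2 N1' N2' (f1 : 'I_N1 -> 'I_N1') (f2 : 'I_N2 -> 'I_N2') :
  bijective f1 -> bijective f2 ->
  bijective (ord_case (fun u => lshift N2' (f1 u)) (fun u => rshift N1' (f2 u))).
Proof.
move=> [g1 f1K g1K] [g2 f2K g2K].
exists (ord_case (fun u => lshift N2 (g1 u)) (fun u => rshift N1 (g2 u))) => v;
case: (ord_sumP v) => u; rewrite !(ord_caseL, ord_caseR) ?f1K ?f2K ?g1K ?g2K //.
Qed.

Section CorrCat.
Context (N1 N2 N1' N2' : nat) (a1 : 'I_N1 -> nat) (a2 : 'I_N2 -> nat).
Context (a1' : 'I_N1' -> nat) (a2' : 'I_N2' -> nat).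
Context (f1 : 'I_N1 -> 'I_N1') (f2 : 'I_N2 -> 'I_N2').
Context (r1 : 'I_N1 -> nat -> nat) (r2 : 'I_N2 -> nat -> nat).
Let f := ord_case (fun u => lshift N2' (f1 u)) (fun u => rshift N1' (f2 u)).
Let r := ord_case r1 r2.
Let a := ord_case a1 a2.
Let a' := ord_case a1' a2'.

Lemma port_corrL (p : port a1) (p' : port a1') :
  port_corr f1 r1 p p' ->
  port_corr (a := a) (a' := a') f r (portl p) (portl p').
Proof. by case=> tp vp; split; rewrite /= /f /r ord_caseL ?tp. Qed.

Lemma port_corrR (p : port a2) (p' : port a2') :
  port_corr f2 r2 p p' ->
  port_corr (a := a) (a' := a') f r (portr p) (portr p').
Proof. by case=> tp vp; split; rewrite /= /f /r ord_caseR ?tp. Qed.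

Variant port_corr_spec : port a -> port a' -> Prop :=
| PortCorrL p p' of port_corr f1 r1 p p' : port_corr_spec (portl p) (portl p')
| PortCorrR p p' of port_corr f2 r2 p p' : port_corr_spec (portr p) (portr p').

Lemma port_corrP (q : port a) (q' : port a') :
  port_corr f r q q' -> port_corr_spec q q'.
Proof.
case: (port_sumP q) => p; case: (port_sumP q') => p' [] /=; rewrite /f /r.
- by rewrite !ord_caseL => /lshift_inj tp vp; constructor.
- by rewrite ord_caseL => /eqP; rewrite eq_rlshift.
- by rewrite ord_caseR => /eqP; rewrite eq_lrshift.
- by rewrite !ord_caseR => /rshift_inj tp vp; constructor.
Qed.

End CorrCat.

Lemma star_case m1 n1 m2 n2 m1' n1' m2' n2'
    (D1 : dgraph m1 n1) (D2 : dgraph m2 n2)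
    (D1' : dgraph m1' n1') (D2' : dgraph m2' n2')
    (f1 : 'I_(nvert D1) -> 'I_(nvert D1')) (f2 : 'I_(nvert D2) -> 'I_(nvert D2'))
    (r1 l1 : 'I_(nvert D1) -> nat -> nat) (r2 l2 : 'I_(nvert D2) -> nat -> nat) :
  (forall v, relabeled (r1 v) (l1 v) (star v) (star (f1 v))) ->
  (forall v, relabeled (r2 v) (l2 v) (star v) (star (f2 v))) ->
  forall v, relabeled (ord_case r1 r2 v) (ord_case l1 l2 v)
   (Corolla (dec_case (@dec _ _ D1) (@dec _ _ D2) v))
   (Corolla (dec_case (@dec _ _ D1') (@dec _ _ D2')
      (ord_case (fun u => lshift _ (f1 u)) (fun u => rshift _ (f2 u)) v))).
Proof.
pose cat1 v := Corolla (dec_case (@dec _ _ D1) (@dec _ _ D2) v).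
pose cat2 v := Corolla (dec_case (@dec _ _ D1') (@dec _ _ D2') v).
move=> H1 H2 v; rewrite -/(cat1 v) -/(cat2 _); case: (ord_sumP v) => u.
  by rewrite !ord_caseL /cat1 /cat2 !dec_caseL; apply: H1.
by rewrite !ord_caseR /cat1 /cat2 !dec_caseR; apply: H2.
Qed.

Lemma vcomp_iso m n l (D1 D1' : dgraph m n) (D2 D2' : dgraph n l)
    f1 r1 l1 f2 r2 l2 :
  dgraph_iso (D:=D1) (D':=D1') f1 r1 l1 -> dgraph_iso (D:=D2) (D':=D2') f2 r2 l2 ->
  dgraph_iso (D:=vcomp_dgraph D1 D2) (D':=vcomp_dgraph D1' D2')
    (ord_case (fun u => lshift _ (f1 u)) (fun u => rshift _ (f2 u)))
    (ord_case r1 r2) (ord_case l1 l2).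
Proof.
move=> [b1 s1 w1] [b2 s2 w2]; split; first exact: bij_case.
  exact: star_case.
have tgtl x x' : corr f1 l1 x x' ->
    corr (ord_case (fun u => lshift _ (f1 u)) (fun u => rshift _ (f2 u)))
         (ord_case l1 l2) (vcomp_tgtl D2 x) (vcomp_tgtl D2' x').
  by case: x x' => [i|p] [i'|p'] //=; apply: port_corrL.
have tgtr x x' : corr f2 l2 x x' ->
    corr (ord_case (fun u => lshift _ (f1 u)) (fun u => rshift _ (f2 u)))
         (ord_case l1 l2) (vcomp_tgtr D1 x) (vcomp_tgtr D1' x').
  case: x x' => [i|p] [i'|p'] //=; last first.
    exact: port_corrR.
  by move=> <-; apply: tgtl; apply: w1.
move=> [i|q] [i'|q'] //=; first by move=> <-; apply: tgtr; apply: w2.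
case/port_corrP => p p' c.
  by rewrite !port_splitL; apply: tgtl; apply: w1.
by rewrite !port_splitR; apply: tgtr; apply: w2.
Qed.

Lemma hcomp_iso m1 n1 m2 n2 (D1 D1' : dgraph m1 n1) (D2 D2' : dgraph m2 n2)
    f1 r1 l1 f2 r2 l2 :
  dgraph_iso (D:=D1) (D':=D1') f1 r1 l1 -> dgraph_iso (D:=D2) (D':=D2') f2 r2 l2 ->
  dgraph_iso (D:=hcomp_dgraph D1 D2) (D':=hcomp_dgraph D1' D2')
    (ord_case (fun u => lshift _ (f1 u)) (fun u => rshift _ (f2 u)))
    (ord_case r1 r2) (ord_case l1 l2).
Proof.
move=> [b1 s1 w1] [b2 s2 w2]; split; first exact: bij_case.
  exact: star_case.
have tgtl x x' : corr f1 l1 x x' ->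
    corr (ord_case (fun u => lshift _ (f1 u)) (fun u => rshift _ (f2 u)))
         (ord_case l1 l2) (hcomp_tgtl D2 x) (hcomp_tgtl D2' x').
  case: x x' => [i|p] [i'|p'] //=; first by move->.
  exact: port_corrL.
have tgtr x x' : corr f2 l2 x x' ->
    corr (ord_case (fun u => lshift _ (f1 u)) (fun u => rshift _ (f2 u)))
         (ord_case l1 l2) (hcomp_tgtr D1 x) (hcomp_tgtr D1' x').
  case: x x' => [i|p] [i'|p'] //=; first by move->.
  exact: port_corrR.
move=> [i|q] [i'|q'] //=.
  move=> <-; case: (ord_sumP i) => j; rewrite !(ord_caseL, ord_caseR).
    by apply: tgtl; apply: w1.
  by apply: tgtr; apply: w2.
case/port_corrP => p p' c.
  by rewrite !port_splitL; apply: tgtl; apply: w1.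
by rewrite !port_splitR; apply: tgtr; apply: w2.
Qed.

Lemma relabel_iso m n s t (D D' : dgraph m n) f r l :
  dgraph_iso (D:=D) (D':=D') f r l ->
  dgraph_iso (D:=relabel_dgraph s t D) (D':=relabel_dgraph s t D') f r l.
Proof.
move=> [b st w]; split=> //= -[i|p] [i'|p'] //= c.
  rewrite c; have := w (inl (t^-1%g i')) (inl (t^-1%g i')) erefl.
  by case: (wire D _) => ?; case: (wire D' _) => ? //= ->.
have := w (inr p) (inr p') c.
by case: (wire D _) => ?; case: (wire D' _) => ? //= ->.
Qed.

Definition tdeg m n (D : dgraph m n) : nat := (\sum_v @ddeg _ _ D v)%N.

Lemma iso_ddeg m n (D D' : dgraph m n) f r l :
  dgraph_iso (D:=D) (D':=D') f r l -> forall v, ddeg (f v) = ddeg v.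
Proof.
move=> [_ st _] v.
have E1 c c' : relabeled (r v) (l v) c c' -> c_deg c' = c_deg c by case.
exact: E1 (st v).
Qed.

Lemma iso_tdeg m n (D D' : dgraph m n) f r l :
  dgraph_iso (D:=D) (D':=D') f r l -> tdeg D' = tdeg D.
Proof.
move=> i; rewrite /tdeg (reindex f) /=; last exact: onW_bij (iso_bij i).
by apply: eq_bigr => v _; apply: iso_ddeg i v.
Qed.

Lemma freemod_ind m n (Q : freemod m n -> Prop) :
  Q 0 -> (forall D, Q (mono D)) -> (forall x y, Q x -> Q y -> Q (x + y)) ->
  (forall a x, Q x -> Q (a *: x)) -> forall x, Q x.
Proof.
move=> Q0 QG QD QZ x; rewrite -(repK x).
elim: (rep x) => [|D|t Qt u Qu|a t Qt]; first by rewrite class0.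
- exact: QG.
- by rewrite classD; apply: QD.
- by rewrite classZ; apply: QZ.
Qed.

Section Lift1.
Context (m n : nat) (M : lmodType k) (g : dgraph m n -> M).

Lemma respectsP :
  (forall (G : graph m n) (d : 'I_(nvert G) -> nat) v a
      (e e1 e2 : forall u, E (outs G u) (ins G u) (d u)),
    (forall u, u != v -> e1 u = e u /\ e2 u = e u) -> e v = a *: e1 v + e2 v ->
    g (DGraph e) = a *: g (DGraph e1) + g (DGraph e2)) ->
  (forall (D D' : dgraph m n) f r l, dgraph_iso (D:=D) (D':=D') f r l ->
    g D = (-1) ^+ koszul (@ddeg _ _ D) f *: g D') ->
  respects (@grel m n) g.
Proof.
move=> glin giso _ _ [G d v a e e1 e2 eu ev|D D' f r l i] /=.
  exact: glin eu ev.
exact: giso i.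
Qed.

End Lift1.

Lemma relabel_respects m n s t :
  respects (@grel m n) (fun D => mono (relabel_dgraph s t D)).
Proof.
apply: respectsP => [G d v a e e1 e2 eu ev|D D' f r l i].
  exact: (@mono_lin m n (relabel_graph s t G) d v a e e1 e2 eu ev).
exact: mono_iso (relabel_iso s t i).
Qed.

Lemma vcomp_respects_l m n l (D' : dgraph n l) :
  respects (@grel m n) (fun D => mono (vcomp_dgraph D D')).
Proof.
apply: respectsP => [G d v a e e1 e2 eu ev|D D2 f r r' i].
  have [eu' ev'] := dec_case_lin_l (@dec _ _ D') eu ev.
  exact: (@mono_lin m l (vcomp_graph G D') _ _ a _ _ _ eu' ev').
rewrite (mono_iso (vcomp_iso i (iso_id D'))).
by rewrite (koszul_case (N2' := nvert D')) koszul_id addn0.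
Qed.

Lemma vcomp_respects_r m n l (D : dgraph m n) :
  respects (@grel n l) (fun D' => mono (vcomp_dgraph D D')).
Proof.
apply: respectsP => [G d v a e e1 e2 eu ev|D1 D2 f r r' i].
  have [eu' ev'] := dec_case_lin_r (@dec _ _ D) eu ev.
  exact: (@mono_lin m l (vcomp_graph D G) _ _ a _ _ _ eu' ev').
rewrite (mono_iso (vcomp_iso (iso_id D) i)).
by rewrite (koszul_case (N1' := nvert D)) koszul_id add0n.
Qed.

Lemma hcomp_respects_l m n m' n' (D' : dgraph m' n') :
  respects (@grel m n) (fun D => mono (hcomp_dgraph D D')).
Proof.
apply: respectsP => [G d v a e e1 e2 eu ev|D D2 f r r' i].
  have [eu' ev'] := dec_case_lin_l (@dec _ _ D') eu ev.
  exact: (@mono_lin _ _ (hcomp_graph G D') _ _ a _ _ _ eu' ev').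
rewrite (mono_iso (hcomp_iso i (iso_id D'))).
by rewrite (koszul_case (N2' := nvert D')) koszul_id addn0.
Qed.

Lemma hcomp_respects_r m n m' n' (D : dgraph m n) :
  respects (@grel m' n') (fun D' => mono (hcomp_dgraph D D')).
Proof.
apply: respectsP => [G d v a e e1 e2 eu ev|D1 D2 f r r' i].
  have [eu' ev'] := dec_case_lin_r (@dec _ _ D) eu ev.
  exact: (@mono_lin _ _ (hcomp_graph D G) _ _ a _ _ _ eu' ev').
rewrite (mono_iso (hcomp_iso (iso_id D) i)).
by rewrite (koszul_case (N1' := nvert D)) koszul_id add0n.
Qed.

Definition free_l m n (s : 'S_m) : freemod m n -> freemod m n :=
  plift (fun D => mono (relabel_dgraph s 1%g D)).

Definition free_r m n (t : 'S_n) : freemod m n -> freemod m n :=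
  plift (fun D => mono (relabel_dgraph 1%g t D)).

Definition free_v m n l : freemod m n -> freemod n l -> freemod m l :=
  plift2 (fun D D' => mono (vcomp_dgraph D D')).

Definition free_h m1 n1 m2 n2 :
    freemod m1 n1 -> freemod m2 n2 -> freemod (m1 + m2) (n1 + n2) :=
  plift2 (fun D D' => mono (hcomp_dgraph D D')).

Definition free_deg m n (d : nat) : freemod m n -> Prop :=
  lspan (fun x => exists2 D : dgraph m n, tdeg D = d & x = mono D).

Definition free_prop_data : prop_data k :=
  @PropData k (fun m n => freemod m n : lmodType k)
    free_deg free_l free_r free_h free_v (mono unit_dgraph).

Lemma free_l_mono m n s (D : dgraph m n) :
  free_l s (mono D) = mono (relabel_dgraph s 1%g D).
Proof. exact: (plift_gen (relabel_respects _ _)). Qed.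

Lemma free_r_mono m n t (D : dgraph m n) :
  free_r t (mono D) = mono (relabel_dgraph 1%g t D).
Proof. exact: (plift_gen (relabel_respects _ _)). Qed.

Lemma free_v_mono m n l (D : dgraph m n) (D' : dgraph n l) :
  free_v (mono D) (mono D') = mono (vcomp_dgraph D D').
Proof.
exact: (plift2_gen (fun D' => vcomp_respects_l D') (fun D => vcomp_respects_r D)).
Qed.

Lemma free_h_mono m1 n1 m2 n2 (D : dgraph m1 n1) (D' : dgraph m2 n2) :
  free_h (mono D) (mono D') = mono (hcomp_dgraph D D').
Proof.
exact: (plift2_gen (fun D' => hcomp_respects_l D') (fun D => hcomp_respects_r D)).
Qed.

Lemma free_l_linear m n s : linear (@free_l m n s).
Proof. exact: (plift_linear (relabel_respects _ _)). Qed.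

Lemma free_r_linear m n t : linear (@free_r m n t).
Proof. exact: (plift_linear (relabel_respects _ _)). Qed.

Lemma free_v_linear_l m n l (y : freemod n l) :
  linear (fun x : freemod m n => free_v x y).
Proof.
by have := plift2_linear_l (fun D' => @vcomp_respects_l m n l D') y.
Qed.

Lemma free_v_linear_r m n l (x : freemod m n) :
  linear (fun y : freemod n l => free_v x y).
Proof. by have := plift2_linear_r (fun D => @vcomp_respects_r m n l D) x. Qed.

Lemma free_h_linear_l m1 n1 m2 n2 (y : freemod m2 n2) :
  linear (fun x : freemod m1 n1 => free_h x y).
Proof.
by have := plift2_linear_l (fun D' => @hcomp_respects_l m1 n1 m2 n2 D') y.
Qed.

Lemma free_h_linear_r m1 n1 m2 n2 (x : freemod m1 n1) :
  linear (fun y : freemod m2 n2 => free_h x y).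
Proof. by have := plift2_linear_r (fun D => @hcomp_respects_r m1 n1 m2 n2 D) x. Qed.

Lemma mono_wire m n N (o i : 'I_N -> nat) (w w' : 'I_n + port o -> 'I_m + port i)
    h1 h2 h3 h4 h1' h2' h3' h4' d e :
  w =1 w' ->
  mono (@DGraph m n (@Graph m n (PreGraph w) h1 h2 h3 h4) d e)
  = mono (@DGraph m n (@Graph m n (PreGraph w') h1' h2' h3' h4') d e).
Proof.
move=> ww'.
have i0 : dgraph_iso
    (D := @DGraph m n (@Graph m n (PreGraph w) h1 h2 h3 h4) d e)
    (D' := @DGraph m n (@Graph m n (PreGraph w') h1' h2' h3' h4') d e)
    id (fun=> id) (fun=> id).
  split; first by exists id.
  - by move=> v; apply: relabeled_id.
  - move=> x x' /corr_id <- /=; rewrite ww'.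
    by case: (w' x) => /=.
by rewrite (mono_iso i0) koszul_id expr0 scale1r.
Qed.

End Decorated.

Section FreeAxioms.
Context (k : fieldType) (E : bicollection k).
Notation dgraph := (dgraph E).
Notation freemod := (freemod E).
Notation F := (free_prop_data E).

Lemma linD (U V : lmodType k) (f : U -> V) x y :
  linear f -> f (x + y) = f x + f y.
Proof. by move=> lf; rewrite -[x]scale1r lf !scale1r. Qed.

Lemma lin0 (U V : lmodType k) (f : U -> V) : linear f -> f 0 = 0.
Proof. by move=> lf; apply: (addrI (f 0)); rewrite -linD // !addr0. Qed.

Lemma linZ (U V : lmodType k) (f : U -> V) a x :
  linear f -> f (a *: x) = a *: f x.
Proof. by move=> lf; rewrite -[a *: x]addr0 lf lin0 // !addr0. Qed.

Lemma lin_comp (U V W : lmodType k) (f : V -> W) (g : U -> V) :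
  linear f -> linear g -> linear (fun x => f (g x)).
Proof. by move=> lf lg a x y; rewrite lg lf. Qed.

Lemma lin_scale (U V : lmodType k) (f : U -> V) b :
  linear f -> linear (fun x => b *: f x).
Proof. by move=> lf a x y; rewrite lf scalerDr !scalerA mulrC. Qed.

Lemma lin_sum (U V : lmodType k) (f : U -> V) r (c : 'I_r -> k) (y : 'I_r -> U) :
  linear f -> f (\sum_(i < r) c i *: y i) = \sum_(i < r) c i *: f (y i).
Proof.
move=> lf; elim/big_ind2: _ => [|x1 x2 y1 y2 <- <-|i _]; first exact: lin0.
  exact: linD.
exact: linZ.
Qed.

Lemma lin_ext m n (M : lmodType k) (f g : freemod m n -> M) :
  linear f -> linear g -> (forall D, f (mono D) = g (mono D)) -> f =1 g.
Proof.
move=> lf lg fg x; elim/freemod_ind: x => [|//|x y fx fy|a x fx].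
- by rewrite !lin0.
- by rewrite !linD // fx fy.
- by rewrite !linZ // fx.
Qed.

Lemma lin_ext_deg m n d (M : lmodType k) (f g : freemod m n -> M) :
  linear f -> linear g ->
  (forall D : dgraph m n, tdeg D = d -> f (mono D) = g (mono D)) ->
  forall x, free_deg d x -> f x = g x.
Proof.
move=> lf lg fg x [r [c [y [yP ->]]]]; rewrite !lin_sum //.
by apply: eq_bigr => i _; have [D Dd ->] := yP i; rewrite fg.
Qed.

Lemma lspan_gen (M : lmodType k) (S : M -> Prop) x : S x -> lspan S x.
Proof.
move=> Sx; exists 1, (fun=> 1), (fun=> x); split=> //.
by rewrite big_ord1 scale1r.
Qed.

Lemma lspan_lin (M : lmodType k) (S : M -> Prop) a x y :
  lspan S x -> lspan S y -> lspan S (a *: x + y).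
Proof.
move=> [r [c [f [fS ->]]]] [s [d [g [gS ->]]]].
exists (r + s)%N, (ord_case (fun i => a * c i) d), (ord_case f g); split.
  by move=> i; case: (ord_sumP i) => j; rewrite ?ord_caseL ?ord_caseR.
rewrite big_split_ord scaler_sumr /=; congr (_ + _).
  by apply: eq_bigr => i _; rewrite !ord_caseL scalerA.
by apply: eq_bigr => i _; rewrite !ord_caseR.
Qed.

Lemma lspan0 (M : lmodType k) (S : M -> Prop) : lspan S 0.
Proof.
exists 0, (fun=> 0), (fun=> 0); split; first by case.
by rewrite big_ord0.
Qed.

Lemma lspan_map (U V : lmodType k) (f : U -> V) (S : U -> Prop) (S' : V -> Prop) :
  linear f -> (forall x, S x -> lspan S' (f x)) ->
  forall x, lspan S x -> lspan S' (f x).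
Proof.
move=> lf H x [r [c [y [yS ->]]]]; rewrite lin_sum //.
elim/big_ind: _ => [|x1 x2 h1 h2|i _]; first exact: lspan0.
- by rewrite -[x1]scale1r; apply: lspan_lin.
- by rewrite -[_ *: _]addr0; apply: lspan_lin; [apply: H|apply: lspan0].
Qed.

Lemma free_deg_mono m n (D : dgraph m n) : free_deg (tdeg D) (mono D).
Proof. by apply: lspan_gen; exists D. Qed.

Definition port_map m N N' (i : 'I_N -> nat) (i' : 'I_N' -> nat)
    (pi : port i -> port i') (x : 'I_m + port i) : 'I_m + port i' :=
  match x with inl o => inl o | inr q => inr (pi q) end.

Lemma mono_fun m n (D D' : dgraph m n) (f : 'I_(nvert D) -> 'I_(nvert D'))
    (po : port (outs D) -> port (outs D')) (pi : port (ins D) -> port (ins D')) :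
  bijective f ->
  (forall v, star v = star (f v)) ->
  (forall p, port_corr f (fun=> id) p (po p)) ->
  (forall p, port_corr f (fun=> id) p (pi p)) ->
  (forall x, wire D' (port_map po x) = port_map pi (wire D x)) ->
  mono D = (-1) ^+ koszul (@ddeg k E _ _ D) f *: mono D'.
Proof.
move=> fB fS poP piP wf.
apply: (@mono_iso k E m n D D' f (fun=> id) (fun=> id)); split=> //.
  by move=> v; rewrite -fS; apply: relabeled_id.
have tm x : corr f (fun=> id) x (port_map pi x).
  by case: x => [i|q] //=; apply: piP.
case=> [i|p] [i'|p'] //=.
  by move=> <-; rewrite (wf (inl i)); apply: tm.
move=> [tp vp]; have [tq vq] := poP p.
have -> : p' = po p by apply: port_eq; rewrite ?tp ?vp ?tq ?vq.
by rewrite (wf (inr p)); apply: tm.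
Qed.

Definition cast_map m m' N N' (em : m = m')
    (i : 'I_N -> nat) (i' : 'I_N' -> nat)
    (pi : port i -> port i') (x : 'I_m + port i) : 'I_m' + port i' :=
  match x with inl o => inl (cast_ord em o) | inr q => inr (pi q) end.

Lemma mono_fun_cast m n m' n' (em : m = m') (en : n = n')
    (D : dgraph m n) (D' : dgraph m' n')
    (f : 'I_(nvert D) -> 'I_(nvert D'))
    (po : port (outs D) -> port (outs D')) (pi : port (ins D) -> port (ins D')) :
  bijective f ->
  (forall v, star v = star (f v)) ->
  (forall p, port_corr f (fun=> id) p (po p)) ->
  (forall p, port_corr f (fun=> id) p (pi p)) ->
  (forall x, wire D' (cast_map en po x) = cast_map em pi (wire D x)) ->
  pr_cast (P := F) em en (mono D)
  = (-1) ^+ koszul (@ddeg k E _ _ D) f *: (mono D' : F m' n').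
Proof.
subst m' n' => fB fS poP piP wf; apply: (mono_fun fB fS poP piP) => x.
have cE l N N' (i : 'I_N -> nat) (i' : 'I_N' -> nat) (p : port i -> port i')
    (y : 'I_l + port i) : cast_map erefl p y = port_map p y.
  by case: y => //= o; rewrite cast_ord_id.
by rewrite -!cE wf.
Qed.

Lemma koszul_mono N N' (d : 'I_N -> nat) (f : 'I_N -> 'I_N') :
  {homo f : u v / (u < v)%N >-> (u < v)%N} -> koszul d f = 0%N.
Proof.
move=> fH; rewrite /koszul big1 // => u _; rewrite big1 // => v /andP[uv].
by have := ltn_trans (fH _ _ uv); move=> H /H; rewrite ltnn.
Qed.

Lemma pr_cast_linear m m' n n' (em : m = m') (en : n = n') :
  linear (@pr_cast k F m m' n n' em en).
Proof. by case: _ / em; case: _ / en. Qed.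

Section Assoc.
Context (N1 N2 N3 : nat).
Definition vassoc : 'I_(N1 + (N2 + N3)) -> 'I_(N1 + N2 + N3) :=
  cast_ord (addnA N1 N2 N3).

Lemma vassocL u : vassoc (lshift _ u) = lshift _ (lshift _ u).
Proof. exact: val_inj. Qed.
Lemma vassocM u : vassoc (rshift _ (lshift _ u)) = lshift _ (rshift _ u).
Proof. exact: val_inj. Qed.
Lemma vassocR u : vassoc (rshift _ (rshift _ u)) = rshift _ u.
Proof. by apply: val_inj; rewrite /= addnA. Qed.

Lemma vassoc_bij : bijective vassoc.
Proof. exact: Bijective (cast_ordK _) (cast_ordKV _). Qed.

Context (a1 : 'I_N1 -> nat) (a2 : 'I_N2 -> nat) (a3 : 'I_N3 -> nat).

Definition passoc (p : port (ord_case a1 (ord_case a2 a3))) :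
    port (ord_case (ord_case a1 a2) a3) :=
  match port_split p with
  | inl q => portl (portl q)
  | inr q => match port_split q with
             | inl q => portl (portr q)
             | inr q => portr q
             end
  end.

Lemma passocL p : passoc (portl p) = portl (portl p).
Proof. by rewrite /passoc port_splitL. Qed.
Lemma passocM p : passoc (portr (portl p)) = portl (portr p).
Proof. by rewrite /passoc port_splitR port_splitL. Qed.
Lemma passocR p : passoc (portr (portr p)) = portr p.
Proof. by rewrite /passoc !port_splitR. Qed.

Lemma passocP p : port_corr vassoc (fun=> id) p (passoc p).
Proof.
rewrite /passoc; case: (port_sumP p) => {}p; rewrite ?port_splitL ?port_splitR.
  by split=> //=; rewrite vassocL.
case: (port_sumP p) => {}p; rewrite ?port_splitL ?port_splitR; split=> //=.
  by rewrite vassocM.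
by rewrite vassocR.
Qed.

End Assoc.

Lemma star_assoc m1 n1 m2 n2 m3 n3
    (D1 : dgraph m1 n1) (D2 : dgraph m2 n2) (D3 : dgraph m3 n3) v :
  Corolla (dec_case (@dec _ _ _ _ D1) (dec_case (@dec _ _ _ _ D2) (@dec _ _ _ _ D3)) v)
  = Corolla (dec_case (dec_case (@dec _ _ _ _ D1) (@dec _ _ _ _ D2)) (@dec _ _ _ _ D3)
      (vassoc v)).
Proof.
pose c w := Corolla (dec_case (dec_case (@dec _ _ _ _ D1) (@dec _ _ _ _ D2))
  (@dec _ _ _ _ D3) w).
rewrite -/(c _); case: (ord_sumP v) => {}v.
  by rewrite dec_caseL vassocL /c !dec_caseL.
case: (ord_sumP v) => {}v; rewrite dec_caseR.
  by rewrite dec_caseL vassocM /c dec_caseL dec_caseR.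
by rewrite dec_caseR vassocR /c dec_caseR.
Qed.

Lemma free_vA m n l o (x : freemod m n) (y : freemod n l) (z : freemod l o) :
  free_v x (free_v y z) = free_v (free_v x y) z.
Proof.
have ll := free_v_linear_l; have lr := free_v_linear_r.
move: x; apply: lin_ext => [||D1].
- exact: ll.
- exact: (lin_comp (f := fun u : freemod m l => free_v u z) (ll _ _ _ _ _ _) (ll _ _ _ _ _ _)).
move: y; apply: lin_ext => [||D2].
- exact: (lin_comp (f := fun u => free_v (mono D1) u) (lr _ _ _ _ _ _) (ll _ _ _ _ _ _)).
- exact: (lin_comp (f := fun u => free_v u z) (ll _ _ _ _ _ _) (lr _ _ _ _ _ _)).
move: z; apply: lin_ext => [||D3].
- exact: (lin_comp (f := fun u => free_v (mono D1) u) (lr _ _ _ _ _ _) (lr _ _ _ _ _ _)).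
- exact: lr.
rewrite /= !free_v_mono.
rewrite (@mono_fun _ _ (vcomp_dgraph D1 (vcomp_dgraph D2 D3))
  (vcomp_dgraph (vcomp_dgraph D1 D2) D3) (@vassoc _ _ _)
  (@passoc _ _ _ _ _ _) (@passoc _ _ _ _ _ _)).
- by rewrite koszul_mono ?expr0 ?scale1r // => u v.
- exact: vassoc_bij.
- exact: star_assoc.
- exact: passocP.
- exact: passocP.
have w1 (x : 'I_m + port (ins D1)) :
    vcomp_tgtl (G := vcomp_graph D1 D2) D3 (vcomp_tgtl D2 x)
    = port_map (@passoc _ _ _ _ _ _) (vcomp_tgtl (vcomp_dgraph D2 D3) x).
  by case: x => //= q; rewrite /passoc port_splitL.
have w2 (x : 'I_n + port (ins D2)) :
    vcomp_tgtl (G := vcomp_graph D1 D2) D3 (vcomp_tgtr D1 x)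
    = port_map (@passoc _ _ _ _ _ _) (vcomp_tgtr (H := vcomp_graph D2 D3) D1 (vcomp_tgtl D3 x)).
  by case: x => [j|q] /=; rewrite ?w1 // /passoc port_splitR port_splitL.
have w3 (x : 'I_l + port (ins D3)) : vcomp_tgtr (vcomp_dgraph D1 D2) x
    = port_map (@passoc _ _ _ _ _ _) (vcomp_tgtr (H := vcomp_graph D2 D3) D1 (vcomp_tgtr D2 x)).
  by case: x => [j|q] /=; rewrite ?w2 // /passoc !port_splitR.
case=> [i|p] /=; first by rewrite w3.
case: (port_sumP p) => {}p.
  by rewrite passocL !port_splitL w1.
case: (port_sumP p) => {}p.
  by rewrite passocM !(port_splitL, port_splitR) /= ?(port_splitL, port_splitR) w2.
by rewrite passocR !(port_splitL, port_splitR) /= ?(port_splitL, port_splitR) w3.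
Qed.

Lemma free_hA m1 n1 m2 n2 m3 n3
    (x : freemod m1 n1) (y : freemod m2 n2) (z : freemod m3 n3) :
  free_h (free_h x y) z
    = pr_cast (P := F) (addnA m1 m2 m3) (addnA n1 n2 n3) (free_h x (free_h y z)).
Proof.
have ll := free_h_linear_l; have lr := free_h_linear_r.
move: x; apply: lin_ext => [||D1].
- exact: (lin_comp (f := fun u : freemod (m1 + m2) (n1 + n2) => free_h u z)
                   (ll _ _ _ _ _ _ _) (ll _ _ _ _ _ _ _)).
- exact: lin_comp (@pr_cast_linear _ _ _ _ _ _) (ll _ _ _ _ _ _ _).
move: y; apply: lin_ext => [||D2].
- exact: (lin_comp (f := fun u => free_h u z) (ll _ _ _ _ _ _ _) (lr _ _ _ _ _ _ _)).
- apply: lin_comp (@pr_cast_linear _ _ _ _ _ _) _.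
  exact: (lin_comp (f := fun u => free_h (mono D1) u) (lr _ _ _ _ _ _ _) (ll _ _ _ _ _ _ _)).
move: z; apply: lin_ext => [||D3].
- exact: lr.
- apply: lin_comp (@pr_cast_linear _ _ _ _ _ _) _.
  exact: (lin_comp (f := fun u => free_h (mono D1) u) (lr _ _ _ _ _ _ _) (lr _ _ _ _ _ _ _)).
rewrite !free_h_mono.
rewrite (@mono_fun_cast _ _ _ _ _ _ (hcomp_dgraph D1 (hcomp_dgraph D2 D3))
  (hcomp_dgraph (hcomp_dgraph D1 D2) D3) (@vassoc _ _ _)
  (@passoc _ _ _ _ _ _) (@passoc _ _ _ _ _ _)).
- by rewrite koszul_mono ?expr0 ?scale1r // => u v.
- exact: vassoc_bij.
- exact: star_assoc.
- exact: passocP.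
- exact: passocP.
have w1 (x : 'I_m1 + port (ins D1)) :
    hcomp_tgtl (G := hcomp_graph D1 D2) D3 (hcomp_tgtl D2 x)
    = cast_map (addnA m1 m2 m3) (@passoc _ _ _ _ _ _) (hcomp_tgtl (hcomp_dgraph D2 D3) x).
  case: x => [o|q] /=; first by congr inl; apply: val_inj.
  by rewrite /passoc port_splitL.
have w2 (x : 'I_m2 + port (ins D2)) :
    hcomp_tgtl (G := hcomp_graph D1 D2) D3 (hcomp_tgtr D1 x)
    = cast_map (addnA m1 m2 m3) (@passoc _ _ _ _ _ _) (hcomp_tgtr (H := hcomp_graph D2 D3) D1 (hcomp_tgtl D3 x)).
  case: x => [o|q] /=; first by congr inl; apply: val_inj.
  by rewrite /passoc port_splitR port_splitL.
have w3 (x : 'I_m3 + port (ins D3)) : hcomp_tgtr (hcomp_dgraph D1 D2) x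
    = cast_map (addnA m1 m2 m3) (@passoc _ _ _ _ _ _) (hcomp_tgtr (H := hcomp_graph D2 D3) D1 (hcomp_tgtr D2 x)).
  case: x => [o|q] /=; first by congr inl; apply: val_inj; rewrite /= addnA.
  by rewrite /passoc !port_splitR.
case=> [i|p] /=.
  rewrite -/(vassoc i); case: (ord_sumP i) => {}i.
    by rewrite vassocL !ord_caseL w1.
  case: (ord_sumP i) => {}i.
    by rewrite vassocM !(ord_caseL, ord_caseR) /= ?(ord_caseL, ord_caseR) w2.
  by rewrite vassocR !(ord_caseL, ord_caseR) /= ?(ord_caseL, ord_caseR) w3.
case: (port_sumP p) => {}p.
  by rewrite passocL !port_splitL w1.
case: (port_sumP p) => {}p.
  by rewrite passocM !(port_splitL, port_splitR) /= ?(port_splitL, port_splitR) w2.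
by rewrite passocR !(port_splitL, port_splitR) /= ?(port_splitL, port_splitR) w3.
Qed.

Section Swap.
Context (N1 N2 : nat).

Definition vswap : 'I_(N2 + N1) -> 'I_(N1 + N2) :=
  ord_case (@rshift N1 N2) (@lshift N1 N2).

Lemma vswapL u : vswap (lshift _ u) = rshift _ u.
Proof. exact: ord_caseL. Qed.
Lemma vswapR u : vswap (rshift _ u) = lshift _ u.
Proof. exact: ord_caseR. Qed.

Lemma vswap_bij : bijective vswap.
Proof.
exists (ord_case (@rshift N2 N1) (@lshift N2 N1)) => v;
  by case: (ord_sumP v) => u; rewrite /vswap !(ord_caseL, ord_caseR).
Qed.

Context (a1 : 'I_N1 -> nat) (a2 : 'I_N2 -> nat).

Definition pswap (p : port (ord_case a2 a1)) : port (ord_case a1 a2) :=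
  match port_split p with inl q => portr q | inr q => portl q end.

Lemma pswapL p : pswap (portl p) = portr p.
Proof. by rewrite /pswap port_splitL. Qed.
Lemma pswapR p : pswap (portr p) = portl p.
Proof. by rewrite /pswap port_splitR. Qed.

Lemma pswapP p : port_corr vswap (fun=> id) p (pswap p).
Proof.
case: (port_sumP p) => {}p; rewrite ?pswapL ?pswapR; split=> //=.
  by rewrite vswapL.
by rewrite vswapR.
Qed.

Lemma koszul_swap (d1 : 'I_N1 -> nat) (d2 : 'I_N2 -> nat) :
  koszul (ord_case d2 d1) vswap = ((\sum_v d1 v) * (\sum_v d2 v))%N.
Proof.
rewrite /koszul big_split_ord /= [X in (_ + X)%N]big1 ?addn0 => [|u _]; last first.
  rewrite big1 // => v /andP[]; rewrite vswapR.
  case: (ord_sumP v) => {}v; rewrite ?vswapL ?vswapR /=.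
    by move=> uv; have := ltn_ord v; lia.
  by lia.
rewrite mulnC big_distrl /=; apply: eq_bigr => u _.
rewrite big_split_ord /= big1 ?add0n => [|v]; last first.
  by rewrite !vswapL /=; lia.
rewrite big_distrr /=; apply: eq_big => [v|v _].
  by rewrite vswapL vswapR /=; have := ltn_ord u; have := ltn_ord v; lia.
by rewrite ord_caseL ord_caseR.
Qed.

End Swap.

Lemma bswapL a b u : bswap a b (lshift b u) = cast_ord (addnC b a) (rshift b u).
Proof. by rewrite permE /bswap_fun ord_caseL. Qed.
Lemma bswapR a b u : bswap a b (rshift a u) = cast_ord (addnC b a) (lshift a u).
Proof. by rewrite permE /bswap_fun ord_caseR. Qed.

Lemma free_hC m1 n1 m2 n2 d e (x : freemod m1 n1) (y : freemod m2 n2) :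
  free_deg d x -> free_deg e y ->
  pr_cast (P := F) (addnC m2 m1) (addnC n2 n1) (free_h y x)
    = (-1) ^+ (d * e) *:
      free_l (bswap m1 m2)^-1%g (free_r (bswap n1 n2) (free_h x y)).
Proof.
have ll := free_h_linear_l; have lr := free_h_linear_r.
have lL := free_l_linear; have lR := free_r_linear.
move=> dx dy; move: x dx; apply: lin_ext_deg => [||D1 d1].
- exact: lin_comp (@pr_cast_linear _ _ _ _ _ _) (lr _ _ _ _ _ _ _).
- apply: lin_scale; apply: (lin_comp (lL _ _ _ _ _)).
  exact: (lin_comp (lR _ _ _ _ _) (ll _ _ _ _ _ _ _)).
move: y dy; apply: lin_ext_deg => [||D2 d2].
- exact: lin_comp (@pr_cast_linear _ _ _ _ _ _) (ll _ _ _ _ _ _ _).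
- apply: lin_scale; apply: (lin_comp (lL _ _ _ _ _)).
  exact: (lin_comp (lR _ _ _ _ _) (lr _ _ _ _ _ _ _)).
rewrite !free_h_mono free_r_mono free_l_mono.
rewrite (@mono_fun_cast _ _ _ _ _ _ (hcomp_dgraph D2 D1)
  (relabel_dgraph (bswap m1 m2)^-1%g 1%g
     (relabel_dgraph 1%g (bswap n1 n2) (hcomp_dgraph D1 D2)))
  (@vswap _ _) (@pswap _ _ _ _) (@pswap _ _ _ _)).
- by rewrite koszul_swap -d1 -d2.
- exact: vswap_bij.
- move=> v.
  pose c w := Corolla (dec_case (@dec _ _ _ _ D1) (@dec _ _ _ _ D2) w).
  pose c' w := Corolla (dec_case (@dec _ _ _ _ D2) (@dec _ _ _ _ D1) w).
  rewrite -[RHS]/(c _) -[LHS]/(c' _); case: (ord_sumP v) => {}v.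
    by rewrite vswapL /c /c' dec_caseL dec_caseR.
  by rewrite vswapR /c /c' dec_caseL dec_caseR.
- exact: pswapP.
- exact: pswapP.
pose rl (t : 'I_(m1 + m2) + port (ord_case (ins D1) (ins D2))) :=
  match t with inl o => inl (bswap m1 m2 o) | inr p => inr p end.
have rlE t : match match t with inl o => inl ((1%g : 'S_(m1+m2))^-1%g o) | inr p => inr p end with
             | inl o => inl ((bswap m1 m2)^-1^-1%g o) | inr p => inr p end = rl t.
  by case: t => //= o; rewrite invg1 perm1 invgK.
have w1 (t : 'I_m2 + port (ins D2)) :
    rl (hcomp_tgtr D1 t) = cast_map (addnC m2 m1) (@pswap _ _ _ _) (hcomp_tgtl D1 t).
  case: t => [o|p] /=; last by rewrite pswapL.
  by rewrite bswapR; congr inl; apply: val_inj.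
have w2 (t : 'I_m1 + port (ins D1)) :
    rl (hcomp_tgtl D2 t) = cast_map (addnC m2 m1) (@pswap _ _ _ _) (hcomp_tgtr D2 t).
  case: t => [o|p] /=; last by rewrite pswapR.
  by rewrite bswapL; congr inl; apply: val_inj.
case=> [i|p] /=; rewrite rlE.
  rewrite invg1 perm1; case: (ord_sumP i) => {}i.
    have -> : cast_ord (addnC n2 n1) (lshift n1 i) = bswap n1 n2 (rshift n1 i).
      by rewrite bswapR; apply: val_inj.
    by rewrite permK ord_caseL ord_caseR w1.
  have -> : cast_ord (addnC n2 n1) (rshift n2 i) = bswap n1 n2 (lshift n2 i).
    by rewrite bswapL; apply: val_inj.
  by rewrite permK ord_caseL ord_caseR w2.
case: (port_sumP p) => {}p.
  by rewrite pswapL port_splitR port_splitL w1.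
by rewrite pswapR port_splitR port_splitL w2.
Qed.

Section Shuffle.
Context (X1 X2 Y1 Y2 : nat).

Definition vshuf : 'I_(X1 + X2 + (Y1 + Y2)) -> 'I_(X1 + Y1 + (X2 + Y2)) :=
  ord_case
    (ord_case (fun u => lshift (X2 + Y2) (lshift Y1 u))
              (fun u => rshift (X1 + Y1) (lshift Y2 u)))
    (ord_case (fun u => lshift (X2 + Y2) (rshift X1 u))
              (fun u => rshift (X1 + Y1) (rshift X2 u))).

Lemma vshufE :
  (forall u, vshuf (lshift _ (lshift _ u)) = lshift _ (lshift _ u)) *
  (forall u, vshuf (lshift _ (rshift _ u)) = rshift _ (lshift _ u)) *
  (forall u, vshuf (rshift _ (lshift _ u)) = lshift _ (rshift _ u)) *
  (forall u, vshuf (rshift _ (rshift _ u)) = rshift _ (rshift _ u)).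
Proof. by split; [split; [split|]|] => u; rewrite /vshuf !(ord_caseL, ord_caseR). Qed.

Lemma koszul_shuf d1 d2 e1 e2 :
  koszul (ord_case (ord_case d1 d2) (ord_case e1 e2)) vshuf
  = ((\sum_(v < X2) d2 v) * (\sum_(v < Y1) e1 v))%N.
Proof.
have z (N : nat) (P : pred 'I_N) (c : 'I_N -> nat) : P =1 xpred0 ->
    (\sum_(v < N | P v) c v = 0)%N by move=> P0; rewrite big_pred0.
rewrite /koszul !big_split_ord /=.
rewrite [X in (X + _ + _)%N]big1 ?add0n => [|u _]; last first.
  rewrite !big_split_ord /= !z // => v /=; rewrite !vshufE /=;
    by have := ltn_ord u; have := ltn_ord v; lia.
rewrite [X in (_ + (X + _))%N]big1 ?add0n => [|u _]; last first.
  rewrite !big_split_ord /= !z // => v /=; rewrite !vshufE /=;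
    by have := ltn_ord u; have := ltn_ord v; lia.
rewrite [X in (_ + X)%N]big1 ?addn0 => [|u _]; last first.
  rewrite !big_split_ord /= !z // => v /=; rewrite !vshufE /=;
    by have := ltn_ord u; have := ltn_ord v; lia.
rewrite big_distrl /=; apply: eq_bigr => u _.
rewrite !big_split_ord /= [X in (X + _ + _)%N]z => [|v]; last first.
  by rewrite /= !vshufE /=; have := ltn_ord u; have := ltn_ord v; lia.
rewrite [X in (_ + X + _)%N]z => [|v]; last first.
  by rewrite /= !vshufE /=; have := ltn_ord u; have := ltn_ord v; lia.
rewrite [X in (_ + (_ + X))%N]z => [|v]; last first.
  by rewrite /= !vshufE /=; have := ltn_ord u; have := ltn_ord v; lia.
rewrite add0n addn0 big_distrr /=; apply: eq_big => [v|v _].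
  by rewrite /= !vshufE /=; have := ltn_ord u; have := ltn_ord v; lia.
by rewrite !(ord_caseL, ord_caseR).
Qed.

Lemma vshuf_bij : bijective vshuf.
Proof.
exists (ord_case
    (ord_case (fun u => lshift (Y1 + Y2) (lshift X2 u))
              (fun u => rshift (X1 + X2) (lshift Y2 u)))
    (ord_case (fun u => lshift (Y1 + Y2) (rshift X1 u))
              (fun u => rshift (X1 + X2) (rshift Y1 u)))) => v;
case: (ord_sumP v) => {}v; case: (ord_sumP v) => u;
by rewrite /vshuf !(ord_caseL, ord_caseR).
Qed.

Context (a1 : 'I_X1 -> nat) (a2 : 'I_X2 -> nat).
Context (b1 : 'I_Y1 -> nat) (b2 : 'I_Y2 -> nat).

Definition pshuf (p : port (ord_case (ord_case a1 a2) (ord_case b1 b2))) :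
    port (ord_case (ord_case a1 b1) (ord_case a2 b2)) :=
  match port_split p with
  | inl q => match port_split q with
             | inl q => portl (portl q)
             | inr q => portr (portl q)
             end
  | inr q => match port_split q with
             | inl q => portl (portr q)
             | inr q => portr (portr q)
             end
  end.

Lemma pshufE :
  (forall u, pshuf (portl (portl u)) = portl (portl u)) *
  (forall u, pshuf (portl (portr u)) = portr (portl u)) *
  (forall u, pshuf (portr (portl u)) = portl (portr u)) *
  (forall u, pshuf (portr (portr u)) = portr (portr u)).
Proof. by split; [split; [split|]|] => u; rewrite /pshuf !(port_splitL, port_splitR). Qed.

Lemma pshufP p : port_corr vshuf (fun=> id) p (pshuf p).
Proof.
case: (port_sumP p) => {}p; case: (port_sumP p) => {}p; rewrite pshufE;
  by split=> //=; rewrite vshufE.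
Qed.

End Shuffle.

Lemma free_hv m1 n1 l1 m2 n2 l2 d e (x1 : freemod m1 n1) (x2 : freemod m2 n2)
    (y1 : freemod n1 l1) (y2 : freemod n2 l2) :
  free_deg d x2 -> free_deg e y1 ->
  free_v (free_h x1 x2) (free_h y1 y2)
    = (-1) ^+ (d * e) *: free_h (free_v x1 y1) (free_v x2 y2).
Proof.
have hl := free_h_linear_l; have hr := free_h_linear_r.
have vl := free_v_linear_l; have vr := free_v_linear_r.
move=> dx dy; move: x1; apply: lin_ext => [||A1].
- exact: (lin_comp (f := fun u : freemod (m1 + m2) (n1 + n2) => free_v u _)
    (vl _ _ _ _ _ _) (hl _ _ _ _ _ _ _)).
- by apply: lin_scale; exact: (lin_comp (f := fun u : freemod m1 l1 => free_h u _)
    (hl _ _ _ _ _ _ _) (vl _ _ _ _ _ _)).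
move: x2 dx; apply: lin_ext_deg => [||A2 dA].
- exact: (lin_comp (f := fun u : freemod (m1 + m2) (n1 + n2) => free_v u _)
    (vl _ _ _ _ _ _) (hr _ _ _ _ _ _ _)).
- by apply: lin_scale; exact: (lin_comp (f := fun u : freemod m2 l2 => free_h _ u)
    (hr _ _ _ _ _ _ _) (vl _ _ _ _ _ _)).
move: y1 dy; apply: lin_ext_deg => [||B1 dB].
- exact: (lin_comp (f := fun u : freemod (n1 + n2) (l1 + l2) => free_v _ u)
    (vr _ _ _ _ _ _) (hl _ _ _ _ _ _ _)).
- by apply: lin_scale; exact: (lin_comp (f := fun u : freemod m1 l1 => free_h u _)
    (hl _ _ _ _ _ _ _) (vr _ _ _ _ _ _)).
move: y2; apply: lin_ext => [||B2].
- exact: (lin_comp (f := fun u : freemod (n1 + n2) (l1 + l2) => free_v _ u)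
    (vr _ _ _ _ _ _) (hr _ _ _ _ _ _ _)).
- by apply: lin_scale; exact: (lin_comp (f := fun u : freemod m2 l2 => free_h _ u)
    (hr _ _ _ _ _ _ _) (vr _ _ _ _ _ _)).
rewrite !free_h_mono !free_v_mono free_h_mono.
rewrite (@mono_fun _ _ (vcomp_dgraph (hcomp_dgraph A1 A2) (hcomp_dgraph B1 B2))
  (hcomp_dgraph (vcomp_dgraph A1 B1) (vcomp_dgraph A2 B2))
  (@vshuf _ _ _ _) (@pshuf _ _ _ _ _ _ _ _) (@pshuf _ _ _ _ _ _ _ _)).
- by rewrite koszul_shuf -dA -dB.
- exact: vshuf_bij.
- move=> v.
  pose c w := Corolla (dec_case (dec_case (@dec _ _ _ _ A1) (@dec _ _ _ _ B1))
     (dec_case (@dec _ _ _ _ A2) (@dec _ _ _ _ B2)) w).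
  pose c' w := Corolla (dec_case (dec_case (@dec _ _ _ _ A1) (@dec _ _ _ _ A2))
     (dec_case (@dec _ _ _ _ B1) (@dec _ _ _ _ B2)) w).
  rewrite -[RHS]/(c _) -[LHS]/(c' _).
  by case: (ord_sumP v) => {}v; case: (ord_sumP v) => {}v;
    rewrite vshufE /c /c' !(dec_caseL, dec_caseR).
- exact: pshufP.
- exact: pshufP.
pose sh := @pshuf _ _ _ _ (ins A1) (ins A2) (ins B1) (ins B2).
have wa1 (t : 'I_m1 + port (ins A1)) :
    hcomp_tgtl (G := vcomp_graph A1 B1) (vcomp_graph A2 B2) (vcomp_tgtl B1 t)
    = port_map sh (vcomp_tgtl (G := hcomp_graph A1 A2) (hcomp_graph B1 B2) (hcomp_tgtl A2 t)).
  by case: t => [o|p] //=; rewrite /sh pshufE.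
have wa2 (t : 'I_m2 + port (ins A2)) :
    hcomp_tgtr (H := vcomp_graph A2 B2) (vcomp_graph A1 B1) (vcomp_tgtl B2 t)
    = port_map sh (vcomp_tgtl (G := hcomp_graph A1 A2) (hcomp_graph B1 B2) (hcomp_tgtr A1 t)).
  by case: t => [o|p] //=; rewrite /sh pshufE.
have wb1 (t : 'I_n1 + port (ins B1)) :
    hcomp_tgtl (G := vcomp_graph A1 B1) (vcomp_graph A2 B2) (vcomp_tgtr A1 t)
    = port_map sh (vcomp_tgtr (H := hcomp_graph B1 B2) (hcomp_graph A1 A2) (hcomp_tgtl B2 t)).
  by case: t => [o|p] //=; rewrite /sh ?pshufE ?ord_caseL ?wa1.
have wb2 (t : 'I_n2 + port (ins B2)) :
    hcomp_tgtr (H := vcomp_graph A2 B2) (vcomp_graph A1 B1) (vcomp_tgtr A2 t)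
    = port_map sh (vcomp_tgtr (H := hcomp_graph B1 B2) (hcomp_graph A1 A2) (hcomp_tgtr B1 t)).
  by case: t => [o|p] //=; rewrite /sh ?pshufE ?ord_caseR ?wa2.
case=> [i|p] /=.
  by case: (ord_sumP i) => {}i; rewrite !(ord_caseL, ord_caseR) ?wb1 ?wb2.
case: (port_sumP p) => {}p; case: (port_sumP p) => {}p;
  by rewrite pshufE !(port_splitL, port_splitR) /= ?(port_splitL, port_splitR)
    ?wa1 ?wa2 ?wb1 ?wb2.
Qed.

Lemma free_pos m n (x : freemod m n) : (m == 0%N) || (n == 0%N) -> x = 0.
Proof.
move=> mn; elim/freemod_ind: x => [//|D|x y -> ->|a x ->].
- have := graph_pos D; rewrite !lt0n -negb_or.
  by rewrite mn.
- by rewrite addr0.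
- by rewrite scaler0.
Qed.

Lemma relabel_dgraph1 m n (D : dgraph m n) :
  mono (relabel_dgraph 1%g 1%g D) = mono D.
Proof.
case: D => -[[N o i w] h1 h2 h3 h4] d e; apply: mono_wire => -[j|p] /=.
  by rewrite invg1 perm1; case: (w _) => //= x; rewrite invg1 perm1.
by case: (w _) => //= x; rewrite invg1 perm1.
Qed.

Lemma relabel_dgraphM m n (s s' : 'S_m) (t t' : 'S_n) (D : dgraph m n) :
  mono (relabel_dgraph s t (relabel_dgraph s' t' D))
  = mono (relabel_dgraph (s * s')%g (t' * t)%g D).
Proof.
apply: mono_wire => -[j|p] /=.
  rewrite !invMg permM; case: (wire D _) => //= x.
  by rewrite permM.
by case: (wire D _) => //= x; rewrite invMg permM.
Qed.

Lemma free_bimod m n : is_bimodule (@free_l k E m n) (@free_r k E m n).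
Proof.
have lL := @free_l_linear k E m n; have lR := @free_r_linear k E m n.
have li : linear (fun x : freemod m n => x) by [].
split=> //.
- apply: lin_ext => // D; by rewrite free_l_mono relabel_dgraph1.
- move=> s s'; apply: lin_ext => [//||D].
    exact: (lin_comp (f := free_l s)).
  by rewrite !free_l_mono relabel_dgraphM mulg1.
- apply: lin_ext => // D; by rewrite free_r_mono relabel_dgraph1.
- move=> t t'; apply: lin_ext => [//||D].
    exact: (lin_comp (f := free_r t')).
  by rewrite !free_r_mono relabel_dgraphM mulg1.
- move=> s t; apply: lin_ext => [||D].
  + exact: (lin_comp (f := free_l s)).
  + exact: (lin_comp (f := free_r t)).
  by rewrite free_l_mono !free_r_mono free_l_mono !relabel_dgraphM !mulg1 !mul1g.
Qed.

Definition free_proj m n (d : nat) : freemod m n -> freemod m n :=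
  plift (fun D => if tdeg D == d then mono D else 0).

Lemma free_proj_respects m n d :
  respects (@grel k E m n)
    (fun D => if tdeg D == d then mono D : freemod m n else 0).
Proof.
apply: respectsP => [G dg v a e e1 e2 eu ev|D D' f r l i].
  rewrite /tdeg /=; case: eqP => _; last by rewrite scaler0 addr0.
  exact: mono_lin eu ev.
rewrite (iso_tdeg i); case: eqP => _; last by rewrite scaler0.
exact: mono_iso i.
Qed.

Lemma free_proj_linear m n d : linear (@free_proj m n d).
Proof. exact: (plift_linear (free_proj_respects _)). Qed.

Lemma free_proj_mono m n d (D : dgraph m n) :
  free_proj d (mono D) = if tdeg D == d then mono D else 0.
Proof. exact: (plift_gen (free_proj_respects _)). Qed.

Lemma free_proj_deg m n d e (x : freemod m n) :
  free_deg e x -> free_proj d x = if e == d then x else 0.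
Proof.
move: x; apply: lin_ext_deg => [||D De].
- exact: free_proj_linear.
- by case: eqP => _ a x y; rewrite ?scaler0 ?addr0.
by rewrite free_proj_mono De.
Qed.

Lemma free_grading m n : is_grading (@free_deg k E m n).
Proof.
split.
- by move=> d; apply: lspan0.
- by move=> d a x y; apply: lspan_lin.
- elim/freemod_ind => [|D|x y [A [f [fd ->]]] [B [g [gd ->]]]|a x [A [f [fd ->]]]].
  + by exists 0%N, (fun=> 0); split=> [d|]; [apply: lspan0 | rewrite big_ord0].
  + exists (tdeg D).+1, (fun d => if d == tdeg D then mono D else 0); split.
      by move=> d; case: eqP => [->|_]; [apply: free_deg_mono | apply: lspan0].
    rewrite big_ord_recr /= eqxx big1 ?add0r // => i _.
    by rewrite ltn_eqF.
  + exists (A + B)%N.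
    exists (fun d => (if (d < A)%N then f d else 0) + (if (d < B)%N then g d else 0)).
    split.
      move=> d; rewrite -[X in X + _]scale1r; apply: lspan_lin.
        by case: ifP => _; [exact: fd | exact: lspan0].
      by case: ifP => _; [exact: gd | exact: lspan0].
    rewrite big_split /=; congr (_ + _).
      rewrite big_split_ord /= [X in _ + X]big1 ?addr0; last first.
        by move=> i _; rewrite ltnNge leq_addr.
      by apply: eq_bigr => i _; rewrite ltn_ord.
    rewrite addnC big_split_ord /= [X in _ + X]big1 ?addr0; last first.
      by move=> i _; rewrite ltnNge leq_addr.
    by apply: eq_bigr => i _; rewrite ltn_ord.
  + exists A, (fun d => a *: f d); split.
      by move=> d; rewrite -[_ *: _]addr0; apply: lspan_lin; [exact: fd | exact: lspan0].
    by rewrite scaler_sumr.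
- move=> A f fd f0 d dA.
  have := congr1 (free_proj d) f0.
  rewrite (lin0 (free_proj_linear _)).
  have -> : \sum_(i < A) f i = \sum_(i < A) 1 *: f i.
    by apply: eq_bigr => i _; rewrite scale1r.
  rewrite (lin_sum _ _ (free_proj_linear _)) (bigD1 (Ordinal dA)) //=.
  rewrite (free_proj_deg d (fd d)) eqxx scale1r big1 ?addr0 // => i ni.
  rewrite (free_proj_deg d (fd i)); case: eqP => [E0|_]; last by rewrite scaler0.
  by case/eqP: ni; apply: val_inj.
Qed.

Lemma tdeg_case N1 N2 (d1 : 'I_N1 -> nat) (d2 : 'I_N2 -> nat) :
  (\sum_v ord_case d1 d2 v = \sum_v d1 v + \sum_v d2 v)%N.
Proof.
rewrite big_split_ord /=; congr (_ + _)%N; apply: eq_bigr => v _.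
  by rewrite ord_caseL.
by rewrite ord_caseR.
Qed.

Lemma free_deg_l m n d s (x : freemod m n) : free_deg d x -> free_deg d (free_l s x).
Proof.
apply: lspan_map => [|_ [D <- ->]]; first exact: free_l_linear.
by rewrite free_l_mono; apply: lspan_gen; exists (relabel_dgraph s 1%g D).
Qed.

Lemma free_deg_r m n d t (x : freemod m n) : free_deg d x -> free_deg d (free_r t x).
Proof.
apply: lspan_map => [|_ [D <- ->]]; first exact: free_r_linear.
by rewrite free_r_mono; apply: lspan_gen; exists (relabel_dgraph 1%g t D).
Qed.

Lemma free_deg_h m1 n1 m2 n2 d e (x : freemod m1 n1) (y : freemod m2 n2) :
  free_deg d x -> free_deg e y -> free_deg (d + e) (free_h x y).
Proof.
move=> + dy; apply: (lspan_map (f := fun u => free_h u y)) => [|_ [D <- ->]].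
  exact: free_h_linear_l.
move: y dy; apply: (lspan_map (f := fun u => free_h _ u)) => [|_ [D' <- ->]].
  exact: free_h_linear_r.
rewrite free_h_mono; apply: lspan_gen; exists (hcomp_dgraph D D'); last by [].
exact: tdeg_case.
Qed.

Lemma free_deg_v m n l d e (x : freemod m n) (y : freemod n l) :
  free_deg d x -> free_deg e y -> free_deg (d + e) (free_v x y).
Proof.
move=> + dy; apply: (lspan_map (f := fun u => free_v u y)) => [|_ [D <- ->]].
  exact: free_v_linear_l.
move: y dy; apply: (lspan_map (f := fun u => free_v _ u)) => [|_ [D' <- ->]].
  exact: free_v_linear_r.
rewrite free_v_mono; apply: lspan_gen; exists (vcomp_dgraph D D'); last by [].
exact: tdeg_case.
Qed.

Lemma free_deg_one : free_deg 0 (mono (unit_dgraph E)).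
Proof. by apply: lspan_gen; exists (unit_dgraph E); rewrite // /tdeg big_ord0. Qed.

Lemma free_v_l m n l s (x : freemod m n) (y : freemod n l) :
  free_v (free_l s x) y = free_l s (free_v x y).
Proof.
move: x; apply: lin_ext => [||D].
- exact: (lin_comp (f := fun u : freemod m n => free_v u y) (@free_v_linear_l _ _ _ _ _ _) (@free_l_linear _ _ _ _ _)).
- exact: (lin_comp (@free_l_linear _ _ _ _ _) (@free_v_linear_l _ _ _ _ _ _)).
move: y; apply: lin_ext => [||D'].
- exact: free_v_linear_r.
- exact: (lin_comp (@free_l_linear _ _ _ _ _) (@free_v_linear_r _ _ _ _ _ _)).
rewrite free_l_mono !free_v_mono free_l_mono; apply: mono_wire.
have rl (x : 'I_m + port (ins D)) : vcomp_tgtl D'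
    (match x with inl o => inl (s^-1%g o) | inr p => inr p end) =
    match vcomp_tgtl D' x with inl o => inl (s^-1%g o) | inr p => inr p end.
  by case: x.
have rr (x : 'I_n + port (ins D')) :
    vcomp_tgtr (relabel_graph s 1%g D) x =
    match vcomp_tgtr D x with inl o => inl (s^-1%g o) | inr p => inr p end.
  by case: x => //= j; rewrite invg1 perm1 -rl.
case=> [i|p] /=; first by rewrite rr invg1 perm1.
case: (port_sumP p) => {}p; rewrite ?port_splitL ?port_splitR.
  by rewrite -rl.
by rewrite rr.
Qed.

Lemma free_v_r m n l t (x : freemod m n) (y : freemod n l) :
  free_v x (free_r t y) = free_r t (free_v x y).
Proof.
move: x; apply: lin_ext => [||D].
- exact: free_v_linear_l.
- exact: (lin_comp (@free_r_linear _ _ _ _ _) (@free_v_linear_l _ _ _ _ _ _)).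
move: y; apply: lin_ext => [||D'].
- exact: (lin_comp (f := fun u : freemod n l => free_v _ u) (@free_v_linear_r _ _ _ _ _ _) (@free_r_linear _ _ _ _ _)).
- exact: (lin_comp (@free_r_linear _ _ _ _ _) (@free_v_linear_r _ _ _ _ _ _)).
rewrite free_r_mono !free_v_mono free_r_mono; apply: mono_wire.
have r1 N (i : 'I_N -> nat) a (x : 'I_a + port i) :
    match x with inl o => inl ((1%g : 'S_a)^-1%g o) | inr p => inr p end = x.
  by case: x => // o; rewrite invg1 perm1.
by case=> [i|p] /=; rewrite !r1 //; case: port_split => // q; rewrite r1.
Qed.

Lemma free_v_lr m n l s (x : freemod m n) (y : freemod n l) :
  free_v (free_r s x) y = free_v x (free_l s y).
Proof.
move: x; apply: lin_ext => [||D].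
- exact: (lin_comp (f := fun u : freemod m n => free_v u y) (@free_v_linear_l _ _ _ _ _ _) (@free_r_linear _ _ _ _ _)).
- exact: free_v_linear_l.
move: y; apply: lin_ext => [||D'].
- exact: free_v_linear_r.
- exact: (lin_comp (f := fun u : freemod n l => free_v _ u) (@free_v_linear_r _ _ _ _ _ _) (@free_l_linear _ _ _ _ _)).
rewrite free_r_mono free_l_mono !free_v_mono; apply: mono_wire.
have r1 N (i : 'I_N -> nat) a (x : 'I_a + port i) :
    match x with inl o => inl ((1%g : 'S_a)^-1%g o) | inr p => inr p end = x.
  by case: x => // o; rewrite invg1 perm1.
have rr (x : 'I_n + port (ins D')) :
    vcomp_tgtr (relabel_graph 1%g s D) x =
    vcomp_tgtr D (match x with inl o => inl (s^-1%g o) | inr p => inr p end).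
  by case: x => //= j; rewrite r1.
case=> [i|p] /=; first by rewrite rr invg1 perm1.
case: (port_sumP p) => {}p; rewrite ?port_splitL ?port_splitR.
  by rewrite r1.
by rewrite rr.
Qed.

Lemma bsumL a b (s : 'S_a) (t : 'S_b) u : bsum s t (lshift b u) = lshift b (s u).
Proof. by rewrite permE /bsum_fun ord_caseL. Qed.
Lemma bsumR a b (s : 'S_a) (t : 'S_b) u : bsum s t (rshift a u) = rshift a (t u).
Proof. by rewrite permE /bsum_fun ord_caseR. Qed.

Lemma bsumV a b (s : 'S_a) (t : 'S_b) : ((bsum s t)^-1 = bsum s^-1 t^-1)%g.
Proof.
apply/permP => i; apply: (perm_inj (s := bsum s t)); rewrite permKV.
by case: (ord_sumP i) => u; rewrite ?bsumL ?bsumR permKV.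
Qed.

Lemma hcomp_relabel m1 n1 m2 n2 s1 s2 t1 t2 (D1 : dgraph m1 n1) (D2 : dgraph m2 n2) :
  mono (hcomp_dgraph (relabel_dgraph s1 t1 D1) (relabel_dgraph s2 t2 D2))
  = mono (relabel_dgraph (bsum s1 s2) (bsum t1 t2) (hcomp_dgraph D1 D2)).
Proof.
apply: mono_wire.
have rl (x : 'I_m1 + port (ins D1)) : hcomp_tgtl D2
    (match x with inl o => inl (s1^-1%g o) | inr p => inr p end) =
    match hcomp_tgtl D2 x with
    | inl o => inl ((bsum s1 s2)^-1%g o) | inr p => inr p end.
  by case: x => //= o; rewrite bsumV bsumL.
have rr (x : 'I_m2 + port (ins D2)) : hcomp_tgtr D1
    (match x with inl o => inl (s2^-1%g o) | inr p => inr p end) =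
    match hcomp_tgtr D1 x with
    | inl o => inl ((bsum s1 s2)^-1%g o) | inr p => inr p end.
  by case: x => //= o; rewrite bsumV bsumR.
case=> [i|p] /=.
  rewrite (bsumV t1); case: (ord_sumP i) => {}i.
    by rewrite bsumL !ord_caseL -rl.
  by rewrite bsumR !ord_caseR -rr.
by case: (port_sumP p) => {}p; rewrite ?port_splitL ?port_splitR -?rl -?rr.
Qed.

Lemma bsum1 a b : bsum (1 : 'S_a)%g (1 : 'S_b)%g = 1%g.
Proof.
apply/permP => i; rewrite perm1.
by case: (ord_sumP i) => u; rewrite ?bsumL ?bsumR perm1.
Qed.

Lemma free_h_l m1 n1 m2 n2 s1 s2 (x : freemod m1 n1) (y : freemod m2 n2) :
  free_h (free_l s1 x) (free_l s2 y) = free_l (bsum s1 s2) (free_h x y).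
Proof.
have ll := free_h_linear_l; have lr := free_h_linear_r; have lL := free_l_linear.
move: x; apply: lin_ext => [||D].
- exact: (lin_comp (f := fun u : freemod m1 n1 => free_h u _) (ll _ _ _ _ _ _ _) (lL _ _ _ _ _)).
- exact: (lin_comp (lL _ _ _ _ _) (ll _ _ _ _ _ _ _)).
move: y; apply: lin_ext => [||D'].
- exact: (lin_comp (f := fun u : freemod m2 n2 => free_h _ u) (lr _ _ _ _ _ _ _) (lL _ _ _ _ _)).
- exact: (lin_comp (lL _ _ _ _ _) (lr _ _ _ _ _ _ _)).
by rewrite !free_l_mono !free_h_mono free_l_mono hcomp_relabel bsum1.
Qed.

Lemma free_h_r m1 n1 m2 n2 t1 t2 (x : freemod m1 n1) (y : freemod m2 n2) :
  free_h (free_r t1 x) (free_r t2 y) = free_r (bsum t1 t2) (free_h x y).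
Proof.
have ll := free_h_linear_l; have lr := free_h_linear_r; have lR := free_r_linear.
move: x; apply: lin_ext => [||D].
- exact: (lin_comp (f := fun u : freemod m1 n1 => free_h u _) (ll _ _ _ _ _ _ _) (lR _ _ _ _ _)).
- exact: (lin_comp (lR _ _ _ _ _) (ll _ _ _ _ _ _ _)).
move: y; apply: lin_ext => [||D'].
- exact: (lin_comp (f := fun u : freemod m2 n2 => free_h _ u) (lr _ _ _ _ _ _ _) (lR _ _ _ _ _)).
- exact: (lin_comp (lR _ _ _ _ _) (lr _ _ _ _ _ _ _)).
by rewrite !free_r_mono !free_h_mono free_r_mono hcomp_relabel bsum1.
Qed.

Definition id_pregraph n : pregraph n.+1 n.+1 :=
  @PreGraph n.+1 n.+1 0 (fun=> 0%N) (fun=> 0%N)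
    (fun e => match e with inl i => inl i | inr p => inr p end).

Definition id_graph n : graph n.+1 n.+1.
Proof.
apply: (@Graph _ _ (id_pregraph n)) => //.
- by case.
- by exists (fun e => match e with inl i => inl i | inr p => inr p end); case.
- by case=> // -[].
Defined.

Definition id_dgraph n : dgraph n.+1 n.+1 :=
  @DGraph k E _ _ (id_graph n) (fun=> 0%N)
    (fun v : 'I_0 => match notF (ltn_ord v) with end).

Lemma pr_id_mono n : pr_id F n = mono (id_dgraph n).
Proof.
elim: n => [|n IHn] /=.
  rewrite (@mono_fun _ _ (unit_dgraph E) (id_dgraph 0) id id id).
  - by rewrite koszul_mono ?expr0 ?scale1r.
  - by exists id.
  - by case.
  - by [].
  - by [].
  - by case.
rewrite IHn free_h_mono.
pose no (a b : 'I_(0 + 0) -> nat) (p : port a) : port b := match tag p with Ordinal _ h => match notF h with end end.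
rewrite (@mono_fun _ _ (hcomp_dgraph (unit_dgraph E) (id_dgraph n)) (id_dgraph n.+1)
   id (@no _ _) (@no _ _)).
- by rewrite koszul_mono ?expr0 ?scale1r.
- by exists id.
- by case.
- by case=> -[].
- by case=> -[].
case=> [i|[[]//]] /=.
by case: (@ord_sumP 1 n.+1 i) => j; rewrite ?ord_caseL ?ord_caseR.
Qed.

Lemma free_v1 m n (x : freemod m n.+1) : free_v x (mono (id_dgraph n)) = x.
Proof.
move: x; apply: lin_ext => [|//|D]; first exact: free_v_linear_l.
rewrite free_v_mono.
symmetry; rewrite (@mono_fun _ _ D (vcomp_dgraph D (id_dgraph n)) (@lshift _ 0)
  (@portl _ _ _ _) (@portl _ _ _ _)).
- by rewrite koszul_mono ?expr0 ?scale1r.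
- apply: inj_card_bij; first exact: lshift_inj.
  by rewrite !card_ord /= addn0.
- by move=> v; rewrite [RHS]dec_caseL.
- by [].
- by [].
by case=> [i|p] /=; rewrite ?port_splitL; case: (wire D _).
Qed.

Lemma free_1v m n (x : freemod m.+1 n) : free_v (mono (id_dgraph m)) x = x.
Proof.
move: x; apply: lin_ext => [|//|D]; first exact: free_v_linear_r.
rewrite free_v_mono.
symmetry; rewrite (@mono_fun _ _ D (vcomp_dgraph (id_dgraph m) D) (@rshift 0 _)
  (@portr _ _ _ _) (@portr _ _ _ _)).
- by rewrite koszul_mono ?expr0 ?scale1r.
- apply: inj_card_bij; first exact: rshift_inj.
  by rewrite !card_ord.
- by move=> v; rewrite [RHS]dec_caseR.
- by [].
- by [].
by case=> [i|p] /=; rewrite ?port_splitR; case: (wire D _).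
Qed.

Theorem free_prop_is_prop : is_prop F.
Proof.
split=> /=.
- exact: free_pos.
- exact: free_bimod.
- exact: free_grading.
- exact: free_deg_l.
- exact: free_deg_r.
- exact: free_deg_h.
- exact: free_deg_v.
- exact: free_deg_one.
- exact: free_h_linear_l.
- exact: free_h_linear_r.
- exact: free_v_linear_l.
- exact: free_v_linear_r.
- exact: free_vA.
- by move=> m n x; rewrite [pr_id _ _]pr_id_mono free_v1.
- by move=> m n x; rewrite [pr_id _ _]pr_id_mono free_1v.
- exact: free_v_l.
- exact: free_v_r.
- exact: free_v_lr.
- exact: free_hA.
- exact: free_h_l.
- exact: free_h_r.
- exact: free_hC.
- exact: free_hv.
Qed.

End FreeAxioms.

Record PROP (k : fieldType) := MkPROP {
  PROP_data :> prop_data k;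
  PROP_axioms : is_prop PROP_data
}.

Definition free_prop (k : fieldType) (E : bicollection k) : PROP k :=
  MkPROP (free_prop_is_prop E).

Section FreeSubspaces.
Context (k : fieldType) (E : bicollection k).

(* The span of the [G]-monomials whose graph [G] satisfies [Q]. *)
Definition graph_span (Q : forall m n, graph m n -> bool) (m n : nat) :
    free_prop E m n -> Prop :=
  lspan (fun x : freemod E m n => exists2 D : dgraph E m n, Q m n D & x = mono D).

Definition in_connected := graph_span (fun m n G => cmp G == 0%N).
Definition in_pth (p : nat) := graph_span (fun m n G => pth G == p).
Definition in_D := graph_span (fun m n G => contractible G).
Definition in_half :=
  graph_span (fun m n G => contractible G && ~~ has_bad_edge G).
Definition in_bad :=
  graph_span (fun m n G => contractible G && has_bad_edge G).
Definition in_cg :=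
  graph_span (fun m n G => (0 < cmp G + gen_grading G)%N).

(* The image of a generator in the free PROP. The arity conditions lose
   nothing: [E m n] vanishes when they fail. *)
Definition generator m n d (hm : (0 < m)%N) (hn : (0 < n)%N)
    (hmn : (2 < m + n)%N) (e : E m n d) : free_prop E m n :=
  mono (corolla_dgraph hm hn hmn e).

Definition on_generators (Q : forall m n, free_prop E m n -> Prop) : Prop :=
  forall m n d hm hn hmn (e : E m n d), Q m n (generator hm hn hmn e).

(* [D0] is the derivation whose restriction to [E] is [D] followed by the
   projection onto [in_half] along [in_bad] and [in_cg]. This determines [D0],
   since the generators generate the free PROP. *)
Definition is_half_part (D D0 : endo (free_prop E)) : Prop :=
  is_derivation D0 /\
  on_generators (fun m n e =>
    in_half (D0 m n e) /\
    exists2 y, in_bad y & exists2 z, in_cg z & D m n e = D0 m n e + y + z).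

Definition is_connected (D : endo (free_prop E)) : Prop :=
  on_generators (fun m n e => in_connected (D m n e)).

Definition preserves_pth (D : endo (free_prop E)) : Prop :=
  forall m n p (x : free_prop E m n), in_pth p x -> in_pth p (D m n x).

Definition maps_generators_to_D (D : endo (free_prop E)) : Prop :=
  on_generators (fun m n e => in_D (D m n e)).

Definition is_free_resolution (D : endo (free_prop E)) (P : PROP k)
    (dP : endo P) (alpha : forall m n, free_prop E m n -> P m n) : Prop :=
  [/\ is_differential D, is_dg_hom D dP alpha
    & forall i, homology_iso D dP alpha i].

End FreeSubspaces.

Definition concentrated_in_degree0 (k : fieldType) (P : PROP k) : Prop :=
  forall m n (x : P m n), pr_deg 0 x.

(* Main.v *)
Require Import Defs.
From mathcomp Require Import all_boot all_order all_algebra.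
From mathcomp Require Import all_fingroup zify.

(** The half part [d0] is the leading term of [d] for a suitable weight on
    graphs, so that acyclicity passes from [d0] to [d] by peeling off leading
    terms ([perturbation]): if [d0] preserves the weight and [d - d0] lowers it,
    the top component of a [d]-cycle is a [d0]-cycle, hence [d0 z] for some [z]
    of the same weight, and subtracting [d z] leaves a cycle of smaller weight.
    This settles the positive degrees; there [P] vanishes, and in degree 0 the
    isomorphism is a hypothesis.

    The weight is built from two quantities that behave well under composition.
    The path matrix of a graph, whose entries count the directed paths from an
    input to an output, turns vertical composition into the matrix product and
    horizontal composition into the block sum; the sum of its entries is [pth].
    The branching number, the sum over the vertices of the number of outputs
    minus one, is additive, and a connected graph with [m] outputs has first
    Betti number [branching - (m - 1)].

    Every decorated graph is assembled from corollas ([all_built]): detach a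
    vertex all of whose outputs are legs, and induct. A derivation is
    therefore controlled by its values on generators ([derivation_span]). A
    generator has the all-ones path matrix. A contractible graph without bad
    edges has the same path matrix and the same branching number as the corolla
    with the same legs; one with a bad edge has a path matrix that is at most
    all-ones with some zero entry. Hence [d0] preserves both quantities.

    If [d] maps generators to contractible graphs, [d - d0] on a generator is
    the part with bad edges, so [d - d0] strictly lowers the path matrix, and
    [pth] is the weight. If [d] is connected and preserves [pth], there is no
    part with bad edges, since it would lower [pth]; what remains is connected
    of positive first Betti number, so [d - d0] raises the branching number at
    constant [pth]. As the branching number never exceeds [pth]
    ([branching_pth_dgraph]), their difference is a weight. This is where the
    preservation of paths replaces the boundedness of a filtration. *)

Set Implicit Arguments.
Unset Strict Implicit.
Unset Printing Implicit Defensive.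

Import GRing.Theory.

(** * Spanning trees and bridges of multigraphs *)

Section Multigraph.
Context (T I : finType) (s t : I -> T).

Definition link (A : {set I}) (x y : T) : bool :=
  [exists e in A, ((s e == x) && (t e == y)) || ((s e == y) && (t e == x))].

Lemma link_edge (A : {set I}) e : e \in A -> link A (s e) (t e).
Proof. by move=> eA; apply/existsP; exists e; rewrite eA !eqxx. Qed.

Lemma link_sym A : symmetric (link A).
Proof. by move=> x y; apply: eq_existsb => e; rewrite orbC. Qed.

Lemma link_closed (A : {set I}) (a : {pred T}) :
  (forall e, e \in A -> (s e \in a) = (t e \in a)) -> closed (link A) a.
Proof.
by move=> H x y /existsP[e /andP[/H sta /orP[]/andP[/eqP<- /eqP<-]]].
Qed.

(** Grow a subset of nodes containing [r]: as long as it is not everything, some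
    edge leaves it, and adding the other end of that edge adds one node and at
    least one inner edge. *)
Lemma connected_card (A : {set I}) r :
  (forall x, connect (link A) r x) -> (#|T| <= #|A|.+1)%N.
Proof.
move=> conn.
have Tpos : (0 < #|T|)%N by apply/card_gt0P; exists r.
pose inner (X : {set T}) := [set e in A | (s e \in X) && (t e \in X)].
suff grow k : (k < #|T|)%N ->
    exists X : {set T}, [/\ r \in X, #|X| = k.+1 & (#|X| <= #|inner X|.+1)%N].
  have [|X [_ cX lX]] := grow #|T|.-1; first by rewrite prednK.
  rewrite cX prednK // in lX; apply: leq_trans lX _; rewrite ltnS.
  by apply: subset_leq_card; apply/subsetP => e; rewrite inE => /andP[].
elim: k => [_|k IHk kT].
  by exists [set r]; rewrite set11 cards1.
have [X [rX cX lX]] := IHk (ltnW kT).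
have [/existsP[e /andP[eA eX]]|none] :=
    boolP [exists e in A, (s e \in X) != (t e \in X)]; last first.
  have cl : closed (link A) (mem X).
    apply: link_closed => e eA; apply/eqP; move: none.
    by rewrite negb_exists => /forallP/(_ e); rewrite eA negbK.
  have XT : X = [set: T].
    by apply/setP => x; rewrite inE -(closed_connect cl (conn x)).
  by move: kT; rewrite -cX XT cardsT ltnn.
have [y [yX eyX]] : exists y, y \notin X /\ ((s e \in y |: X) && (t e \in y |: X)).
  case: (boolP (s e \in X)) eX => sX; case: (boolP (t e \in X)) => tX // _.
    by exists (t e); rewrite tX !inE eqxx sX orbT.
  by exists (s e); rewrite sX !inE eqxx tX orbT.
exists (y |: X); split.
- by rewrite inE rX orbT.
- by rewrite cardsU1 yX cX.
rewrite cardsU1 yX add1n ltnS; apply: (leq_trans lX).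
have <- : #|e |: inner X| = #|inner X|.+1.
  rewrite cardsU1 !inE (_ : (s e \in X) && (t e \in X) = false) ?andbF //.
  by case: (s e \in X) (t e \in X) eX => -[].
apply: subset_leq_card; apply/subsetP => f; rewrite in_setU1 !inE.
case/orP => [/eqP->|/andP[-> /andP[-> ->]]]; last by rewrite !orbT.
by move: eyX; rewrite eA !inE.
Qed.

(** Deleting an edge of a tree leaves too few edges for a connected graph, so the
    two ends of the edge fall apart; [sg] is the component of the target. The
    labelling stands in for arguments about undirected cycles. *)
Lemma bridge (r : T) e :
  (forall x, connect (link setT) r x) -> (#|I|.+1 <= #|T|)%N ->
  exists sg : pred T, [/\ ~~ sg (s e), sg (t e) & forall f, f != e -> sg (s f) = sg (t f)].
Proof.
move=> conn cardI; pose A := [set~ e].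
have csym : connect_sym (link A) by apply: sym_connect_sym; apply: link_sym.
exists (fun x => connect (link A) (t e) x); split=> [||f fe].
- apply/negP => te.
  have closedr : closed (link setT) (connect (link A) (t e)).
    apply: link_closed => f _; rewrite !inE.
    have [->|fe] := eqVneq f e; first by rewrite te connect0.
    apply: (same_connect_r csym); apply: connect1; apply: link_edge.
    by rewrite !inE.
  have : (#|T| <= #|A|.+1)%N.
    apply: (@connected_card A (t e)) => x.
    have rt := closed_connect closedr (conn (t e)).
    have rx := closed_connect closedr (conn x).
    by rewrite rt !inE connect0 in rx; rewrite -rx.
  rewrite leqNgt cardsC1 prednK; last by apply/card_gt0P; exists e.
  by rewrite cardI.
- exact: connect0.
- apply: (same_connect_r csym); apply: connect1; apply: link_edge.
  by rewrite !inE.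
Qed.

End Multigraph.

(** * Counting directed paths *)

Lemma sum_gt0 (I : finType) (P : pred I) (F : I -> nat) :
  0 < \sum_(i | P i) F i -> exists2 i, P i & 0 < F i.
Proof.
have [/existsP[i /andP[Pi Fi]]|] := boolP [exists i, P i && (0 < F i)].
  by exists i.
rewrite negb_exists => /forallP none; rewrite big1 // => i Pi.
by move: (none i); rewrite Pi /= lt0n negbK => /eqP.
Qed.

Section Paths.
Context (m n : nat) (G : graph m n).
Local Notation edge := (edge G).
Local Notation wire := (wire G).

(** A height with fewer values than vertices bounds the length of the directed
    paths by the number of vertices, as the definition of [pth] takes for
    granted. *)
Lemma bounded_height : exists h : 'I_(nvert G) -> nat,
  (forall v, h v < nvert G) /\
  (forall p q, wire (inr p) = inr q -> h (tag p) < h (tag q)).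
Proof.
have /acyclicP[rk rkP] := graph_acyclic G.
exists (fun v => #|[set u | rk u < rk v]|); split=> [v|p q /rkP lt].
  rewrite -[X in _ < X]card_ord -cardsT; apply: proper_card; apply/properP.
  by split; [apply/subsetP => u; rewrite inE | exists v; rewrite !inE ?ltnn].
apply: proper_card; apply/properP; split.
  by apply/subsetP => u; rewrite !inE => /ltn_trans; apply.
by exists (tag p); rewrite !inE ?ltnn.
Qed.

(** Acyclicity as an induction principle: follow the edges downstream. *)
Lemma edge_ind (P : edge -> Prop) :
  (forall e, (forall q p, wire e = inr q -> tag p = tag q -> P (inr p)) -> P e) ->
  forall e, P e.
Proof.
move=> step; have [h [hN hlt]] := bounded_height.
suff port_ind k p : nvert G - h (tag p) <= k -> P (inr p).
  by move=> e; apply: step => q p _ _; apply: (port_ind _ p (leqnn _)).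
elim: k p => [|k IHk] p; first by have := hN (tag p); lia.
move=> hp; apply: step => q p' /hlt lt pq; apply: IHk; rewrite pq.
by have := hN (tag p); lia.
Qed.

(** Directed walks with [k.+1] edges from the edge [e] to output [j]. *)
Fixpoint walks (j : 'I_m) (k : nat) (e : edge) : nat :=
  match k, wire e with
  | 0, inl o => (o == j)
  | k'.+1, inr q => \sum_(p : port (outs G) | tag p == tag q) walks j k' (inr p)
  | _, _ => 0
  end.

Definition npaths (j : 'I_m) (e : edge) : nat := \sum_(k < (nvert G).+1) walks j k e.

Lemma walks_long j e : walks j (nvert G).+1 e = 0.
Proof.
have [h [hN hlt]] := bounded_height.
suff bnd k e' q : wire e' = inr q -> 0 < walks j k e' -> h (tag q) + k <= nvert G.
  case E: (wire e) => [o|q]; first by rewrite /= E.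
  apply/eqP; rewrite -leqn0 leqNgt; apply/negP => pos.
  by have := bnd _ _ _ E pos; lia.
elim: k e' q => [|k IHk] e' q E /=; rewrite E // => pos.
have [p /eqP pq posp] := sum_gt0 pos.
case E': (wire (inr p)) => [o|q'].
  case: k {IHk pos} posp => [_|k] /=; last by rewrite E'.
  by rewrite addn1; apply: hN.
by have := IHk _ _ E' posp; have := hlt _ _ E'; rewrite pq; lia.
Qed.

Lemma npathsE j e :
  npaths j e = match wire e with
               | inl o => (o == j)
               | inr q => \sum_(p : port (outs G) | tag p == tag q) npaths j (inr p)
               end.
Proof.
rewrite /npaths; case E: (wire e) => [o|q].
  by rewrite big_ord_recl /= E big1 ?addn0 // => i _; rewrite E.
rewrite exchange_big /= [LHS]big_ord_recl [walks j _ _]/= E add0n.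
rewrite [RHS](_ : _ = \sum_(k < (nvert G).+1) walks j k.+1 e); last first.
  by apply: eq_bigr => k _ /=; rewrite E.
rewrite [RHS]big_ord_recr (walks_long j e : walks j (ord_max : 'I_(nvert G).+1).+1 e = 0).
exact: (esym (addn0 _)).
Qed.

(** Path counts of composite graphs are computed by checking that a candidate
    satisfies the recursion [npathsE], instead of cutting and gluing paths. *)
Lemma npaths_unique (j : 'I_m) (F : edge -> nat) :
  (forall e, F e = match wire e with
               | inl o => (o == j)
               | inr q => \sum_(p : port (outs G) | tag p == tag q) F (inr p)
               end) ->
  F =1 npaths j.
Proof.
move=> FE; elim/edge_ind => e IHe; rewrite FE npathsE.
case E: (wire e) => [//|q]; apply: eq_bigr => p /eqP; exact: IHe.
Qed.

Definition path_mx (j : 'I_m) (i : 'I_n) : nat := npaths j (inl i).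

Lemma card_tuples (k : nat) e :
  #|[set p : k.+1.-tuple edge | [&& thead p == e,
      sorted (fun e e' => tgt e == src e') p & is_inl (wire (last (thead p) p))]]|
  = \sum_j walks j k e.
Proof.
elim: k e => [|k IHk] e.
  have -> : \sum_j walks j 0 e = is_inl (wire e).
    rewrite /=; case: (wire e) => [o|q]; last by rewrite big1.
    by rewrite (bigD1 o) //= eqxx big1 ?addn0 // => j; rewrite eq_sym => /negbTE->.
  case E: (is_inl (wire e)) => /=.
    apply/eqP/cards1P; exists [tuple e]; apply/setP => p; rewrite !inE.
    case/tupleP: p => e' p; rewrite (tuple0 p) theadE /=.
    have [->|ne] := eqVneq e' e; first by rewrite E; apply/esym/eqP.
    by apply/esym/negbTE; apply: contra_neq ne => /(congr1 (@thead _ _)); rewrite !theadE.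
  apply: eq_card0 => p; rewrite !inE.
  case/tupleP: p => e' p; rewrite (tuple0 p) theadE /=.
  by case: eqVneq => // ->; rewrite E.
pose good k (p : k.+1.-tuple edge) :=
  sorted (fun e e' => tgt e == src e') p && is_inl (wire (last (thead p) p)).
have -> : #|[set p : k.+2.-tuple edge | (thead p == e) && good _ p]|
   = #|[set p : k.+1.-tuple edge | (tgt e == src (thead p)) && good _ p]|.
  pose f (p : k.+1.-tuple edge) := [tuple of e :: p].
  have fI : injective f.
    by move=> p q /(congr1 (fun x : k.+2.-tuple edge => behead x)) /= /val_inj.
  (* prepending [e] is a bijection between the two sets of tuples *)
  rewrite -(card_imset _ fI); congr #|pred_of_set _|; apply/setP => p.
  case/tupleP: p => e' p; rewrite !inE theadE; apply/andP/imsetP.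
    case=> /eqP-> /andP[]; case/tupleP: p => e'' p /= /andP[ee sp] lp.
    exists [tuple of e'' :: p]; rewrite // inE; apply/andP; split; [exact: ee | by apply/andP].
  case=> p'; rewrite inE => /andP[ee /andP[sp lp]] E0.
  have [-> ->] : e' = e /\ p = p'.
    split; first exact: (congr1 (@thead _ _) E0).
    by apply: val_inj; have := congr1 (fun x : k.+2.-tuple edge => behead x) E0.
  rewrite eqxx; split=> //; move: ee sp lp; case/tupleP: p' {E0} => e'' p''.
  by rewrite /good !theadE /= => -> -> ->.
rewrite -sum1_card (partition_big (@thead _ _) (fun e' => tgt e == src e')) /=; last first.
  by move=> p; rewrite inE => /andP[].
rewrite (eq_bigr (fun e' => \sum_j walks j k e')); last first.
  move=> e' ee; rewrite -IHk -sum1_card; apply: eq_bigl => p; rewrite !inE.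
  have [E|] := eqVneq (thead p) e'; rewrite ?andbF // andbT andTb.
  by rewrite (_ : tgt e == src (thead p)) // E.
rewrite exchange_big /=; apply: eq_bigr => j _; rewrite /tgt.
case: (wire e) => [o|q].
  by rewrite big_pred0 // => -[].
rewrite big_sumType /= big_pred0 ?add0n //=.
by apply: eq_bigl => p; rewrite eq_sym.
Qed.

Lemma pthE : pth G = \sum_(j < m) \sum_(i < n) path_mx j i.
Proof.
rewrite /pth /path_mx /npaths.
under [RHS]eq_bigr => j _ do rewrite exchange_big.
rewrite [RHS]exchange_big; apply: eq_bigr => k _ /=.
pose good (p : k.+1.-tuple edge) :=
  sorted (fun e e' => tgt e == src e') p && is_inl (wire (last (thead p) p)).
rewrite -sum1_card (partition_big (@thead _ _) (fun e => is_inl e)) /=; last first.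
  by move=> p; rewrite inE => /and3P[].
rewrite big_sumType [\sum_(i : port _ | _) _]big_pred0 //=.
rewrite addn0 [RHS]exchange_big. 
apply: eq_bigr => i _; rewrite -card_tuples -sum1_card; apply: eq_bigl => p.
rewrite !inE /is_dipath; have [E|] := eqVneq (thead p) (inl i); rewrite ?andbF //=.
by rewrite E andbT.
Qed.

End Paths.

(** * Invariance under isomorphisms of graphs *)

Section GraphIso.
Context (m n : nat).

(** What an isomorphism of decorated graphs retains when the decorations are
    forgotten: the relabellings of half-edges are packed into maps of ports. *)
Record graph_iso (G G' : graph m n) (f : 'I_(nvert G) -> 'I_(nvert G'))
    (po : port (outs G) -> port (outs G'))
    (pi : port (ins G) -> port (ins G')) : Prop := GraphIso {
  giso_vert : bijective f;
  giso_out : bijective po;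
  giso_outs : forall p, tag (po p) = f (tag p);
  giso_ins : forall q, tag (pi q) = f (tag q);
  giso_outsE : forall v, outs G' (f v) = outs G v;
  giso_wire : forall x, wire G' (port_map po x) = port_map pi (wire G x)
}.

Definition isomorphic (G G' : graph m n) : Prop :=
  exists f po pi, @graph_iso G G' f po pi.

Lemma card_port N (a : 'I_N -> nat) : #|{: port a}| = \sum_v a v.
Proof.
rewrite card_tagged sumnE big_map big_enum /=.
by apply: eq_bigr => v _; rewrite card_ord.
Qed.

Lemma npaths_iso G G' f po pi j e : @graph_iso G G' f po pi ->
  npaths (G := G') j (port_map po e) = npaths (G := G) j e.
Proof.
move=> gi; apply: (@npaths_unique _ _ G j (fun e => npaths j (port_map po e))) => {}e.
rewrite npathsE (giso_wire gi); case: (wire G e) => [//|q] /=.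
rewrite (reindex po) /=; last exact: onW_bij (giso_out gi).
apply: eq_bigl => p; rewrite (giso_outs gi) (giso_ins gi).
by rewrite (bij_eq (giso_vert gi)).
Qed.

Lemma path_mx_iso G G' : isomorphic G G' -> path_mx G' =2 path_mx G.
Proof. by case=> f [po [pi gi]] j i; apply: (npaths_iso j (inl i) gi). Qed.

Lemma nvert_iso G G' : isomorphic G G' -> nvert G' = nvert G.
Proof. by case=> f [po [pi /giso_vert/bij_eq_card]]; rewrite !card_ord. Qed.

Lemma edge_iso G G' : isomorphic G G' -> #|{: edge G'}| = #|{: edge G}|.
Proof.
case=> f [po [pi /giso_out/bij_eq_card cp]].
by rewrite !card_sum; congr addn; rewrite cp.
Qed.

Lemma ncomp_iso G G' : isomorphic G G' -> ncomp G' = ncomp G.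
Proof.
case=> f [po [pi gi]].
pose h (x : node G) : node G' := match x with inl v => inl (f v) | inr y => inr y end.
have hI : injective h.
  by case=> [u|x] [v|y] //= [] => [/(bij_inj (giso_vert gi))->|->].
have hs (e : edge G) : src (port_map po e : edge G') = h (src e).
  by case: e => [//|p] /=; rewrite (giso_outs gi).
have ht (e : edge G) : tgt (port_map po e : edge G') = h (tgt e).
  rewrite /tgt (giso_wire gi); case: (wire G e) => [//|q] /=.
  by rewrite (giso_ins gi).
have hadj x y : adj (h x) (h y) = adj x y.
  apply/existsP/existsP => [] [e /andP[/eqP sx /eqP ty]]; last first.
    by exists (port_map po e); rewrite hs ht sx ty !eqxx.
  have [g _ gK] := giso_out gi.
  have eE : e = port_map po (port_map g e : edge G).
    by case: (e) => //= p; rewrite gK.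
  by exists (port_map g e); apply/andP; split; apply/eqP; apply: hI;
    rewrite -?hs -?ht -eE.
have es (H : pregraph m n) : connect_sym (fun x y : node H => adj x y || adj y x).
  by apply: sym_connect_sym => x y; rewrite orbC.
rewrite /ncomp (adjunction_n_comp h (es G') (es G)).
- by apply: eq_n_comp_r.
- by move=> x y.
apply: strict_adjunction => //; last by move=> x y _; rewrite /= !hadj.
have [g _ gK] := giso_vert gi.
apply/subsetP => x _; apply/codomP.
by case: x => [v|x]; [exists (inl (g v)); rewrite /= gK | exists (inr x)].
Qed.

Lemma cmp_iso G G' : isomorphic G G' -> cmp G' = cmp G.
Proof. by rewrite /cmp => /ncomp_iso->. Qed.

Lemma gen_iso G G' : isomorphic G G' -> gen_grading G' = gen_grading G.
Proof.
move=> gi; rewrite /gen_grading (ncomp_iso gi) (edge_iso gi).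
by rewrite !card_sum !card_ord (nvert_iso gi).
Qed.

(** A substitute for the first Betti number that is local at the vertices, hence
    additive under both compositions even when components merge. *)
Definition branching (G : pregraph m n) : nat := \sum_v (outs G v).-1.

Lemma branching_iso (G G' : graph m n) : isomorphic G G' -> branching G' = branching G.
Proof.
case=> f [po [pi gi]]; rewrite /branching (reindex f) /=; last exact: onW_bij (giso_vert gi).
by apply: eq_bigr => v _; rewrite (giso_outsE gi).
Qed.

End GraphIso.

Section DgraphIso.
Context (k : fieldType) (E : bicollection k) (m n : nat).

Lemma relabeledP (r l : nat -> nat) (c c' : corolla E) : relabeled r l c c' ->
  [/\ c_out c' = c_out c, c_in c' = c_in c,
      (forall j, j < c_out c -> r j < c_out c) /\
      (forall i j, i < c_out c -> j < c_out c -> r i = r j -> i = j)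
    & forall i, i < c_in c -> l i < c_in c].
Proof.
case=> a b d e s t rs lt; split=> //=; last first.
  by move=> i ib; rewrite (lt (Ordinal ib)).
have rE (j : 'I_a) : r j = (s^-1%g j : 'I_a) by rewrite -[in LHS](permKV s j) rs.
split=> [j ja|i j ia ja]; first by rewrite (rE (Ordinal ja)).
rewrite (rE (Ordinal ia)) (rE (Ordinal ja)) => /ord_inj/perm_inj.
by move/(congr1 val).
Qed.

Lemma port_bij N N' (a : 'I_N -> nat) (a' : 'I_N' -> nat) (f : 'I_N -> 'I_N')
    (r : 'I_N -> nat -> nat) :
  (forall v j, j < a v -> r v j < a' (f v)) ->
  exists po : port a -> port a', forall p, port_corr f r p (po p).
Proof.
move=> ra.
exists (fun p : port a => Tagged (fun v => 'I_(a' v)) (i := f (tag p))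
           (Ordinal (ra (tag p) (tagged p) (ltn_ord _)))).
by [].
Qed.

Lemma dgraph_iso_isomorphic (D D' : dgraph E m n) f r l :
  dgraph_iso (D := D) (D' := D') f r l -> isomorphic D D'.
Proof.
case=> fB st wE.
have oE v : outs D' (f v) = outs D v by case: (relabeledP (st v)).
have iE v : ins D' (f v) = ins D v by case: (relabeledP (st v)).
have [|po poP] := @port_bij _ _ (outs D) (outs D') f r.
  by move=> v j; rewrite oE; case: (relabeledP (st v)) => _ _ [+ _] _; apply.
have [|pi piP] := @port_bij _ _ (ins D) (ins D') f l.
  by move=> v j; rewrite iE; case: (relabeledP (st v)) => _ _ _; apply.
exists f, po, pi; split=> //.
- apply: inj_card_bij.
    move=> p p' pp'; have [tp vp] := poP p; have [tp' vp'] := poP p'.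
    have tt : tag p = tag p' by apply: (bij_inj fB); rewrite -tp -tp' pp'.
    apply: port_eq => //; case: (relabeledP (st (tag p))) => _ _ [_ rI] _.
    apply: rI; rewrite /= ?ltn_ord //; first by rewrite tt ltn_ord.
    by rewrite -vp pp' vp' tt.
  rewrite !card_port (reindex f) /=; last exact: onW_bij.
  by rewrite leq_eqVlt (eq_bigr _ (fun v _ => oE v)) eqxx.
- by move=> p; case: (poP p).
- by move=> p; case: (piP p).
move=> x; have : corr f r x (port_map po x) by case: x => //= p; apply: poP.
move/wE; case: (wire D x) (wire D' _) => [o|q] [o'|q'] //= => [->//|[tq vq]].
by congr inr; have [tq' vq'] := piP q; apply: port_eq; rewrite ?tq ?vq.
Qed.

End DgraphIso.

(** * The path matrix of a composite *)

Lemma big_port_case N1 N2 (a1 : 'I_N1 -> nat) (a2 : 'I_N2 -> nat)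
    (P : pred (port (ord_case a1 a2))) (F : port (ord_case a1 a2) -> nat) :
  \sum_(p | P p) F p =
  \sum_(p | P (portl p)) F (portl p) + \sum_(p | P (portr p)) F (portr p).
Proof.
pose h (s : port a1 + port a2) : port (ord_case a1 a2) :=
  match s with inl p => portl p | inr p => portr p end.
rewrite (reindex h) /=; first by rewrite big_sumType.
apply: onW_bij; exists port_split; last exact: port_splitK.
by case=> p /=; rewrite ?port_splitL ?port_splitR.
Qed.

Section Next.
Context (m n : nat) (G : graph m n) (j : 'I_m).

Definition npaths_from (x : 'I_m + port (ins G)) : nat :=
  match x with
  | inl o => (o == j)
  | inr q => \sum_(p : port (outs G) | tag p == tag q) npaths j (inr p)
  end.

Lemma npaths_wire e : npaths j e = npaths_from (wire G e).
Proof. exact: npathsE. Qed.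

End Next.

Lemma path_mx_unit j i : path_mx unit_graph j i = 1.
Proof. by rewrite /path_mx npathsE /= [i]ord1 [j]ord1. Qed.

Lemma path_mx_corolla m n hm hn hmn j i : path_mx (@corolla_graph m n hm hn hmn) j i = 1.
Proof.
rewrite /path_mx npathsE /=.
pose h (o : 'I_m) : port (fun _ : 'I_1 => m) := Tagged (fun=> 'I_m) (i := ord0) o.
rewrite (reindex h) /=; last first.
  apply: onW_bij; exists (fun p : port (fun _ : 'I_1 => m) => tagged p) => //.
  by case=> v o /=; rewrite [v]ord1.
rewrite (eq_bigl xpredT); last by move=> o; rewrite /= eqxx.
rewrite (bigD1 j) //= npathsE /= eqxx big1 // => o oj.
by rewrite npathsE /= (negbTE oj).
Qed.

Lemma path_mx_relabel m n s t (G : graph m n) j i :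
  path_mx (relabel_graph s t G) j i = path_mx G (s j) (t^-1%g i).
Proof.
pose F (e : edge (relabel_graph s t G)) : nat := @npaths _ _ G (s j)
  (match e with inl i => inl (t^-1%g i) | inr p => inr p end).
rewrite /path_mx -[LHS](_ : F (inl i) = _) //; apply: npaths_unique => e.
rewrite /F npathsE /=.
case: (wire G _) => [o|q //].
by congr nat_of_bool; apply/eqP/eqP => [->|<-]; rewrite ?permK ?permKV.
Qed.

Section Vertical.
Context (m n l : nat) (G : graph m n) (H : graph n l) (j : 'I_m).

Lemma path_mx_vcomp i :
  path_mx (vcomp_graph G H) j i = \sum_(j' < n) path_mx G j j' * path_mx H j' i.
Proof.
pose top (e : edge H) := \sum_(j' < n) path_mx G j j' * npaths j' e.
pose F (e : edge (vcomp_graph G H)) := match e with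
  | inl i => top (inl i)
  | inr q => match port_split q with
             | inl p => npaths j (inr p : edge G)
             | inr p => top (inr p)
             end
  end.
rewrite [LHS](_ : _ = F (inl i)) //; apply/esym/npaths_unique => {i}.
pose next (x : 'I_m + port (ord_case (ins G) (ins H))) := match x with
   | inl o => (o == j) : nat
   | inr q => \sum_(p : port (ord_case (outs G) (outs H)) | tag p == tag q) F (inr p) end.
have nextL x : next (vcomp_tgtl H x) = npaths_from j x.
  case: x => [//|q] /=; rewrite big_port_case [X in _ + X]big_pred0 ?addn0.
    by apply: eq_big => p; rewrite ?port_splitL //= (inj_eq (@lshift_inj _ _)).
  by move=> p /=; rewrite eq_rlshift.
have nextR x : next (vcomp_tgtr G x) = \sum_(j' < n) path_mx G j j' * npaths_from j' x.
  case: x => [j'|q] /=.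
    rewrite nextL -npaths_wire (bigD1 j') //= eqxx muln1 big1 ?addn0 // => o.
    by rewrite eq_sym => /negbTE->; rewrite muln0.
  rewrite big_port_case big_pred0 ?add0n; last by move=> p /=; rewrite eq_lrshift.
  under eq_bigr do rewrite port_splitR /top.
  under [RHS]eq_bigr do rewrite big_distrr.
  rewrite exchange_big /=; apply: eq_bigr => o _; apply: eq_bigl => p.
  by rewrite (inj_eq (@rshift_inj _ _)).
have topE e : top e = next (vcomp_tgtr G (wire H e)).
  by rewrite nextR; apply: eq_bigr => o _; rewrite npaths_wire.
case=> [i|q]; first exact: topE.
rewrite /= -/(next _); case: (port_sumP q) => p; rewrite !(port_splitL, port_splitR).
  by rewrite nextL npaths_wire.
exact: topE.
Qed.

End Vertical.

Section Horizontal.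
Context (m1 n1 m2 n2 : nat) (G : graph m1 n1) (H : graph m2 n2).

Lemma path_mx_hcomp j :
  path_mx (hcomp_graph G H) j =1
  ord_case (fun i => ord_case (fun j => path_mx G j i) (fun=> 0) j)
           (fun i => ord_case (fun=> 0) (fun j => path_mx H j i) j).
Proof.
pose FG (e : edge G) := ord_case (fun j => npaths j e) (fun=> 0) j.
pose FH (e : edge H) := ord_case (fun=> 0) (fun j => npaths j e) j.
pose F (e : edge (hcomp_graph G H)) := match e with
  | inl i => ord_case (fun i => FG (inl i)) (fun i => FH (inl i)) i
  | inr q => match port_split q with inl p => FG (inr p) | inr p => FH (inr p) end
  end.
move=> i; rewrite [LHS](_ : _ = F (inl i)) //; apply/esym/npaths_unique => {i}.
pose next (x : 'I_(m1 + m2) + port (ord_case (ins G) (ins H))) := match x with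
   | inl o => (o == j) : nat
   | inr q => \sum_(p : port (ord_case (outs G) (outs H)) | tag p == tag q) F (inr p) end.
have nextL x : next (hcomp_tgtl H x) = ord_case (fun j => npaths_from j x) (fun=> 0) j.
  case: x => [o|q] /=.
    case: (ord_sumP j) => u; rewrite ?ord_caseL ?ord_caseR.
      by rewrite (inj_eq (@lshift_inj _ _)).
    by rewrite eq_lrshift.
  rewrite big_port_case [X in _ + X]big_pred0 ?addn0; last first.
    by move=> p /=; rewrite eq_rlshift.
  under eq_bigl do rewrite (inj_eq (@lshift_inj _ _)).
  under eq_bigr do rewrite port_splitL /FG.
  case: (ord_sumP j) => u; under eq_bigr do rewrite ?ord_caseL ?ord_caseR.
    by rewrite ord_caseL.
  by rewrite ord_caseR big1.
have nextR x : next (hcomp_tgtr G x) = ord_case (fun=> 0) (fun j => npaths_from j x) j.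
  case: x => [o|q] /=.
    case: (ord_sumP j) => u; rewrite ?ord_caseL ?ord_caseR.
      by rewrite eq_rlshift.
    by rewrite (inj_eq (@rshift_inj _ _)).
  rewrite big_port_case big_pred0 ?add0n; last first.
    by move=> p /=; rewrite eq_lrshift.
  under eq_bigl do rewrite (inj_eq (@rshift_inj _ _)).
  under eq_bigr do rewrite port_splitR /FH.
  case: (ord_sumP j) => u; under eq_bigr do rewrite ?ord_caseL ?ord_caseR.
    by rewrite ord_caseL big1.
  by rewrite ord_caseR.
have FGE e : FG e = next (hcomp_tgtl H (wire G e)).
  by rewrite nextL /FG; case: (ord_sumP j) => u; rewrite ?ord_caseL ?ord_caseR // npaths_wire.
have FHE e : FH e = next (hcomp_tgtr G (wire H e)).
  by rewrite nextR /FH; case: (ord_sumP j) => u; rewrite ?ord_caseL ?ord_caseR // npaths_wire.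
case=> [i|q]; rewrite /= -/(next _).
  by case: (ord_sumP i) => u; rewrite ?ord_caseL ?ord_caseR.
by case: (port_sumP q) => p; rewrite !(port_splitL, port_splitR).
Qed.

End Horizontal.

Lemma branching_unit : branching unit_graph = 0.
Proof. by rewrite /branching big_ord0. Qed.

Lemma branching_corolla m n hm hn hmn : branching (@corolla_graph m n hm hn hmn) = m.-1.
Proof. by rewrite /branching big_ord1. Qed.

Lemma branching_relabel m n s t (G : graph m n) : branching (relabel_graph s t G) = branching G.
Proof. by []. Qed.

Lemma sum_pred_case N1 N2 (a1 : 'I_N1 -> nat) (a2 : 'I_N2 -> nat) :
  \sum_v (ord_case a1 a2 v).-1 = \sum_v (a1 v).-1 + \sum_v (a2 v).-1.
Proof.
by rewrite big_split_ord; congr (_ + _); apply: eq_bigr => v _; rewrite ?ord_caseL ?ord_caseR.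
Qed.

Lemma branching_vcomp m n l (G : graph m n) (H : graph n l) :
  branching (vcomp_graph G H) = branching G + branching H.
Proof. exact: sum_pred_case. Qed.

Lemma branching_hcomp m1 n1 m2 n2 (G : graph m1 n1) (H : graph m2 n2) :
  branching (hcomp_graph G H) = branching G + branching H.
Proof. exact: sum_pred_case. Qed.

(** * Contractible graphs and bad edges *)

Section Contractible.
Context (m n : nat) (G : graph m n).
Local Notation edge := (edge G).
Local Notation node := (node G).
Local Notation wire := (wire G).
Local Notation olink := (link (@src m n G) (@tgt m n G) setT).

Lemma link_adj x y : olink x y = adj x y || adj y x.
Proof.
apply/existsP/orP => [[e]|[]/existsP[e he]].
- by rewrite inE => /orP[he|he]; [left|right]; apply/existsP; exists e.
- by exists e; rewrite inE he.
- by exists e; rewrite inE he orbT.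
Qed.

Lemma ncomp_gt0 : 0 < ncomp G.
Proof.
have /andP[m0 _] := graph_pos G; pose x : node := inr (inl (Ordinal m0)).
apply/card_gt0P; exists (fingraph.root (fun x y => adj x y || adj y x) x).
rewrite inE andbT; apply: roots_root.
by apply: sym_connect_sym => y z; rewrite orbC.
Qed.

Hypothesis connG : cmp G == 0.

Lemma ncomp1 : ncomp G = 1.
Proof. by have := ncomp_gt0; move: connG; rewrite /cmp; lia. Qed.

Lemma connected_link (x y : node) : connect olink x y.
Proof.
rewrite (eq_connect link_adj).
have sym : connect_sym (fun x y : node => adj x y || adj y x).
  by apply: sym_connect_sym => u v; rewrite orbC.
rewrite -(root_connect sym).
have /cards1P[r rE] :
    #|[set u | fingraph.roots (fun x y : node => adj x y || adj y x) u]| == 1.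
  by rewrite cardsE -[X in _ == X]ncomp1; apply/eqP/eq_card => u; rewrite !inE andbT.
have rootE u : fingraph.root (fun x y : node => adj x y || adj y x) u = r.
  by apply/set1P; rewrite -rE inE; apply: roots_root.
by rewrite !rootE.
Qed.

Lemma card_node : #|{: node}| = nvert G + (m + n).
Proof. by rewrite !card_sum !card_ord. Qed.

Lemma card_edge : #|{: edge}| = n + (branching G + nvert G).
Proof.
rewrite card_sum card_ord card_port; congr addn.
rewrite -[X in _ = _ + X]card_ord -sum1_card -big_split /=; apply: eq_bigr => v _.
by have /and3P[] := graph_val G v; lia.
Qed.

(** Without this bound the truncated subtraction that defines [gen_grading] would
    lose information on connected graphs. *)
Lemma node_le_edge : #|{: node}| <= #|{: edge}|.+1.
Proof.
have /andP[m0 _] := graph_pos G; rewrite -cardsT.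
have /= := @connected_card _ _ (@src m n G) (@tgt m n G) setT (inr (inl (Ordinal m0)) : node).
by rewrite !cardsT; apply=> x; apply: connected_link.
Qed.

Lemma gen_branching : gen_grading G + m.-1 = branching G.
Proof.
have := node_le_edge; rewrite /gen_grading ncomp1 card_node card_edge.
by have /andP[] := graph_pos G; lia.
Qed.

End Contractible.

Lemma contractible_branching m n (G : graph m n) :
  contractible G = (cmp G == 0) && (branching G == m.-1).
Proof.
rewrite /contractible; case: (boolP (cmp G == 0)) => // cG /=.
by have := gen_branching cG; lia.
Qed.

Section Tree.
Context (m n : nat) (G : graph m n).
Local Notation edge := (edge G).
Local Notation node := (node G).
Local Notation wire := (wire G).

Lemma npaths_step j (e : edge) q : wire e = inr q -> 0 < npaths j e ->
  exists2 p : port (outs G), tag p = tag q & 0 < npaths j (inr p : edge).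
Proof.
move=> E; rewrite npathsE E => /sum_gt0[p /eqP pq pos]; by exists p.
Qed.

Lemma npaths_next j (e : edge) q p : wire e = inr q -> tag p = tag q ->
  npaths j (inr p : edge) <= npaths j e.
Proof.
by move=> E pq; rewrite (npathsE j e) E (bigD1 p) ?leq_addr // pq.
Qed.

Lemma npaths_exists (e : edge) : exists j, 0 < npaths j e.
Proof.
elim/edge_ind: e => e IHe; case E: (wire e) => [o|q].
  by exists o; rewrite npathsE E eqxx.
have /and3P[o0 _ _] := graph_val G (tag q).
pose p : port (outs G) := Tagged (fun v => 'I_(outs G v)) (Ordinal o0).
have [//|j pj] := IHe q p E; exists j; apply: leq_trans pj _; exact: npaths_next E _.
Qed.

Lemma label_monotone (sg : pred node) j (e : edge) :
  (forall e : edge, sg (src e) -> sg (tgt e)) ->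
  0 < npaths j e -> sg (tgt e) -> sg (inr (inl j)).
Proof.
move=> mon; elim/edge_ind: e => e IHe; case E: (wire e) => [o|q].
  by rewrite npathsE /tgt E; case: eqP => // ->.
move=> /(npaths_step E)[p pq pj]; rewrite /tgt E => sq.
by apply: (IHe q p E pq pj); apply: mon; rewrite /src pq.
Qed.

Context (h : 'I_(nvert G) -> nat).
Hypothesis hlt : forall p q, wire (inr p) = inr q -> h (tag p) < h (tag q).

(** By acyclicity, a directed path that starts past the source of the edge [p0]
    never comes back to cross it. *)
Lemma label_constant (sg : pred node) j p0 (e : edge) :
  (forall e : edge, e != inr p0 -> sg (src e) = sg (tgt e)) ->
  (forall q, wire e = inr q -> h (tag p0) < h (tag q)) ->
  0 < npaths j e -> sg (inr (inl j)) = sg (tgt e).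
Proof.
move=> con; elim/edge_ind: e => e IHe; case E: (wire e) => [o|q] hq.
  by rewrite npathsE /tgt E; case: eqP => // ->.
move=> /(npaths_step E)[p pq pj]; have hp := hq q erefl.
rewrite (IHe q p E pq _ pj).
  rewrite -con; first by rewrite /tgt E /src pq.
  by apply: contraTneq hp => -[<-]; rewrite pq ltnn.
by move=> q' /hlt; rewrite pq; apply: ltn_trans.
Qed.

(** Going upstream from above the target of [e0], one reaches an input without
    crossing [e0]. *)
Lemma label_backward (sg : pred node) q0 (e0 e : edge) :
  (forall e : edge, e != e0 -> sg (src e) = sg (tgt e)) ->
  wire e0 = inr q0 ->
  (forall p, e = inr p -> h (tag p) < h (tag q0)) ->
  exists i, sg (inr (inr i)) = sg (src e).
Proof.
move=> con E0; have [w wK Kw] := graph_wire G.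
suff back k (p : port (outs G)) : h (tag p) < k -> h (tag p) < h (tag q0) ->
    exists i, sg (inr (inr i)) = sg (inl (tag p)).
  case: e => [i _|p /(_ p erefl)]; first by exists i.
  exact: (back _ p (ltnSn _)).
elim: k p => [//|k IHk] p pk pq0; rewrite ltnS in pk.
have /and3P[_ i0 _] := graph_val G (tag p).
pose q : port (ins G) := Tagged (fun v => 'I_(ins G v)) (Ordinal i0).
have E : wire (w (inr q)) = inr q by rewrite Kw.
have -> : sg (inl (tag p)) = sg (src (w (inr q) : edge)).
  rewrite con; first by rewrite /tgt E.
  by apply: contraTneq pq0 => ee; move: E; rewrite ee E0 => -[->]; rewrite ltnn.
case Ew: (w (inr q)) E => [i|p'] E; first by exists i.
have lt := hlt E; apply: IHk; first exact: leq_trans lt pk.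
exact: ltn_trans lt pq0.
Qed.

Lemma npaths_backward j (p : port (outs G)) :
  exists i, npaths j (inr p : edge) <= path_mx G j i.
Proof.
have [w wK Kw] := graph_wire G.
elim: {p}(h (tag p)).+1 {-2}p (ltnSn (h (tag p))) => [//|k IHk] p; rewrite ltnS => pk.
have /and3P[_ i0 _] := graph_val G (tag p).
pose q : port (ins G) := Tagged (fun v => 'I_(ins G v)) (Ordinal i0).
have E : wire (w (inr q)) = inr q by rewrite Kw.
have le : npaths j (inr p : edge) <= npaths j (w (inr q) : edge).
  exact: npaths_next E _.
case Ew: (w (inr q)) E le => [i|p'] E le; first by exists i.
have [i le'] := IHk p' (leq_trans (hlt E) pk).
exists i; exact: leq_trans le le'.
Qed.

End Tree.

Lemma path_mx_col m n (G : graph m n) i : exists j, 0 < path_mx G j i.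
Proof. exact: npaths_exists. Qed.

Lemma path_mx_row m n (G : graph m n) j : exists i, 0 < path_mx G j i.
Proof.
have [h [_ hlt]] := bounded_height G; have [w wK Kw] := graph_wire G.
have : npaths j (w (inl j) : edge G) = 1 by rewrite npathsE Kw eqxx.
case: (w (inl j)) => [i|p] np; first by exists i; rewrite /path_mx np.
by have [i le] := npaths_backward hlt j p; exists i; rewrite -np.
Qed.

Section TreePaths.
Context (m n : nat) (G : graph m n).
Local Notation edge := (edge G).
Local Notation node := (node G).
Local Notation wire := (wire G).
Hypothesis treeG : contractible G.

Lemma tree_bridge (e : edge) : exists sg : pred node,
  [/\ ~~ sg (src e), sg (tgt e) & forall f : edge, f != e -> sg (src f) = sg (tgt f)].
Proof.
have /andP[connG gen0] := treeG.
apply: (@bridge _ _ (@src m n G) (@tgt m n G) (src e) e).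
  by move=> x; apply: connected_link.
by move: gen0; rewrite /gen_grading (ncomp1 connG) subn_eq0 addn1.
Qed.

(** Two different ways to reach [j] from a vertex would start with two edges [p]
    and [p'] out of it; the bridge [p] separates its target, and thus [j], from
    the vertex, so a path through [p'] would have to return and cross [p]. *)
Lemma tree_npaths_le1 j (e : edge) : npaths j e <= 1.
Proof.
have [h [_ hlt]] := bounded_height G.
elim/edge_ind: e => e IHe; rewrite npathsE; case E: (wire e) => [o|q].
  by case: eqP.
have [->//|/sum_gt0[p /eqP pq pj]] :=
  posnP (\sum_(p : port (outs G) | tag p == tag q) npaths j (inr p : edge)).
rewrite (bigD1 p) ?pq //= big1 ?addn0; first exact: IHe E pq.
move=> p' /andP[/eqP p'q p'p]; apply/eqP; rewrite -leqn0 leqNgt; apply/negP => p'j.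
have [sg [sp tp con]] := tree_bridge (inr p).
have pc : sg (inr (inl j)).
  apply: label_monotone pj tp => f.
  have [->|/con->//] := eqVneq f (inr p); by rewrite (negbTE sp).
have := label_constant hlt con _ p'j; rewrite pc -con; last by apply: contra_neq p'p => -[].
rewrite /src p'q -pq => H; move: sp; rewrite /src -H //.
by move=> q' /hlt; rewrite p'q pq.
Qed.

Lemma tree_path_mx_le1 j i : path_mx G j i <= 1.
Proof. exact: tree_npaths_le1. Qed.

Lemma other_ord a (i : 'I_a) : 1 < a -> exists i' : 'I_a, i' != i.
Proof.
case: a i => [|[|a]] // i _; exists (if i == ord0 then ord_max else ord0).
by have [->|] := eqVneq i ord0; rewrite 1?eq_sym.
Qed.

(** The source of the bad edge has another output, leading downstream to some leg
    [j] on the source side of the bridge; its target has another input, coming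
    from some leg [i] on the target side. Directed paths cross the bridge only
    from the source side to the target side, so none leads from [i] to [j]. *)
Lemma tree_bad_edge : has_bad_edge G -> exists j i, path_mx G j i = 0.
Proof.
have [h [_ hlt]] := bounded_height G; have [w wK Kw] := graph_wire G.
case/existsP => -[//|p0]; rewrite /bad_edge; case E0: (wire (inr p0)) => [//|q0].
case/andP => po qi; have [sg [sp tp con]] := tree_bridge (inr p0).
have [j sgj] : exists j, ~~ sg (inr (inl j)).
  have [o' oo'] := other_ord (tagged p0) po.
  pose p' : port (outs G) := Tagged (fun v => 'I_(outs G v)) (i := tag p0) o'.
  have [j pj] := npaths_exists (inr p' : edge); exists j.
  rewrite (label_constant hlt con _ pj); last by move=> q /hlt.
  rewrite -con //; apply: contra_neq oo' => -[] pp.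
  have : p' = Tagged (fun v => 'I_(outs G v)) (tagged p0) by rewrite pp; case: (p0).
  by move=> /eqP; rewrite eq_Tagged => /eqP.
have [i sgi] : exists i, sg (inr (inr i)).
  have [i' ii'] := other_ord (tagged q0) qi.
  pose q' : port (ins G) := Tagged (fun v => 'I_(ins G v)) (i := tag q0) i'.
  have E : wire (w (inr q')) = inr q' by rewrite Kw.
  have ne : w (inr q') != inr p0.
    apply: contra_neq ii' => ww; move: E; rewrite ww E0 => -[] qq.
    have : q' = Tagged (fun v => 'I_(ins G v)) (tagged q0) by rewrite -qq; case: (q0).
    by move=> /eqP; rewrite eq_Tagged => /eqP.
  have [|i si] := label_backward (e := w (inr q')) hlt con E0.
    by move=> p pE; move: E; rewrite pE => /hlt.
  by exists i; rewrite si (con _ ne) /tgt E; move: tp; rewrite /tgt E0.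
exists j, i; apply/eqP; rewrite -leqn0 leqNgt; apply/negP => pos.
move/negP: sgj; apply; apply: (label_monotone _ pos) => [f|].
  have [->|/con->//] := eqVneq f (inr p0); by rewrite (negbTE sp).
by rewrite -con.
Qed.

End TreePaths.

Lemma port_single N (a : 'I_N -> nat) (p p' : port a) :
  a (tag p) <= 1 -> tag p' = tag p -> p' = p.
Proof.
case: p p' => u i [v j] /= a1 uv; subst v; congr existT; apply: ord_inj.
by have := ltn_ord i; have := ltn_ord j; lia.
Qed.

Section NoBadEdge.
Context (m n : nat) (G : graph m n).
Local Notation edge := (edge G).
Local Notation node := (node G).
Local Notation wire := (wire G).
Hypothesis connG : cmp G == 0.
Hypothesis nobad : ~~ has_bad_edge G.
Context (j : 'I_m).

Let reach (x : node) : bool :=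
  (x == inr (inl j)) || [exists e : edge, (src e == x) && (0 < npaths j e)].

Lemma reach_tgt (e : edge) : reach (tgt e) = (0 < npaths j e).
Proof.
rewrite /reach /tgt npathsE; case E: (wire e) => [o|q].
  rewrite (_ : [exists _, _] = false) ?orbF.
    have [->|ne] := eqVneq o j; rewrite ?eqxx // (_ : _ == _ = false) //.
    by apply/negbTE; apply: contra_neq ne => -[].
  by apply/negbTE; rewrite negb_exists; apply/forallP => -[].
rewrite /=; apply/existsP/idP => [[[//|p] /andP[/eqP[pq] pos]]|pos].
  by rewrite (bigD1 p) ?pq //= ltn_addr.
have [|p pq pj] := @npaths_step _ _ G j e q E; first by rewrite npathsE E.
by exists (inr p); rewrite /src pq eqxx.
Qed.

Lemma reach_src (e : edge) : 0 < npaths j e -> reach (src e).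
Proof. by move=> pos; apply/orP; right; apply/existsP; exists e; rewrite eqxx. Qed.

(** Without bad edges, every vertex upstream of a vertex with several inputs has a
    single output, so a directed path that starts there has no choice but to
    pass through that vertex. *)
Lemma collector (v : 'I_(nvert G)) (y : node) : 1 < ins G v ->
  connect (@adj m n G) y (inl v) -> reach y -> reach (inl v).
Proof.
move=> v2 /connectP[s sP sv].
suff : match y with inl u => 1 < ins G u | inr (inl _) => False | _ => True end
       /\ (reach y -> reach (inl v)) by case.
(* the first conjunct records the single outputs upstream, and that no output
   leg occurs on the path *)
elim: s y sP sv => [|y1 s IHs] y /=; first by move=> _ <-.
case/andP => /existsP[e /andP[/eqP ey /eqP ey1]] sP sv.
have [] := IHs y1 sP sv; rewrite -ey1 -ey {sP sv IHs} /tgt.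
case E: (wire e) => [//|q] q2 IH.
have reach_next : 0 < npaths j e -> reach (inl v).
  by rewrite -reach_tgt /tgt E.
case: e E {ey ey1} reach_next => [i|p] E reach_next; rewrite /src.
  split=> // /orP[//|/existsP[[i'|//] /andP[/eqP[->]]]]; exact: reach_next.
have o1 : outs G (tag p) <= 1.
  rewrite leqNgt; apply/negP => p2; case/negP: nobad.
  by apply/existsP; exists (inr p); rewrite /bad_edge E p2.
have /and3P[_ _ val3] := graph_val G (tag p).
split; first by move: o1 val3 => /=; set a := outs _ _; set b := ins _ _; lia.
case/orP => [//|/existsP[[//|p'] /andP[/eqP[pp] pos]]]; apply: reach_next.
suff <- : p' = p by [].
exact: port_single o1 pp.
Qed.

(** The nodes that have a common ancestor with output [j] are closed under
    adjacency: going back along an edge [e] into [x] from a node whose ancestor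
    reached [x] by another edge, [x] has several inputs and [collector] applies.
    By connectedness every input is among them, and an input is its own only
    ancestor. *)
Lemma nobad_path_mx_gt0 i : 0 < path_mx G j i.
Proof.
(* nodes with a common ancestor with output [j] *)
pose W (x : node) := [exists y, connect (@adj m n G) y x && reach y].
have edge_adj (e : edge) : adj (src e : node) (tgt e).
  by apply/existsP; exists e; rewrite !eqxx.
have Wcl : closed (link (@src m n G) (@tgt m n G) setT) W.
  apply: link_closed => e _; apply/existsP/existsP => [] [y /andP[yx ry]].
    exists y; rewrite ry andbT; exact: connect_trans yx (connect1 (edge_adj e)).
  have Wsrc : reach (tgt e) -> exists y, connect (@adj m n G) y (src e) && reach y.
    by rewrite reach_tgt => /reach_src re; exists (src e); rewrite connect0.
  case/connectP: yx => s; case: (lastP s) => [|s' z].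
    by move=> _ /= ye; apply: Wsrc; rewrite ye.
  rewrite rcons_path last_rcons => /andP[sP lz] ez; move: lz; rewrite -ez.
  case/existsP => e' /andP[/eqP se' /eqP te'].
  have ys : connect (@adj m n G) y (src e') by apply/connectP; exists s'.
  have [->|ne] := eqVneq e e'; first by exists y; rewrite ry ys.
  apply: Wsrc.
  have yt : connect (@adj m n G) y (tgt e).
    by rewrite -te'; apply: connect_trans ys (connect1 (edge_adj _)).
  have wI := bij_inj (graph_wire G).
  move: te' yt; rewrite /tgt; case E: (wire e) => [o|q]; case E': (wire e') => [o'|q'] //.
    by case=> oo; case/eqP: ne; apply: wI; rewrite E E' oo.
  case=> qq yt; apply: collector yt ry; rewrite ltnNge; apply/negP => le1.
  case/eqP: ne; apply: wI; rewrite E E'; congr inr.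
  by apply/esym; apply: port_single qq.
have Wj : W (inr (inl j)) by apply/existsP; exists (inr (inl j)); rewrite connect0 /reach eqxx.
have : W (inr (inl j)) = W (inr (inr i)).
  exact: (closed_connect Wcl (connected_link connG _ _)).
rewrite Wj => /esym /existsP[y /andP[yi ry]].
have {yi} ry : reach (inr (inr i)).
  case/connectP: yi => s; case: (lastP s) => [|s' z]; first by move=> _ ->.
  rewrite rcons_path last_rcons => /andP[_ +] zi; rewrite -zi.
  by case/existsP => e /andP[_]; rewrite /tgt; case: (wire e).
case/orP: ry => [//|/existsP[[i'|//] /andP[/eqP[<-]]]].
exact.
Qed.

End NoBadEdge.

(** * Graphs assembled from corollas *)

Section LiftPorts.
Context (N : nat) (a : 'I_N.+1 -> nat) (v : 'I_N.+1).
Local Notation rest := (fun u => a (lift v u)).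

Definition port_lift (p : port rest) : port a :=
  Tagged (fun u => 'I_(a u)) (i := lift v (tag p)) (tagged p).
Definition port_top (j : 'I_(a v)) : port a := Tagged (fun u => 'I_(a u)) j.

Definition port_unlift (q : port a) : 'I_(a v) + port rest :=
  match unliftP v (tag q) with
  | UnliftSome u uE =>
      inr (Tagged (fun u => 'I_(rest u)) (i := u) (cast_ord (congr1 a uE) (tagged q)))
  | UnliftNone vE => inl (cast_ord (congr1 a vE) (tagged q))
  end.

Lemma port_top_inj : injective port_top.
Proof. by move=> j j' /eqP; rewrite eq_Tagged => /eqP. Qed.

Lemma port_lift_inj : injective port_lift.
Proof.
move=> p q pq; apply: port_eq.
  exact: lift_inj (congr1 (@tag _ _) pq).
exact: (congr1 (fun x : port a => nat_of_ord (tagged x)) pq).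
Qed.

Lemma port_lift_top p j : port_lift p <> port_top j.
Proof. by move=> /(congr1 (@tag _ _)) /= /esym /eqP; rewrite (negbTE (neq_lift _ _)). Qed.

Lemma port_unliftK :
  cancel port_unlift (fun s => match s with inl j => port_top j | inr p => port_lift p end).
Proof. by move=> q; rewrite /port_unlift; case: unliftP => [u uE|vE]; apply: port_eq. Qed.

Lemma port_unlift_top j : port_unlift (port_top j) = inl j.
Proof.
have := port_unliftK (port_top j); case: (port_unlift _) => [j' /port_top_inj->//|p].
by move/port_lift_top.
Qed.

Lemma port_unlift_lift p : port_unlift (port_lift p) = inr p.
Proof.
have := port_unliftK (port_lift p); case: (port_unlift _) => [j /esym/port_lift_top //|q].
by move/port_lift_inj->.
Qed.

Variant port_lift_spec : port a -> Prop :=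
| PortTop j : port_lift_spec (port_top j)
| PortLift p : port_lift_spec (port_lift p).

Lemma port_liftP q : port_lift_spec q.
Proof. by rewrite -(port_unliftK q); case: (port_unlift q); constructor. Qed.

End LiftPorts.

Lemma extend_inj a m (f : 'I_a -> 'I_m) : injective f ->
  exists k (s : 'I_(a + k) -> 'I_m),
    [/\ (a + k = m)%N, injective s & forall j, s (lshift k j) = f j].
Proof.
move=> fI; pose A := ~: [set f j | j in setT].
exists #|A|, (ord_case f (@enum_val _ (mem A))).
split; last by move=> j; rewrite ord_caseL.
  have := cardsC [set f j | j in setT].
  by rewrite card_ord card_imset // cardsT card_ord.
have no j c : f j <> @enum_val _ (mem A) c.
  by move=> fc; have := enum_valP c; rewrite -fc !inE imset_f.
move=> x y; case: (ord_sumP x) => u; case: (ord_sumP y) => w; rewrite !(ord_caseL, ord_caseR).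
- by move/fI->.
- by move/no.
- by move/esym/no.
- by move/enum_val_inj->.
Qed.

Section Cork.
Context (a b k : nat).

(** A corolla beside [k] vertexless edges, defined directly because for [k = 0]
    there is no identity to compose it with horizontally. *)
Definition corolla_wires_pregraph : pregraph (a + k) (b + k) :=
  @PreGraph (a + k) (b + k) 1 (fun=> a) (fun=> b)
    (fun e => match e with
              | inl i => ord_case (fun u => inr (Tagged (fun=> 'I_b) (i := ord0) u))
                                  (fun c => inl (rshift a c)) i
              | inr p => inl (lshift k (tagged p))
              end).

Hypotheses (a0 : (0 < a)%N) (b0 : (0 < b)%N) (ab : (2 < a + b)%N).

Definition corolla_wires_graph : graph (a + k) (b + k).
Proof.
apply: (@Graph _ _ corolla_wires_pregraph) => /=.
- by rewrite !addn_gt0 a0 b0.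
- by move=> v; rewrite a0 b0.
- pose back (t : 'I_(a + k) + port (fun _ : 'I_1 => b)) :
      'I_(b + k) + port (fun _ : 'I_1 => a) :=
    match t with
    | inl o => ord_case (fun u => inr (Tagged (fun=> 'I_a) (i := ord0) u))
                        (fun c => inl (rshift b c)) o
    | inr p => inl (lshift k (tagged p))
    end.
  exists back => -[i|[v j]] /=; rewrite ?ord_caseL ?(ord1 v) //.
    by case: (ord_sumP i) => u; rewrite !(ord_caseL, ord_caseR) //= ord_caseR.
  by case: (ord_sumP i) => u; rewrite !(ord_caseL, ord_caseR) //= ord_caseR.
- by apply/acyclicP; exists (fun=> 0%N).
Defined.

End Cork.

Section Built.
Context (k : fieldType) (E : bicollection k).
Local Notation dgraph := (dgraph E).

(** Stated on decorated graphs rather than on elements of the free PROP, so that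
    graph invariants can be computed along the induction. *)
Inductive built : forall m n, dgraph m n -> Prop :=
| built_unit : built (unit_dgraph E)
| built_corolla m n d hm hn hmn (e : E m n d) : built (corolla_dgraph hm hn hmn e)
| built_relabel m n s t (D : dgraph m n) : built D -> built (relabel_dgraph s t D)
| built_hcomp m1 n1 m2 n2 (D1 : dgraph m1 n1) (D2 : dgraph m2 n2) :
    built D1 -> built D2 -> built (hcomp_dgraph D1 D2)
| built_vcomp m n l (D1 : dgraph m n) (D2 : dgraph n l) :
    built D1 -> built D2 -> built (vcomp_dgraph D1 D2)
| built_iso m n (D D' : dgraph m n) f r l :
    dgraph_iso (D := D) (D' := D') f r l -> built D -> built D'.

Lemma built_fun m n (D D' : dgraph m n) (f : 'I_(nvert D) -> 'I_(nvert D'))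
    (po : port (outs D) -> port (outs D')) (pi : port (ins D) -> port (ins D')) :
  bijective f ->
  (forall v, star v = star (f v)) ->
  (forall p, port_corr f (fun=> id) p (po p)) ->
  (forall p, port_corr f (fun=> id) p (pi p)) ->
  (forall x, wire D' (port_map po x) = port_map pi (wire D x)) ->
  built D -> built D'.
Proof.
move=> fB fS poP piP wf; apply: (@built_iso _ _ _ _ f (fun=> id) (fun=> id)); split=> //.
  by move=> v; rewrite -fS; apply: relabeled_id.
have tm x : corr f (fun=> id) x (port_map pi x).
  by case: x => [i|q] //=; apply: piP.
case=> [i|p] [i'|p'] //=.
  by move=> <-; rewrite (wf (inl i)); apply: tm.
move=> [tp vp]; have [tq vq] := poP p.
have -> : p' = po p by apply: port_eq; rewrite ?tp ?vp ?tq ?vq.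
by rewrite (wf (inr p)); apply: tm.
Qed.

Definition no_port (T : Type) (a : 'I_0 -> nat) (p : port a) : T :=
  match notF (ltn_ord (tag p)) with end.

Lemma built_id n : built (id_dgraph E n).
Proof.
elim: n => [|n IHn].
  apply: (@built_fun _ _ (unit_dgraph E) (id_dgraph E 0) (fun v : 'I_0 => v : 'I_0)
      (@no_port (port _) _) (@no_port (port _) _));
    try (by exists id); try (by case=> -[]); try by case.
  exact: built_unit.
pose D := hcomp_dgraph (unit_dgraph E) (id_dgraph E n).
pose po (p : port (outs D)) : port (outs (id_dgraph E n.+1)) := @no_port _ (outs D) p.
pose pi (p : port (ins D)) : port (ins (id_dgraph E n.+1)) := @no_port _ (ins D) p.
apply: (@built_fun _ _ D (id_dgraph E n.+1) (fun v : 'I_0 => v : 'I_0) po pi);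
  try (by exists id); try (by case=> -[]); try (by case).
  by case=> [i|[[]//]] /=; case: (@ord_sumP 1 n.+1 i) => j; rewrite ?ord_caseL ?ord_caseR.
exact: built_hcomp built_unit IHn.
Qed.

Lemma built_novert m n (D : dgraph m n) : nvert D = 0%N -> built D.
Proof.
case: D => -[[N o i w] /= h1 h2 h3 h4] d e /= N0; move: N0 o i w h2 h3 h4 d e => -> {N}.
move=> o i w h2 h3 h4 d e.
pose sg (x : 'I_n) : 'I_m := match w (inl x) with inl y => y | inr p => no_port _ p end.
have wE x : w (inl x) = inl (sg x) by rewrite /sg; case: (w _) => // -[[]].
have sI : injective sg.
  by move=> x y xy; have := wE x; rewrite xy -wE => /(bij_inj h3)[].
have mn : n = m.
  have := bij_eq_card h3.
  by rewrite !card_sum !card_ord !card_port !big_ord0 !addn0.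
move: mn h1 w h3 h4 sg wE sI => <- {m} h1 w h3 h4 sg wE sI.
case: n h1 w h3 h4 sg wE sI => [//|n] h1 w h3 h4 sg wE sI.
pose D' := relabel_dgraph (perm sI)^-1%g 1%g (id_dgraph E n).
set D := (X in built X).
pose po (p : port (outs D')) : port (outs D) := @no_port _ (outs D') p.
pose pi (p : port (ins D')) : port (ins D) := @no_port _ (ins D') p.
apply: (@built_fun _ _ D' D (fun v : 'I_0 => v : 'I_0) po pi);
  try (by exists id); try (by case=> -[]); try (by case).
  by case=> [x|[[]//]] /=; rewrite wE invgK invg1 perm1 permE.
by apply: built_relabel; apply: built_id.
Qed.

Lemma Corolla_cast m n m' n' d (em : m = m') (en : n = n') (e : E m n d) :
  Corolla (ecast x (E x n' d) em (ecast x (E m x d) en e)) = Corolla e.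
Proof. by case: _ / em; case: _ / en. Qed.

Lemma built_corolla_wires a b c a0 b0 ab d (e : E a b d) :
  built (@DGraph k E _ _ (@corolla_wires_graph a b c a0 b0 ab) (fun=> d) (fun=> e)).
Proof.
(* for [c = 0] a corolla, up to casts along [addn0] *)
case: c => [|c].
  have a0' : (0 < a + 0)%N by rewrite addn0.
  have b0' : (0 < b + 0)%N by rewrite addn0.
  have ab' : (2 < a + 0 + (b + 0))%N by rewrite !addn0.
  pose e' := ecast x (E x (b + 0) d) (esym (addn0 a)) (ecast x (E a x d) (esym (addn0 b)) e).
  pose cp x (p : port (fun _ : 'I_1 => (x + 0)%N)) : port (fun _ : 'I_1 => x) :=
    Tagged (fun=> 'I_x) (i := tag p) (cast_ord (addn0 x) (tagged p)).
  set D := (X in built X); pose D' := corolla_dgraph a0' b0' ab' e'.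
  pose po (p : port (outs D')) : port (outs D) := @cp a p.
  pose pi (p : port (ins D')) : port (ins D) := @cp b p.
  apply: (@built_fun _ _ D' D (fun v : 'I_1 => v : 'I_1) po pi) => //.
  - by exists id.
  - by move=> v; apply: Corolla_cast.
  - case=> [i|p] /=.
      case: (ord_sumP i) => u; last by case: u.
      by rewrite ord_caseL; congr inr; apply: port_eq.
    by congr inl; apply: val_inj.
  exact: built_corolla.
set D := (X in built X).
pose D' := hcomp_dgraph (corolla_dgraph a0 b0 ab e) (id_dgraph E c).
pose f : 'I_(1 + 0) -> 'I_1 :=
  ord_case id (fun u : 'I_0 => match notF (ltn_ord u) with end).
pose cp x (p : port (ord_case (fun _ : 'I_1 => x) (fun _ : 'I_0 => 0%N))) :
    port (fun _ : 'I_1 => x) :=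
  match port_split p with inl p => p | inr p => no_port _ p end.
have cpL x p : cp x (portl p) = p by rewrite /cp port_splitL.
have cpP x p : port_corr f (fun=> id) p (cp x p).
  by case: (port_sumP p) => {}p; [rewrite cpL; split=> //=; rewrite /f ord_caseL | case: p => -[]].
pose po (p : port (outs D')) : port (outs D) := @cp a p.
pose pi (p : port (ins D')) : port (ins D) := @cp b p.
apply: (@built_fun _ _ D' D f po pi) => //.
- exists (@lshift 1 0) => v; last by rewrite /f ord_caseL.
  by case: (ord_sumP v) => [u|[]//]; rewrite /f ord_caseL.
- move=> v; rewrite -[LHS]/(Corolla (dec_case _ _ v)).
  by case: (ord_sumP v) => [u|[]//]; rewrite dec_caseL.
- exact: cpP.
- exact: cpP.
- case=> [i|p] /=.
    by case: (ord_sumP i) => u; rewrite !(ord_caseL, ord_caseR) //= /pi cpL.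
  by case: (port_sumP p) => {}p; [rewrite /po cpL port_splitL | case: p => -[]].
by apply: built_hcomp; [apply: built_corolla | apply: built_id].
Qed.

End Built.

Section Peel.
Context (N n k : nat) (o i : 'I_N.+1 -> nat) (v : 'I_N.+1) (s : 'S_(o v + k)).
Context (w : 'I_n + port o -> 'I_(o v + k) + port i).
Context (w' : 'I_(o v + k) + port i -> 'I_n + port o).
Hypotheses (wK : cancel w w') (Kw : cancel w' w).
Hypotheses (n0 : (0 < n)%N) (i0 : (0 < i v)%N).
Hypothesis top : forall j : 'I_(o v), w (inr (port_top j)) = inl (s (lshift k j)).

Local Notation orest := (fun u => o (lift v u)).
Local Notation irest := (fun u => i (lift v u)).

(** Ends of edges once the top vertex [v] is removed: its inputs become the first
    [i v] output legs, followed by the [k] legs that [v] does not feed. The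
    remaining case is never met: it concerns legs fed by [v], and is filled with
    an arbitrary leg. *)
Definition peel_tgt (t : 'I_(o v + k) + port i) : 'I_(i v + k) + port irest :=
  match t with
  | inl x => match split (s^-1%g x) with
             | inr c => inl (rshift (i v) c)
             | inl _ => inl (lshift k (Ordinal i0))
             end
  | inr q => match port_unlift v q with
             | inl u => inl (lshift k u)
             | inr q' => inr q'
             end
  end.

Definition unpeel_tgt (y : 'I_(i v + k) + port irest) : 'I_(o v + k) + port i :=
  match y with
  | inl c => ord_case (fun u => inr (port_top u)) (fun c => inl (s (rshift (o v) c))) c
  | inr q => inr (port_lift q)
  end.

Definition unpeel_src (x : 'I_n + port orest) : 'I_n + port o :=
  port_map (@port_lift _ o v) x.

Definition peel_src (z : 'I_n + port o) : 'I_n + port orest :=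
  match z with
  | inl x => inl x
  | inr p => match port_unlift v p with
             | inr p' => inr p'
             | inl _ => inl (Ordinal n0)
             end
  end.

Lemma unpeel_tgtK : cancel unpeel_tgt peel_tgt.
Proof.
case=> [c|q] /=; last by rewrite port_unlift_lift.
case: (ord_sumP c) => u; rewrite !(ord_caseL, ord_caseR) /=.
  by rewrite port_unlift_top.
by rewrite permK (unsplitK (inr u)).
Qed.

Lemma peel_tgtK t : (forall j, t <> inl (s (lshift k j))) -> unpeel_tgt (peel_tgt t) = t.
Proof.
case: t => [x|q] no /=.
  have := splitK (s^-1%g x); case: (split _) => [j|c] /= E.
    by case: (no j); rewrite E permKV.
  by rewrite ord_caseR E permKV.
case: (port_liftP v q) => u; rewrite ?port_unlift_top ?port_unlift_lift //=.
by rewrite ord_caseL.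
Qed.

Lemma unpeel_srcK : cancel unpeel_src peel_src.
Proof. by case=> [x|p] //=; rewrite port_unlift_lift. Qed.

Lemma peel_srcK z : (forall j, z <> inr (port_top (v := v) j)) -> unpeel_src (peel_src z) = z.
Proof.
case: z => [x|q] //= no; move: no.
case: (port_liftP v q) => u; rewrite ?port_unlift_top ?port_unlift_lift //=.
by move=> /(_ u).
Qed.

Definition peel_wire (x : 'I_n + port orest) : 'I_(i v + k) + port irest :=
  peel_tgt (w (unpeel_src x)).

Lemma peel_wireK x : unpeel_tgt (peel_wire x) = w (unpeel_src x).
Proof.
apply: peel_tgtK => j; rewrite -top => /(can_inj wK).
by case: x => [x|p] H; [discriminate H | apply: (port_lift_top (inr_inj H))].
Qed.

Lemma peel_wire_bij : bijective peel_wire.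
Proof.
exists (fun y => peel_src (w' (unpeel_tgt y))) => [x|y].
  by rewrite peel_wireK wK unpeel_srcK.
rewrite /peel_wire peel_srcK ?Kw ?unpeel_tgtK // => j.
move/(congr1 w); rewrite Kw top; case: y => [c|q] //=.
case: (ord_sumP c) => u; rewrite ?ord_caseL ?ord_caseR // => -[] /perm_inj /eqP.
by rewrite eq_rlshift.
Qed.

Definition peel_pregraph : pregraph (i v + k) n :=
  @PreGraph _ _ N orest irest peel_wire.

Lemma peel_acyclic : acyclic (PreGraph w) -> acyclic peel_pregraph.
Proof.
move=> /acyclicP[rk rkP]; apply/acyclicP; exists (fun u => rk (lift v u)) => p q pq.
apply: (rkP (port_lift p) (port_lift q)).
by have := peel_wireK (inr p); rewrite [peel_wire _]pq /= => ->.
Qed.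

Hypothesis val3 : forall u, [&& 0 < o u, 0 < i u & 2 < o u + i u]%N.
Hypothesis acyc : acyclic (PreGraph w).

Definition peel_graph : graph (i v + k) n.
Proof.
apply: (@Graph _ _ peel_pregraph).
- by rewrite addn_gt0 i0.
- by move=> u; apply: val3.
- exact: peel_wire_bij.
- exact: peel_acyclic.
Defined.

Context (F : fieldType) (E : bicollection F).
Context (d : 'I_N.+1 -> nat) (e : forall u, E (o u) (i u) (d u)).

Definition peel_dgraph : dgraph E (i v + k) n :=
  @DGraph F E _ _ peel_graph (fun u => d (lift v u)) (fun u => e (lift v u)).

(** The graph is the corolla of [v] beside [k] edges, on top of the graph without
    [v], up to the permutation [s] that gathers the legs fed by [v]. *)
Lemma built_peel h1 h2 h3 h4 : built peel_dgraph ->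
  built (@DGraph F E _ _ (@Graph _ _ (PreGraph w) h1 h2 h3 h4) d e).
Proof.
move=> bP; have /and3P[o0 i0' oi] := val3 v.
pose C := @DGraph F E _ _ (@corolla_wires_graph (o v) (i v) k o0 i0' oi) (fun=> d v) (fun=> e v).
pose D' := relabel_dgraph s^-1%g 1%g (vcomp_dgraph C peel_dgraph).
set D := (X in built X).
pose f : 'I_(1 + N) -> 'I_N.+1 := ord_case (fun=> v) (lift v).
pose pmap (a : 'I_N.+1 -> nat)
    (p : port (ord_case (fun _ : 'I_1 => a v) (fun u => a (lift v u)))) : port a :=
  match port_split p with
  | inl q => port_top (a := a) (v := v) (tagged q)
  | inr q => port_lift q
  end.
have pmapL a q : pmap a (portl q) = port_top (a := a) (v := v) (tagged q).
  by rewrite /pmap port_splitL.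
have pmapR a q : pmap a (portr q) = port_lift q by rewrite /pmap port_splitR.
have pmapP a p : port_corr f (fun=> id) p (pmap a p).
  case: (port_sumP p) => {}p; rewrite ?pmapL ?pmapR; split=> //=.
    by rewrite /f ord_caseL.
  by rewrite /f ord_caseR.
pose po (p : port (outs D')) : port (outs D) := pmap o p.
pose pi (p : port (ins D')) : port (ins D) := pmap i p.
apply: (@built_fun _ _ _ _ D' D f po pi).
- apply: inj_card_bij; last by rewrite !card_ord.
  move=> x y; case: (ord_sumP x) => a; case: (ord_sumP y) => b;
    rewrite /f !(ord_caseL, ord_caseR).
  + by rewrite (ord1 a) (ord1 b).
  + by move/eqP; rewrite (negbTE (neq_lift _ _)).
  + by move/esym/eqP; rewrite (negbTE (neq_lift _ _)).
  + by move/lift_inj->.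
- move=> u; rewrite -[LHS]/(Corolla (dec_case (@dec _ _ _ _ C) (@dec _ _ _ _ peel_dgraph) u)).
  rewrite -[RHS]/(Corolla (e (f u))) /f.
  by case: (ord_sumP u) => a; rewrite ?dec_caseL ?dec_caseR ?ord_caseL ?ord_caseR.
- exact: pmapP.
- exact: pmapP.
- pose rel (t : 'I_(o v + k) + port (ord_case (fun _ : 'I_1 => i v) irest)) :=
    match t with inl x => inl (s x) | inr p => inr p end.
  have relE y : port_map (pmap i) (rel (vcomp_tgtr (H := peel_graph) C y)) = unpeel_tgt y.
    case: y => [c|q] /=; last by rewrite pmapR.
    case: (ord_sumP c) => u; rewrite !(ord_caseL, ord_caseR) //=.
    by rewrite pmapL.
  have rlE t : match t with inl x => inl ((s^-1)^-1%g x) | inr p => inr p end = rel t.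
    by case: t => //= x; rewrite invgK.
  case=> [x|p].
    rewrite [wire D' _]/= invg1 perm1 rlE [RHS]relE peel_wireK //.
  rewrite [wire D' _]/=; case: (port_sumP p) => {}p.
    by rewrite port_splitL invgK /po /= pmapL top.
  rewrite port_splitR rlE [RHS]relE /po [port_map _ (inr _)]/= pmapR.
  by rewrite peel_wireK.
apply: built_relabel; apply: built_vcomp => //; exact: built_corolla_wires.
Qed.

End Peel.

(** A vertex of maximal rank feeds only legs, and can be peeled off. *)
Theorem all_built (F : fieldType) (E : bicollection F) m n (D : dgraph E m n) : built D.
Proof.
move NE: (nvert D) => N; elim: N m n D NE => [|N IHN] m n D DN.
  exact: built_novert.
case: D DN => -[[N' o i w] h1 h2 h3 h4] d e /= N'E.
move: N'E o i w h2 h3 h4 d e => -> {N'} o i w h2 h3 h4 d e.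
move: h2 h3 h4 d e => /= h2 h3 h4 d e; have /acyclicP[rk rkP] := h4.
pose v : 'I_N.+1 := [arg max_(v > ord0) rk v].
have vmax u : (rk u <= rk v)%N by rewrite /v; case: arg_maxnP => // x _; apply.
have top j : exists x, w (inr (port_top (v := v) j)) = inl x.
  case W: (w _) => [x|q]; first by exists x.
  by have := rkP _ _ W; rewrite ltnNge vmax.
pose t j := match w (inr (port_top (v := v) j)) with
            | inl x => x
            | inr _ => Ordinal (proj1 (andP h1))
            end.
have tE j : w (inr (port_top j)) = inl (t j) by rewrite /t; case: (top j) => x ->.
have tI : injective t.
  move=> j j' tt; have := tE j; rewrite tt -tE => /(bij_inj h3)[].
  exact: port_top_inj.
have [k [s [mE sI sE]]] := extend_inj tI.
(* what is left of [t] and [s] once [m] is identified with [o v + k] *)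
have sw j : w (inr (port_top j)) = inl (s (lshift k j)) by rewrite sE.
clear t tE tI sE top rkP vmax; clearbody v; clear rk.
case: _ / mE s sI w h1 h3 h4 sw => s sI w h1 h3 h4 sw.
have [w' wK Kw] := h3.
have /and3P[o0 i0 _] := h2 v; have /andP[_ n0] := h1.
apply: (@built_peel N n k o i v (perm sI) w w' wK Kw n0 i0 _ h2 h4).
  by move=> j; rewrite permE sw.
by move=> *; apply: IHN.
Qed.

(** * Spans of monomials and derivations *)

Section GraphSpan.
Local Open Scope ring_scope.
Context (k : fieldType) (E : bicollection k) (m n : nat).

(** Subspaces of the free PROP cut out by a property of graphs. The projections
    [gproj] below split the free PROP into such a subspace and that of the
    negated property, when the property is invariant under isomorphism. *)
Definition gspan (Q : graph m n -> Prop) : freemod E m n -> Prop :=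
  lspan (fun x : freemod E m n => exists2 D : dgraph E m n, Q D & x = mono D).

Lemma gspan_mono (Q : graph m n -> Prop) (D : dgraph E m n) : Q D -> gspan Q (mono D).
Proof. by move=> QD; apply: lspan_gen; exists D. Qed.

Lemma gspan0 Q : gspan Q 0. Proof. exact: lspan0. Qed.

Lemma gspanD Q x y : gspan Q x -> gspan Q y -> gspan Q (x + y).
Proof. by move=> hx hy; rewrite -[x]scale1r; apply: lspan_lin. Qed.

Lemma gspanZ Q a x : gspan Q x -> gspan Q (a *: x).
Proof. by move=> hx; rewrite -[_ *: _]addr0; apply: lspan_lin; last exact: lspan0. Qed.

Lemma gspanB Q x y : gspan Q x -> gspan Q y -> gspan Q (x - y).
Proof. by move=> hx hy; rewrite -scaleN1r; apply/gspanD/gspanZ. Qed.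

End GraphSpan.

Lemma gspan_map k (E : bicollection k) m n m' n' (Q : graph m n -> Prop)
    (Q' : graph m' n' -> Prop) (f : freemod E m n -> freemod E m' n') :
  linear f -> (forall D : dgraph E m n, Q D -> gspan Q' (f (mono D))) ->
  forall x, gspan Q x -> gspan Q' (f x).
Proof. by move=> lf H; apply: lspan_map => // _ [D QD ->]; apply: H. Qed.

Section GraphProj.
Local Open Scope ring_scope.
Context (k : fieldType) (E : bicollection k) (m n : nat).
Local Notation freemod := (freemod E m n).
Local Notation gspan := (@gspan k E m n).

Lemma gspan_sub (Q Q' : graph m n -> Prop) x :
  (forall G, Q G -> Q' G) -> gspan Q x -> gspan Q' x.
Proof.
move=> QQ'; apply: (gspan_map (f := id)) => // D /QQ'; exact: gspan_mono.
Qed.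

Lemma gspan_ext (Q : graph m n -> Prop) (V : lmodType k) (f g : freemod -> V) :
  linear f -> linear g -> (forall D : dgraph E m n, Q D -> f (mono D) = g (mono D)) ->
  forall x, gspan Q x -> f x = g x.
Proof.
move=> lf lg fg x [r [c [y [yP ->]]]]; rewrite !lin_sum //.
by apply: eq_bigr => i _; have [D QD ->] := yP i; rewrite fg.
Qed.

Lemma gspan_false (Q : graph m n -> Prop) x : (forall G, ~ Q G) -> gspan Q x -> x = 0.
Proof.
move=> nQ; apply: (@gspan_ext Q _ id (fun=> 0)) => // [a ? ?|D /nQ//].
by rewrite scaler0 addr0.
Qed.

Lemma gspan_bound (phi : graph m n -> nat) x : exists p, gspan (fun G => phi G < p)%N x.
Proof.
elim/freemod_ind: x => [|D|x y [p hp] [q hq]|a x [p hp]].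
- by exists 0%N; apply: gspan0.
- by exists (phi D).+1; apply: gspan_mono.
- exists (maxn p q); apply: gspanD; [apply: gspan_sub hp|apply: gspan_sub hq] => G lt.
    exact: leq_trans lt (leq_maxl _ _).
  exact: leq_trans lt (leq_maxr _ _).
- by exists p; apply: gspanZ.
Qed.

Definition graph_invariant (T : Type) (Q : graph m n -> T) : Prop :=
  forall G G', isomorphic G G' -> Q G' = Q G.

Definition gproj (Q : graph m n -> bool) : freemod -> freemod :=
  plift (fun D : dgraph E m n => if Q D then mono D else 0).

Section Proj.
Context (Q : graph m n -> bool) (Qinv : graph_invariant Q).

Lemma gproj_respects : respects (@Defs.grel k E m n)
  (fun D : dgraph E m n => if Q D then mono D : freemod else 0).
Proof.
apply: respectsP => [G d v a e e1 e2 eu ev|D D' f r l i] /=.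
  by case: ifP => _; rewrite ?scaler0 ?addr0 //; apply: mono_lin eu ev.
rewrite (Qinv (dgraph_iso_isomorphic i)); case: ifP => _; rewrite ?scaler0 //.
exact: mono_iso i.
Qed.

Lemma gproj_linear : linear (gproj Q).
Proof. exact: (plift_linear gproj_respects). Qed.

Lemma gproj_mono (D : dgraph E m n) : gproj Q (mono D) = if Q D then mono D else 0.
Proof. exact: (plift_gen gproj_respects). Qed.

Lemma gproj_id (A : graph m n -> Prop) x : (forall G, A G -> Q G) -> gspan A x -> gproj Q x = x.
Proof.
move=> AQ; apply: (@gspan_ext A _ _ id) => // [|D /AQ QD]; first exact: gproj_linear.
by rewrite gproj_mono QD.
Qed.

Lemma gproj0 (A : graph m n -> Prop) x :
  (forall G, A G -> ~~ Q G) -> gspan A x -> gproj Q x = 0.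
Proof.
move=> AQ; apply: (@gspan_ext A _ _ (fun=> 0)) => [||D /AQ QD].
- exact: gproj_linear.
- by move=> a ? ?; rewrite scaler0 addr0.
by rewrite gproj_mono (negbTE QD).
Qed.

Lemma gproj_gspan A x : gspan A x -> gspan (fun G => A G /\ Q G) (gproj Q x).
Proof.
apply: (@lspan_map _ _ _ (gproj Q)) => [|_ [D AD ->]]; first exact: gproj_linear.
rewrite gproj_mono; case: ifP => QD; last exact: lspan0.
by apply: lspan_gen; exists D.
Qed.

Lemma gspan_and A x : gspan A x -> gspan Q x -> gspan (fun G => A G /\ Q G) x.
Proof. by move=> /gproj_gspan + /(gproj_id (fun _ q => q)) xE; rewrite xE. Qed.

Lemma gproj_deg d x : free_deg d x -> free_deg d (gproj Q x).
Proof.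
apply: lspan_map => [|_ [D Dd ->]]; first exact: gproj_linear.
by rewrite gproj_mono; case: ifP => _; [apply: lspan_gen; exists D | apply: lspan0].
Qed.

End Proj.
End GraphProj.

Section Derivations.
Local Open Scope ring_scope.
Context (k : fieldType) (E : bicollection k).
Local Notation F := (free_prop E).

(** Closure conditions under which a relation between a graph and the results of
    substituting at one of its vertices need only be checked on corollas. *)
Record local_relation (R : forall m n, graph m n -> graph m n -> Prop) : Prop :=
    LocalRelation {
  loc_iso : forall m n (H G G' : graph m n), isomorphic G G' -> R _ _ H G -> R _ _ H G';
  loc_relabel : forall m n s t (H G : graph m n),
    R _ _ H G -> R _ _ (relabel_graph s t H) (relabel_graph s t G);
  loc_vl : forall m n l (H G : graph m n) (K : graph n l),
    R _ _ H G -> R _ _ (vcomp_graph H K) (vcomp_graph G K);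
  loc_vr : forall m n l (H G : graph n l) (K : graph m n),
    R _ _ H G -> R _ _ (vcomp_graph K H) (vcomp_graph K G);
  loc_hl : forall m1 n1 m2 n2 (H G : graph m1 n1) (K : graph m2 n2),
    R _ _ H G -> R _ _ (hcomp_graph H K) (hcomp_graph G K);
  loc_hr : forall m1 n1 m2 n2 (H G : graph m2 n2) (K : graph m1 n1),
    R _ _ H G -> R _ _ (hcomp_graph K H) (hcomp_graph K G)
}.

(** The Leibniz rules propagate the relation along the construction of the
    monomial from generators. *)
Lemma derivation_span (R : forall m n, graph m n -> graph m n -> Prop) (D : endo F) :
  local_relation R -> is_derivation D ->
  (forall m n d hm hn hmn (e : E m n d),
    gspan (fun H => R m n H (corolla_graph hm hn hmn)) (D m n (generator hm hn hmn e))) ->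
  forall m n (A : dgraph E m n), gspan (fun H => R m n H A) (D m n (mono A)).
Proof.
move=> loc der gen m n A.
elim: (all_built A) => {m n A}
  [|m n d hm hn hmn e|m n s t A _ IH|m1 n1 m2 n2 A B _ IHA _ IHB
  |m n l A B _ IHA _ IHB|m n A B f r l i _ IH].
- by rewrite (der_deg0 der); [apply: gspan0 | apply: free_deg_one].
- exact: gen.
- have -> : mono (relabel_dgraph s t A) = pr_l s (pr_r t (mono A : F m n)).
    by rewrite /= free_r_mono free_l_mono relabel_dgraphM mulg1 mulg1.
  rewrite (der_l der) (der_r der).
  apply: (gspan_map (f := fun x => free_l s (free_r t x)) _ _ IH) => [|H RH].
    exact: (lin_comp (f := @free_l k E m n s)
      (@free_l_linear _ _ _ _ _) (@free_r_linear _ _ _ _ _)).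
  rewrite /= free_r_mono free_l_mono relabel_dgraphM !mulg1.
  exact: (@gspan_mono _ _ _ _ _ (relabel_dgraph s t H) (loc_relabel loc s t RH)).
- have -> : mono (hcomp_dgraph A B) = hcomp (mono A : F m1 n1) (mono B : F m2 n2).
    by rewrite /= free_h_mono.
  rewrite (der_h der _ (free_deg_mono A)); apply: gspanD; last apply: gspanZ.
    apply: (gspan_map (f := fun x => free_h x (mono B)) _ _ IHA) => [|H RH].
      exact: free_h_linear_l.
    rewrite free_h_mono; exact: (@gspan_mono _ _ _ _ _ (hcomp_dgraph H B) (loc_hl loc B RH)).
  apply: (gspan_map (f := fun x => free_h (mono A) x) _ _ IHB) => [|H RH].
    exact: free_h_linear_r.
  rewrite free_h_mono; exact: (@gspan_mono _ _ _ _ _ (hcomp_dgraph A H) (loc_hr loc A RH)).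
- have -> : mono (vcomp_dgraph A B) = vcomp (mono A : F m n) (mono B : F n l).
    by rewrite /= free_v_mono.
  rewrite (der_v der _ (free_deg_mono A)); apply: gspanD; last apply: gspanZ.
    apply: (gspan_map (f := fun x => free_v x (mono B)) _ _ IHA) => [|H RH].
      exact: free_v_linear_l.
    rewrite free_v_mono; exact: (@gspan_mono _ _ _ _ _ (vcomp_dgraph H B) (loc_vl loc B RH)).
  apply: (gspan_map (f := fun x => free_v (mono A) x) _ _ IHB) => [|H RH].
    exact: free_v_linear_r.
  rewrite free_v_mono; exact: (@gspan_mono _ _ _ _ _ (vcomp_dgraph A H) (loc_vr loc A RH)).
- have -> : mono B = (-1) ^+ koszul (@ddeg _ _ _ _ A) f *: mono A.
    by rewrite (mono_iso i) scalerA -exprD addnn -signr_odd odd_double scale1r.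
  rewrite (linZ _ _ (der_linear der (m:=m) (n:=n))); apply: gspanZ.
  apply: gspan_sub IH => G; exact: (loc_iso loc (dgraph_iso_isomorphic i)).
Qed.

Lemma derivationB (D D' : endo F) :
  is_derivation D -> is_derivation D' ->
  is_derivation (fun m n x => D m n x - D' m n x : F m n).
Proof.
move=> d1 d2; split.
- move=> m n a x y; rewrite (der_linear d1) (der_linear d2).
  by rewrite scalerBr opprD addrACA.
- move=> m n d x hx; have h1 := der_deg d1 hx; have h2 := der_deg d2 hx.
  by rewrite addrC -scaleN1r; apply: lspan_lin.
- by move=> m n x hx; rewrite (der_deg0 d1) // (der_deg0 d2) // subr0.
- move=> m n s x; rewrite (der_l d1) (der_l d2) /=.
  by rewrite addrC -scaleN1r -(@free_l_linear _ _ _ _ s) scaleN1r addrC.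
- move=> m n s x; rewrite (der_r d1) (der_r d2) /=.
  by rewrite addrC -scaleN1r -(@free_r_linear _ _ _ _ s) scaleN1r addrC.
- move=> m1 n1 m2 n2 d x y hx; rewrite (der_h d1 _ hx) (der_h d2 _ hx) /=.
  rewrite opprD addrACA -scalerBr; congr (_ + _ *: _).
    rewrite addrC -scaleN1r -(@free_h_linear_l _ _ _ _ _ _ (y : freemod E m2 n2)).
    by rewrite scaleN1r addrC.
  rewrite addrC -scaleN1r -(@free_h_linear_r _ _ _ _ _ _ (x : freemod E m1 n1)).
  by rewrite scaleN1r addrC.
- move=> m n l d x y hx; rewrite (der_v d1 _ hx) (der_v d2 _ hx) /=.
  rewrite opprD addrACA -scalerBr; congr (_ + _ *: _).
    rewrite addrC -scaleN1r -(@free_v_linear_l _ _ _ _ _ (y : freemod E n l)).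
    by rewrite scaleN1r addrC.
  rewrite addrC -scaleN1r -(@free_v_linear_r _ _ _ _ _ (x : freemod E m n)).
  by rewrite scaleN1r addrC.
Qed.

(** Induction on a bound for the weights occurring in the cycle. *)
Lemma perturbation (phi : forall m n, graph m n -> nat) (d d0 : endo F) :
  (forall m n, graph_invariant (@phi m n)) ->
  is_differential d ->
  (forall m n, linear (d0 m n)) ->
  (forall m n (A : dgraph E m n), gspan (fun H => phi _ _ H = phi _ _ A) (d0 m n (mono A))) ->
  (forall m n (A : dgraph E m n),
    gspan (fun H => (phi _ _ H < phi _ _ A)%N) (d m n (mono A) - d0 m n (mono A))) ->
  forall i, homology_vanishes d0 i -> homology_vanishes d i.
Proof.
move=> phi_inv [der dd] d0_linear d0_phi d_phi i van m n x.
have [p xp] := gspan_bound (phi m n) x; elim: p x xp => [|p IHp] x xp [xi dx].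
  exists 0; first exact: lspan0.
  by rewrite (lin0 (der_linear der (m:=m) (n:=n))) subr0; apply: gspan_false xp.
have ld := der_linear der (m:=m) (n:=n); have ld0 := d0_linear m n.
pose pi := @gproj k E m n (fun G : graph m n => phi m n G == p).
have piinv : graph_invariant (fun G : graph m n => phi m n G == p).
  by move=> G G' iso; rewrite (phi_inv _ _ _ _ iso).
have lpi : linear pi := gproj_linear piinv.
pose th (y : F m n) : F m n := d m n y - d0 m n y.
have lth : linear th.
  by move=> a y z; rewrite /th ld ld0 scalerBr opprD addrACA.
have d_split y : d m n y = d0 m n y + th y by rewrite addrC subrK.
have th_lt q y :
    gspan (fun G : graph m n => phi m n G <= q)%N y ->
    gspan (fun G : graph m n => phi m n G < q)%N (th y).
  apply: (gspan_map lth) => A Aq; apply: (gspan_sub _ (d_phi m n A)) => G lt.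
  exact: leq_trans lt Aq.
have d0_lt y :
    gspan (fun G : graph m n => phi m n G < p)%N y ->
    gspan (fun G : graph m n => phi m n G < p)%N (d0 m n y).
  by apply: (gspan_map ld0) => A Aq; apply: (gspan_sub _ (d0_phi m n A)) => G ->.
have d_lt y :
    gspan (fun G : graph m n => phi m n G < p)%N y ->
    gspan (fun G : graph m n => phi m n G < p)%N (d m n y).
  move=> yp; rewrite d_split; apply: gspanD; first exact: d0_lt.
  apply: (@gspan_sub _ _ _ _ (fun G : graph m n => phi m n G < p)%N) => //.
  by apply: th_lt; apply: gspan_sub yp => G /ltnW.
have pi_lt y : gspan (fun G : graph m n => phi m n G < p)%N y -> pi y = 0.
  by apply: gproj0 => // G lt; rewrite ltn_eqF.
have xr_lt : gspan (fun G : graph m n => phi m n G < p)%N (x - pi x).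
  apply: (gspan_map (f := fun y => y - pi y) _ _ xp) => [a y z|A Ap].
    by rewrite lpi scalerBr opprD addrACA.
  rewrite /pi gproj_mono //; case: eqVneq => [_|ne]; rewrite ?subrr ?subr0; first exact: gspan0.
  by apply: gspan_mono; rewrite ltn_neqAle ne -ltnS.
have xp_eq : gspan (fun G : graph m n => phi m n G = p) (pi x).
  by apply: gspan_sub (gproj_gspan piinv xp) => G [_ /eqP].
have pi_d0 y : pi (d0 m n y) = d0 m n (pi y).
  move: y; apply: lin_ext => [||A].
  - exact: lin_comp lpi ld0.
  - exact: lin_comp ld0 lpi.
  rewrite /pi gproj_mono //; case: eqVneq => Ap.
    by apply: (gproj_id piinv _ (d0_phi m n A)) => G ->; apply/eqP.
  by rewrite (lin0 ld0); apply: (gproj0 piinv _ (d0_phi m n A)) => G ->.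
have th_eq y :
    gspan (fun G : graph m n => phi m n G = p) y ->
    gspan (fun G : graph m n => phi m n G < p)%N (th y).
  by move=> yp; apply: th_lt; apply: gspan_sub yp => G ->.
have pi_id : pi (pi x) = pi x by apply: (gproj_id piinv _ xp_eq) => G ->; apply/eqP.
have d0x : d0 m n (pi x) = 0.
  have : pi (d m n x) = 0 by rewrite dx (lin0 lpi).
  rewrite -[in d m n x](subrK (pi x) x) (linD _ _ ld) (linD _ _ lpi).
  rewrite (pi_lt _ (d_lt _ xr_lt)) add0r d_split (linD _ _ lpi).
  rewrite (pi_lt _ (th_eq _ xp_eq)) addr0 pi_d0.
  by rewrite pi_id.
have [z zi] := van m n (pi x) (conj (gproj_deg piinv xi) d0x); rewrite subr0 => xz.
have zp_eq : gspan (fun G : graph m n => phi m n G = p) (pi z).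
  have [q zq] := gspan_bound (phi m n) z.
  by apply: gspan_sub (gproj_gspan piinv zq) => G [_ /eqP].
have d0z : d0 m n (pi z) = pi x.
  by rewrite -pi_d0 -xz pi_id.
have zi' : free_deg i.+1 (pi z) := gproj_deg piinv zi.
have [||z' z'i] := IHp (x - d m n (pi z)).
- rewrite d_split d0z opprD addrA; apply: gspanB => //.
  exact: th_eq.
- split; last by rewrite addrC -scaleN1r ld dd dx scaler0 addr0.
  by rewrite addrC -scaleN1r; apply: lspan_lin => //; apply: (der_deg der zi').
rewrite subr0 => xE; (* the coefficient only gives the sum the shape of the linearity lemmas *)
exists (1 *: z' + pi z); first exact: lspan_lin.
by rewrite subr0 ld scale1r -xE subrK.
Qed.

End Derivations.

(** * Effect of substitution on paths and branching *)

Section LocalRelations.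

Lemma sum_lt (I : finType) (F G : I -> nat) i0 :
  (forall i, F i <= G i) -> F i0 < G i0 -> \sum_i F i < \sum_i G i.
Proof.
move=> le lt; rewrite (bigD1 i0) //= [ltnRHS](bigD1 i0) //= -addSn.
by apply: leq_add => //; apply: leq_sum.
Qed.

(** What [d0] preserves: it replaces a vertex by trees without bad edges. *)
Definition same_profile m n (H G : graph m n) : Prop :=
  path_mx H =2 path_mx G /\ branching H = branching G.

(** Entrywise comparison, since a strict inequality between sums of entries would
    not survive matrix products. *)
Definition fewer_paths m n (H G : graph m n) : Prop :=
  (forall j i, path_mx H j i <= path_mx G j i) /\
  exists j i, path_mx H j i < path_mx G j i.

Definition more_branching m n (H G : graph m n) : Prop := branching G < branching H.

Lemma same_profile_local : local_relation same_profile.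
Proof.
split.
- move=> m n H G G' iso [pE gE]; split; last by rewrite (branching_iso iso).
  by move=> j i; rewrite (path_mx_iso iso).
- move=> m n s t H G [pE gE]; split=> // j i; by rewrite !path_mx_relabel.
- move=> m n l H G K [pE gE]; split; last by rewrite !branching_vcomp gE.
  by move=> j i; rewrite !path_mx_vcomp; apply: eq_bigr => u _; rewrite pE.
- move=> m n l H G K [pE gE]; split; last by rewrite !branching_vcomp gE.
  by move=> j i; rewrite !path_mx_vcomp; apply: eq_bigr => u _; rewrite pE.
- move=> m1 n1 m2 n2 H G K [pE gE]; split; last by rewrite !branching_hcomp gE.
  move=> j i; rewrite !path_mx_hcomp.
  by case: (ord_sumP i) => u; case: (ord_sumP j) => x; rewrite !(ord_caseL, ord_caseR).
- move=> m1 n1 m2 n2 H G K [pE gE]; split; last by rewrite !branching_hcomp gE.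
  move=> j i; rewrite !path_mx_hcomp.
  by case: (ord_sumP i) => u; case: (ord_sumP j) => x; rewrite !(ord_caseL, ord_caseR).
Qed.

(** Strictness survives composition because every row and every column of a path
    matrix has a positive entry. *)
Lemma fewer_paths_local : local_relation fewer_paths.
Proof.
split.
- move=> m n H G G' iso [le [j [i lt]]]; split=> [j' i'|].
    by rewrite (path_mx_iso iso).
  by exists j, i; rewrite (path_mx_iso iso).
- move=> m n s t H G [le [j [i lt]]]; split=> [j' i'|].
    by rewrite !path_mx_relabel.
  by exists (s^-1%g j), (t i); rewrite !path_mx_relabel permKV permK.
- move=> m n l H G K [le [j [u lt]]]; split=> [j' i'|].
    by rewrite !path_mx_vcomp; apply: leq_sum => x _; rewrite leq_mul2r le orbT.
  have [i ui] := path_mx_row K u; exists j, i; rewrite !path_mx_vcomp.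
  apply: (@sum_lt _ _ _ u) => [x|]; first by rewrite leq_mul2r le orbT.
  by rewrite ltn_mul2r ui.
- move=> m n l H G K [le [u [i lt]]]; split=> [j' i'|].
    by rewrite !path_mx_vcomp; apply: leq_sum => x _; rewrite leq_mul2l le orbT.
  have [j ju] := path_mx_col K u; exists j, i; rewrite !path_mx_vcomp.
  apply: (@sum_lt _ _ _ u) => [x|]; first by rewrite leq_mul2l le orbT.
  by rewrite ltn_mul2l ju.
- move=> m1 n1 m2 n2 H G K [le [j [i lt]]]; split=> [j' i'|].
    rewrite !path_mx_hcomp.
    by case: (ord_sumP i') => u; case: (ord_sumP j') => x; rewrite !(ord_caseL, ord_caseR).
  by exists (lshift _ j), (lshift _ i); rewrite !path_mx_hcomp !ord_caseL.
- move=> m1 n1 m2 n2 H G K [le [j [i lt]]]; split=> [j' i'|].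
    rewrite !path_mx_hcomp.
    by case: (ord_sumP i') => u; case: (ord_sumP j') => x; rewrite !(ord_caseL, ord_caseR).
  by exists (rshift _ j), (rshift _ i); rewrite !path_mx_hcomp !ord_caseR.
Qed.

Lemma more_branching_local : local_relation more_branching.
Proof.
split; rewrite /more_branching.
- by move=> m n H G G' iso; rewrite (branching_iso iso).
- by move=> m n s t H G.
- by move=> m n l H G K; rewrite !branching_vcomp ltn_add2r.
- by move=> m n l H G K; rewrite !branching_vcomp ltn_add2l.
- by move=> m1 n1 m2 n2 H G K; rewrite !branching_hcomp ltn_add2r.
- by move=> m1 n1 m2 n2 H G K; rewrite !branching_hcomp ltn_add2l.
Qed.

Lemma fewer_paths_pth m n (H G : graph m n) : fewer_paths H G -> pth H < pth G.
Proof.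
case=> le [j [i lt]]; rewrite !pthE; apply: (@sum_lt _ _ _ j) => [x|].
  by apply: leq_sum.
exact: (@sum_lt _ _ _ i).
Qed.

Lemma same_profile_pth m n (H G : graph m n) : same_profile H G -> pth H = pth G.
Proof.
by case=> pE _; rewrite !pthE; apply: eq_bigr => j _; apply: eq_bigr => i _.
Qed.

Lemma pth_iso m n : graph_invariant (fun G : graph m n => pth G).
Proof.
move=> G G' iso; rewrite !pthE; apply: eq_bigr => j _; apply: eq_bigr => i _.
exact: path_mx_iso.
Qed.

Lemma pth_corolla m n hm hn hmn : pth (@corolla_graph m n hm hn hmn) = m * n.
Proof.
rewrite pthE; under eq_bigr => j _ do under eq_bigr => i _ do rewrite path_mx_corolla.
by rewrite !sum_nat_const !card_ord muln1.
Qed.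

Context (k : fieldType) (E : bicollection k).

(** For the vertical composition, the sum of the entries of a matrix product is
    the sum of [c * r] over the middle legs, with [c] a column sum and [r] a row
    sum; both are positive, so [c * r >= c + r - 1]. *)
Lemma branching_pth_dgraph m n (D : dgraph E m n) : branching D + n <= pth D.
Proof.
elim: (all_built D) => {m n D}
  [|m n d hm hn hmn e|m n s t A _ IH|m1 n1 m2 n2 A B _ IHA _ IHB
  |m n l A B _ IHA _ IHB|m n A B f r l i _ IH].
- by rewrite pthE !big_ord1 path_mx_unit branching_unit.
- rewrite pth_corolla branching_corolla; move: hm hn; clear; nia.
- rewrite branching_relabel; apply: (leq_trans IH); rewrite !pthE.
  rewrite (reindex_inj (perm_inj (s := s))) /=; apply/eq_leq/eq_bigr => j _.
  rewrite (reindex_inj (perm_inj (s := t^-1%g))) /=; apply: eq_bigr => i' _.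
  by rewrite path_mx_relabel.
- rewrite branching_hcomp addnACA; apply: (leq_trans (leq_add IHA IHB)).
  rewrite !pthE big_split_ord /=; apply: leq_add; apply: leq_sum => j _;
    rewrite big_split_ord /=.
    apply: leq_trans (leq_addr _ _); apply: leq_sum => i' _.
    by rewrite path_mx_hcomp !ord_caseL.
  apply: leq_trans (leq_addl _ _); apply: leq_sum => i' _.
  by rewrite path_mx_hcomp !ord_caseR.
- rewrite branching_vcomp; apply: (@leq_trans (pth A + pth B - n)); first by move: IHA IHB; lia.
  rewrite leq_subLR !pthE exchange_big /= -big_split /=.
  have -> : \sum_(j < m) \sum_(i < l) path_mx (vcomp_dgraph A B) j i
    = \sum_(u < n) (\sum_(j < m) path_mx A j u) * (\sum_(i < l) path_mx B u i).
    under eq_bigr => j _ do under eq_bigr => i _ do rewrite path_mx_vcomp.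
    under eq_bigr => j _ do rewrite exchange_big.
    rewrite exchange_big /=; apply: eq_bigr => u _; rewrite big_distrl /=.
    by apply: eq_bigr => j _; rewrite big_distrr.
  rewrite -[X in _ <= X + _]card_ord -sum1_card -big_split /=; apply: leq_sum => u _.
  have [j ju] := path_mx_col A u; have [i ui] := path_mx_row B u.
  have : 0 < \sum_(j < m) path_mx A j u by rewrite (bigD1 j) //= ltn_addr.
  have : 0 < \sum_(i < l) path_mx B u i by rewrite (bigD1 i) //= ltn_addr.
  by set a := \sum_j _; set b := \sum_i _; nia.
- have iso := dgraph_iso_isomorphic i.
  by rewrite (branching_iso iso) (pth_iso iso).
Qed.

End LocalRelations.

(** * Comparing a differential with its half part *)

Section HalfPart.
Local Open Scope ring_scope.
Context (k : fieldType) (E : bicollection k).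
Local Notation F := (free_prop E).

Lemma contractible_inv m n : graph_invariant (fun G : graph m n => contractible G).
Proof. by move=> G G' iso; rewrite /contractible (cmp_iso iso) (gen_iso iso). Qed.

(** A tree has at most one directed path between two legs, and exactly one in the
    absence of bad edges. *)
Lemma half_same_profile m n hm hn hmn (G : graph m n) :
  contractible G && ~~ has_bad_edge G -> same_profile G (@corolla_graph m n hm hn hmn).
Proof.
case/andP=> cG nb; split.
  move=> j i; rewrite path_mx_corolla; apply/eqP; rewrite eqn_leq tree_path_mx_le1 //=.
  by case/andP: cG => c0 _; apply: nobad_path_mx_gt0.
by move: cG; rewrite contractible_branching branching_corolla => /andP[_ /eqP].
Qed.

Lemma bad_fewer_paths m n hm hn hmn (G : graph m n) :
  contractible G && has_bad_edge G -> fewer_paths G (@corolla_graph m n hm hn hmn).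
Proof.
case/andP=> cG /(tree_bad_edge cG)[j [i z]]; split.
  by move=> j' i'; rewrite path_mx_corolla tree_path_mx_le1.
by exists j, i; rewrite path_mx_corolla z.
Qed.

Lemma cg_not_contractible m n (G : graph m n) :
  (0 < cmp G + gen_grading G)%N -> ~~ contractible G.
Proof. by rewrite /contractible -addn_eq0 lt0n. Qed.

(** Separates the two components that [d - d0] has on a generator. *)
Lemma bad_part m n (y z : freemod E m n) :
  in_bad y -> in_cg z -> gproj (fun G => contractible G) (y + z) = y.
Proof.
move=> yb zc; rewrite (linD _ _ (gproj_linear (@contractible_inv m n))).
have -> : gproj (fun G => contractible G) y = y.
  apply: (gproj_id (@contractible_inv m n)
    (A := fun G => contractible G && has_bad_edge G) _ yb).
  by move=> G /andP[].
have -> : gproj (fun G => contractible G) z = 0.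
  apply: (gproj0 (@contractible_inv m n)
    (A := fun G => (0 < cmp G + gen_grading G)%N) _ zc).
  by move=> G; apply: cg_not_contractible.
by rewrite addr0.
Qed.

Context (d d0 : endo F).
Hypothesis d_diff : is_differential d.
Hypothesis d0_half : is_half_part d d0.

Lemma half_part_split m n a hm hn hmn (e : E m n a) (g := generator hm hn hmn e) :
  exists y z : freemod E m n, [/\
    gspan (fun G => contractible G && ~~ has_bad_edge G) (@d0 m n g),
    gspan (fun G => contractible G && has_bad_edge G) y,
    gspan (fun G => (0 < cmp G + gen_grading G)%N) z
  & @d m n g - @d0 m n g = y + z].
Proof.
have [_ gen0] := d0_half; have [h0 [y yb [z zc dE]]] := gen0 m n a hm hn hmn e.
by exists y, z; split=> //; rewrite dE addrC !addrA addNr add0r.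
Qed.

Lemma half_part_same_profile m n (A : dgraph E m n) :
  gspan (fun H => same_profile H A) (@d0 m n (mono A)).
Proof.
have [der0 _] := d0_half; apply: (derivation_span same_profile_local der0).
move=> m' n' a hm hn hmn e; have [y [z [h0 _ _ _]]] := half_part_split hm hn hmn e.
by apply: gspan_sub h0 => G; apply: half_same_profile.
Qed.

Lemma half_part_defect_derivation : is_derivation (fun m n x => @d m n x - @d0 m n x : F m n).
Proof. by apply: derivationB; [case: d_diff | case: d0_half]. Qed.

Lemma half_part_defect_fewer_paths : maps_generators_to_D d ->
  forall m n (A : dgraph E m n),
    gspan (fun H => fewer_paths H A) (@d m n (mono A) - @d0 m n (mono A)).
Proof.
move=> dD; apply: (derivation_span fewer_paths_local half_part_defect_derivation).
move=> m n a hm hn hmn e; have [y [z [h0 yb zc xE]]] := half_part_split hm hn hmn e.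
set x := _ - _ in xE *.
suff -> : x = y by apply: gspan_sub yb => G; apply: bad_fewer_paths.
rewrite -[RHS](bad_part yb zc) -xE.
rewrite (gproj_id (@contractible_inv m n) (A := fun G => contractible G)) //.
apply: gspanB; first exact: dD.
by apply: gspan_sub h0 => G /andP[].
Qed.

(** The component [y] with bad edges lies both in the span of graphs with [m * n]
    paths and in that of graphs with fewer, so it vanishes. The other component
    is connected of positive first Betti number, which [gen_branching] reads as
    an excess of branching over the corolla. *)
Lemma half_part_defect_more_branching : is_connected d -> preserves_pth d ->
  forall m n (A : dgraph E m n),
    gspan (fun H => more_branching H A) (@d m n (mono A) - @d0 m n (mono A)).
Proof.
move=> dc dpth; apply: (derivation_span more_branching_local half_part_defect_derivation).
move=> m n a hm hn hmn e; have [y [z [h0 yb zc xE]]] := half_part_split hm hn hmn e.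
set x := _ - _ in xE *.
have mn_pth (G : graph m n) : contractible G && ~~ has_bad_edge G -> pth G == (m * n)%N.
  by move=> cG; rewrite -(pth_corolla hm hn hmn); apply/eqP/same_profile_pth/half_same_profile.
have x_pth : gspan (fun G : graph m n => pth G == (m * n)%N) x.
  apply: gspanB; last exact: gspan_sub h0.
  apply: dpth; apply: (@gspan_mono k E m n (fun G => pth G == (m * n)%N)).
  by rewrite /= pth_corolla.
have y0 : y = 0.
  have y_pth : gspan (fun G : graph m n => pth G == (m * n)%N) y.
    rewrite -(bad_part yb zc) -xE.
    by apply: gspan_sub (gproj_gspan (@contractible_inv m n) x_pth) => G [].
  have pinv : graph_invariant (fun G : graph m n => pth G == (m * n)%N).
    by move=> G G' /pth_iso->.
  apply: (gspan_false _ (gspan_and pinv yb y_pth)) => G [bG].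
  by have := fewer_paths_pth (bad_fewer_paths hm hn hmn bG); rewrite pth_corolla => /ltn_eqF->.
have x_conn : gspan (fun G : graph m n => cmp G == 0%N) x.
  apply: gspanB; first exact: dc.
  by apply: gspan_sub h0 => G /andP[/andP[]].
have cinv : graph_invariant (fun G : graph m n => cmp G == 0%N).
  by move=> G G' /cmp_iso->.
have x_cg : gspan (fun G => (0 < cmp G + gen_grading G)%N) x by rewrite xE y0 add0r.
apply: gspan_sub (gspan_and cinv x_cg x_conn) => G [cg cG].
have := gen_branching cG; rewrite /more_branching branching_corolla.
by move: cg; rewrite (eqP cG); lia.
Qed.

End HalfPart.

(** * Vanishing of homology and the free resolution *)

Lemma positive_homology_vanishes (k : fieldType) (E : bicollection k)
    (d d0 : endo (free_prop E)) :
  is_differential d -> is_half_part d d0 ->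
  (is_connected d /\ preserves_pth d) \/ maps_generators_to_D d ->
  forall i, homology_vanishes d0 i -> homology_vanishes d i.
Proof.
move=> dd half cases i.
have lin0 m n : linear (d0 m n) by apply: (der_linear (proj1 half)).
have same m n (A : dgraph E m n) := half_part_same_profile half A.
case: cases => [[dconn dpth]|dD].
(* the truncated subtraction is exact by [branching_pth_dgraph] *)
- apply: (@perturbation _ _ (fun m n G => pth G - branching G)) => //.
  + by move=> m n G G' iso; rewrite (pth_iso iso) (branching_iso iso).
  + move=> m n A; apply: gspan_sub (same m n A) => G SG.
    by rewrite (same_profile_pth SG) (proj2 SG).
  move=> m n A.
  have pinv : graph_invariant (fun G : graph m n => pth G == pth A).
    by move=> G G' iso; rewrite (pth_iso iso).
  have pA : gspan (fun G => pth G == pth A) (d m n (mono A) - d0 m n (mono A))%R.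
    apply: gspanB.
      apply: dpth; exact: (@gspan_mono _ _ _ _ (fun G => pth G == pth A)).
    by apply: gspan_sub (same m n A) => G /same_profile_pth->.
  have hA := half_part_defect_more_branching dd half dconn dpth A.
  have [r [c [y [yP ->]]]] := gspan_and pinv hA pA.
  exists r, c, y; split=> // t; have [D [hD /eqP pD] ->] := yP t; exists D => //.
  have := branching_pth_dgraph D; have /andP[_ n0] := graph_pos D.
  move: hD; rewrite /more_branching pD; lia.
- apply: (@perturbation _ _ (fun m n G => pth G)) => //.
  + by move=> m n; apply: pth_iso.
  + move=> m n A; apply: gspan_sub (same m n A) => G; exact: same_profile_pth.
  move=> m n A; apply: gspan_sub (half_part_defect_fewer_paths dd half dD A) => G.
  exact: fewer_paths_pth.
Qed.

(** An element of positive degree that also has degree 0 gives a relation between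
    homogeneous components of different degrees. *)
Lemma degree0_positive (k : fieldType) (P : PROP k) m n i (y : P m n) :
  concentrated_in_degree0 P -> 0 < i -> pr_deg i y -> y = 0%R.
Proof.
move=> P0 i0 yi; have gr := prop_grading (PROP_axioms P) m n.
pose f e : P m n := if e == 0 then y else if e == i then (- y)%R else 0%R.
have fd e : pr_deg e (f e).
  rewrite /f; case: eqP => [->|_]; first exact: P0.
  case: eqP => [->|_]; last exact: (grading0 gr).
  have := grading_lin gr (-1)%R yi (grading0 gr i).
  by rewrite addr0 scaleN1r.
apply: (grading_free gr (D := i.+1) (f := f) fd _ (d := 0)) => //.
rewrite (bigD1 ord0) //= (bigD1 (ord_max : 'I_i.+1)) /=; last by rewrite -lt0n.
rewrite big1 ?addr0.
  by rewrite /f eqxx eqn0Ngt i0 /= eqxx addrN.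
move=> e /andP[e0 ei]; rewrite -val_eqE /= in e0; rewrite -val_eqE /= in ei.
by rewrite /f (negbTE e0) (negbTE ei).
Qed.

Theorem corollary28 (k : fieldType) (k_char0 : [pchar k]%R =i pred0)
    (E : bicollection k)
    (d d0 : endo (free_prop E))
    (P : PROP k)
    (alpha : forall m n : nat, free_prop E m n -> P m n)
    (d_differential : is_differential d)
    (d0_half_part : is_half_part d d0)
    (P_degree0 : concentrated_in_degree0 P)
    (alpha_hom : is_dg_hom d (zero_endo (P := P)) alpha)
    (alpha_H0 : homology_iso d (zero_endo (P := P)) alpha 0)
    (d0_acyclic : forall i : nat, 0 < i -> homology_vanishes d0 i)
    (d_cases : (is_connected d /\ preserves_pth d) \/ maps_generators_to_D d) :
  is_free_resolution d (zero_endo (P := P)) alpha.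
Proof.
split=> // i; have [->//|i0] := posnP i => m n; split.
- move=> x x' [xi dx] [xi' dx'] _.
  have ld := der_linear (proj1 d_differential) (m := m) (n := n).
  have [|z zi] := @positive_homology_vanishes _ _ d d0 d_differential d0_half_part
    d_cases i (d0_acyclic i i0) m n ((-1) *: x' + x)%R.
  - by split; [apply: lspan_lin | rewrite ld dx dx' scaler0 addr0].
  by rewrite subr0 scaleN1r addrC; exists z.
- move=> y [yi _]; have y0 := degree0_positive P_degree0 i0 yi.
  exists 0%R; first split.
  + exact: lspan0.
  + exact: lin0 (der_linear (proj1 d_differential) (m := m) (n := n)).
  have gr := prop_grading (PROP_axioms P) m n.
  exists 0%R; first exact: (grading0 gr).
  by rewrite y0 (lin0 (hom_linear alpha_hom (m := m) (n := n))) subrr.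
Qed.
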